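(* Let $m\ge2$, $d\ge2$. For all $s\in(\mathbb{R}^+)^m$ with $0<|s|_{\ell_1}<1$ there exists an ergodic gradient Gibbs measure $\mu$ (for graph homomorphisms from $\mathbb{Z}^m$ to the $d$-regular tree $\mathcal T$) with slope $s$.
   Context: $\mathcal T$ is the $d$-regular tree, identified with the Cayley graph of $G=\langle\alpha_1,\dots,\alpha_d\mid\alpha_i^2=e\rangle$ (edges $\{w,w\alpha_i\}$ coloured by $\alpha_i$), with graph distance $d_{\mathcal T}$. A graph homomorphism $h:\mathbb{Z}^m\to\mathcal T$ satisfies $d_{\mathcal T}(h(x),h(y))=1$ whenever $|x-y|_{\ell_1}=1$. Its gradient (dual map) $\tilde h$ assigns to each oriented edge $e_{xy}$ of $\mathbb{Z}^m$ the colour $\alpha_i$ with $h(y)=h(x)\alpha_i$; it determines $h$ up to left multiplication by an element of $G$, and $d_{\mathcal T}(h(x),h(y))$ depends only on $\tilde h$. A gradient Gibbs measure is a probability measure $\mu$ on the space of gradients $\tilde h$ of graph homomorphisms $h:\mathbb{Z}^m\to\mathcal T$ (with the product $\sigma$-algebra) such that for every finite $\Lambda\subset\mathbb{Z}^m$, conditionally on $h$ outside $\Lambda$ (modulo left multiplication by $G$), the restriction of $h$ to $\Lambda$ is uniformly distributed among all the finitely many choices which together with the values outside $\Lambda$ form a graph homomorphism. It is ergodic if it is invariant and ergodic with respect to the translations of $\mathbb{Z}^m$. For an ergodic gradient Gibbs measure $\nu$ the limits $s_k(\nu)=\lim_{n\to\infty}\frac1nd_{\mathcal T}(h(0),h(n\vec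 i_k))$, $1\le k\le m$ ($\vec i_k$ the $k$-th standard basis vector), exist $\nu$-almost surely and are constant; $(s_1(\nu),\dots,s_m(\nu))$ is the slope of $\nu$. $\mathbb{R}^+=[0,\infty)$. *)

(* Defs.v *)
From HB Require Import structures.
From mathcomp Require Import all_boot all_order all_algebra.
From mathcomp Require Import all_classical all_reals all_analysis.
From mathcomp Require Import finmap zify.

Set Implicit Arguments.
Unset Strict Implicit.
Unset Printing Implicit Defensive.

Import Order.TTheory GRing.Theory Num.Theory.
Import numFieldNormedType.Exports.

Local Open Scope classical_set_scope.
Local Open Scope ring_scope.

(* The group < alpha_1, ..., alpha_d | alpha_i ^ 2 = e >, realised by its
   normal forms: words with no two equal consecutive letters.  The lemmas
   gen_mulgg and freeinv_universal below say that it has this presentation. *)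

Definition reduced (d : nat) (s : seq 'I_d) : bool :=
  sorted (fun i j => i != j) s.

Record freeinv (d : nat) := FreeInv { word :> seq 'I_d; _ : reduced word }.

HB.instance Definition _ (d : nat) := [isSub for @word d].
HB.instance Definition _ (d : nat) := [Choice of freeinv d by <:].

Section FreeInvGroup.
Variable d : nat.
Implicit Types (i j : 'I_d) (s t : seq 'I_d) (u v w : freeinv d).

Definition push i s : seq 'I_d :=
  if s is j :: t then if i == j then t else i :: s else [:: i].

Lemma reduced_push i s : reduced s -> reduced (push i s).
Proof.
case: s => [//|j t] /= rt; case: eqVneq => [_|ij] /=; first exact: path_sorted rt.
by rewrite ij.
Qed.

Lemma reduced_behead i s : reduced (i :: s) -> reduced s.
Proof. exact: path_sorted. Qed.

Lemma pushK i s : reduced s -> push i (push i s) = s.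
Proof.
case: s => [_|j t] /=; first by rewrite eqxx.
case: eqVneq => [<-|ij] rt /=; last by rewrite eqxx.
by case: t rt => [//|k t] /= /andP[/negbTE-> _].
Qed.

Lemma push_cons i s : reduced (i :: s) -> push i s = i :: s.
Proof. by case: s => [//|j t] /= /andP[/negbTE->]. Qed.

Lemma reduced_foldr s t : reduced t -> reduced (foldr push t s).
Proof. by move=> rt; elim: s => [//|i s IH] /=; exact: reduced_push. Qed.

Lemma word_reduced u : reduced u. Proof. by case: u. Qed.

Lemma foldr_push_nil s : reduced s -> foldr push [::] s = s.
Proof.
elim: s => [//|i s IH] rs /=.
by rewrite IH ?push_cons//; exact: reduced_behead rs.
Qed.

Lemma foldr_push i s t : reduced s -> reduced t ->
  foldr push t (push i s) = push i (foldr push t s).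
Proof.
case: s => [//|j s] /= rs rt; case: eqVneq => [<-|//].
by rewrite pushK// reduced_foldr.
Qed.

Lemma reduced_rev s : reduced s -> reduced (rev s).
Proof.
move=> rs; rewrite /reduced rev_sorted.
by rewrite (eq_sorted (e' := fun i j => i != j))// => i j /=; rewrite eq_sym.
Qed.

Definition freeinv_one : freeinv d := @FreeInv d [::] isT.
Definition freeinv_mul u v : freeinv d :=
  FreeInv (reduced_foldr u (word_reduced v)).
Definition freeinv_inv u : freeinv d := FreeInv (reduced_rev (word_reduced u)).

Lemma freeinv_mulA : associative freeinv_mul.
Proof.
move=> u v w; apply: val_inj => /=; elim: (word u) => [//|i s IH] /=.
by rewrite IH foldr_push ?reduced_foldr// word_reduced.
Qed.

Lemma freeinv_mul1 : left_id freeinv_one freeinv_mul.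
Proof. by move=> u; apply: val_inj. Qed.

Lemma freeinv_mulr1 : right_id freeinv_one freeinv_mul.
Proof. by move=> u; apply: val_inj; rewrite /= foldr_push_nil// word_reduced. Qed.

Lemma freeinv_mulV : left_inverse freeinv_one freeinv_inv freeinv_mul.
Proof.
move=> [s rs]; apply: val_inj => /=.
elim: s rs => [//|i s IH] rs; rewrite rev_cons foldr_rcons /= eqxx.
by apply: IH; exact: reduced_behead rs.
Qed.

Lemma freeinv_invK : involutive freeinv_inv.
Proof. by move=> u; apply: val_inj; rewrite /= revK. Qed.

Lemma freeinv_mulrV : right_inverse freeinv_one freeinv_inv freeinv_mul.
Proof. by move=> u; rewrite -{1}[u]freeinv_invK freeinv_mulV. Qed.

HB.instance Definition _ := isGroup.Build (freeinv d)
  freeinv_mulA freeinv_mul1 freeinv_mulr1 freeinv_mulV freeinv_mulrV.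

Definition gen i : freeinv d := @FreeInv d [:: i] isT.

Lemma gen_mulgg i : (gen i * gen i = 1)%g.
Proof. by apply: val_inj; rewrite /= eqxx. Qed.

Lemma freeinv_universal (H : groupType) (f : 'I_d -> H) :
  (forall i, f i * f i = 1)%g ->
  exists! F : freeinv d -> H,
    {morph F : u v / (u * v)%g} /\ forall i, F (gen i) = f i.
Proof.
move=> ff1; pose F0 s : H := foldr (fun i x => (f i * x)%g) 1%g s.
have F0push i s : F0 (push i s) = (f i * F0 s)%g.
  case: s => [//|j s] /=; case: eqVneq => [<-|//].
  by rewrite mulgA ff1 mul1g.
exists (fun u => F0 u); split.
  split=> [u v|i]; last by rewrite /= mulg1.
  rewrite /=; elim: (word u) => [|i s IH] /=; first by rewrite mul1g.
  by rewrite F0push IH mulgA.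
move=> F [FM Fg]; apply/funext => -[s rs] /=.
elim: s rs => [|i s IH] rs /=.
  have F11 : (F 1 * F 1 = F 1 * 1)%g by rewrite -FM !mulg1.
  by rewrite -(mulgI _ _ _ F11); congr F; apply: val_inj.
have rs' := reduced_behead rs.
rewrite (IH rs') -Fg -FM; congr F; apply: val_inj => /=.
by rewrite push_cons.
Qed.

End FreeInvGroup.

(* Junk value 0 when x and y are not connected. *)
Section GraphDistance.
Variables (V : eqType) (e : rel V).

Definition walk (x y : V) (n : nat) : bool :=
  `[< exists p, [/\ path e x p, last x p = y & size p = n] >].

Definition gdist (x y : V) : nat :=
  if pselect (exists n, walk x y n) is left w then ex_minn w else 0%N.

Lemma gdist_edge x y : x != y -> e x y -> gdist x y = 1%N.
Proof.
move=> xy exy; rewrite /gdist; case: pselect => [w|[]]; last first.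
  by exists 1%N; apply/asboolP; exists [:: y]; rewrite /= exy.
case: ex_minnP => -[|[//|n]] wn min_n.
  by move/asboolP: wn => [p [_ + /size0nil p0]]; rewrite p0 => /eqP/(negP xy).
have /min_n// : walk x y 1.
by apply/asboolP; exists [:: y]; rewrite /= exy.
Qed.

Lemma gdist1_edge x y : gdist x y = 1%N -> e x y.
Proof.
rewrite /gdist; case: pselect => // w; case: ex_minnP => n /asboolP[p [ep <- <-]] _.
by case: p ep => [//|z [|//]] /=; rewrite andbT.
Qed.

End GraphDistance.

Section Tree.
Variable d : nat.
Implicit Types u v w : freeinv d.

Definition cayley : rel (freeinv d) := fun u v => [exists i, v == (u * gen i)%g].

Definition tree_dist : freeinv d -> freeinv d -> nat := gdist cayley.

Lemma tree_dist1 u v : tree_dist u v = 1%N <-> exists i, v = (u * gen i)%g.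
Proof.
split=> [/gdist1_edge /existsP[i /eqP ->]|[i ->]]; first by exists i.
apply: gdist_edge; last by apply/existsP; exists i.
by rewrite -{1}[u]mulg1 (inj_eq (mulgI u)).
Qed.

End Tree.

Definition l1norm (m : nat) (x : 'rV[int]_m) : nat := (\sum_k `|x 0%R k|)%N.

Definition is_hom (m d : nat) (h : 'rV[int]_m -> freeinv d) : Prop :=
  forall x y, l1norm (x - y) = 1%N -> tree_dist (h x) (h y) = 1%N.

Record oedge (m : nat) := OEdge {
  src : 'rV[int]_m;
  tgt : 'rV[int]_m;
  oedgeP : l1norm (src - tgt) == 1%N }.

Definition dual_map (m d : nat) (h : 'rV[int]_m -> freeinv d)
    (c : oedge m -> 'I_d) : Prop :=
  forall e, h (tgt e) = (h (src e) * gen (c e))%g.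

(* The bound on d serves only to make this type nonempty, as the library
   requires of a measurable space. *)
Record gradient (m d : nat) (hd : (2 <= d)%N) := Gradient {
  colour :> oedge m -> 'I_d;
  gradientP : exists h, is_hom h /\ dual_map h colour }.

HB.instance Definition _ (m d : nat) (hd : (2 <= d)%N) :=
  gen_eqMixin (gradient m hd).
HB.instance Definition _ (m d : nat) (hd : (2 <= d)%N) :=
  gen_choiceMixin (gradient m hd).

Section GradientPointed.
Variables (m d : nat) (hd : (2 <= d)%N).

Let i0 : 'I_d := Ordinal (ltnW hd).
Let h0 (x : 'rV[int]_m) : freeinv d :=
  if odd (l1norm x) then gen i0 else 1%g.

Lemma odd_l1normB (x y : 'rV[int]_m) :
  odd (l1norm (x - y)) = odd (l1norm x) (+) odd (l1norm y).
Proof.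
have odd_absB (a b : int) : odd `|(a - b)%R| = odd `|a| (+) odd `|b|.
  have odd_absz (c : int) : (2 %| c)%Z = ~~ odd `|c| by rewrite -dvdn2.
  apply: negb_inj; rewrite -odd_absz.
  have [|oa] := boolP (odd `|a|); have [|ob] := boolP (odd `|b|) => /=; lia.
rewrite /l1norm; elim/big_ind3: _ => //= [a1 b1 c1 a2 b2 c2|k _].
  by rewrite !oddD => -> ->; rewrite addbACA.
by rewrite !mxE odd_absB.
Qed.

Lemma h0_step x y : l1norm (x - y) = 1%N -> h0 y = (h0 x * gen i0)%g.
Proof.
move=> xy; have := odd_l1normB x y; rewrite xy /h0 /=.
by case: odd; case: odd => //= _; rewrite ?gen_mulgg ?mul1g.
Qed.

Lemma const_gradientP :
  exists h : 'rV[int]_m -> freeinv d, is_hom h /\ dual_map h (fun=> i0).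
Proof.
exists h0; split=> [x y xy|e]; last exact/h0_step/eqP/oedgeP.
by apply/tree_dist1; exists i0; exact: h0_step.
Qed.

HB.instance Definition _ :=
  isPointed.Build (gradient m hd) (Gradient hd const_gradientP).

End GradientPointed.

Section Height.
Variables (m d : nat) (hd : (2 <= d)%N).
Implicit Types (g : gradient m hd) (h : 'rV[int]_m -> freeinv d).

Lemma height_ex g :
  exists h, [/\ is_hom h, dual_map h g & h 0 = 1%g].
Proof.
have [h [hh hg]] := gradientP g.
exists (fun x => (h 0)^-1 * h x)%g; split; last exact: mulVg.
- move=> x y /hh /tree_dist1 [i hi]; apply/tree_dist1; exists i.
  by rewrite hi mulgA.
- by move=> e; rewrite hg mulgA.
Qed.

Definition height g : 'rV[int]_m -> freeinv d := sval (cid (height_ex g)).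

Lemma heightP g : [/\ is_hom (height g), dual_map (height g) g & height g 0 = 1%g].
Proof. by rewrite /height; case: cid. Qed.

Lemma dual_map_height g h : dual_map h g ->
  forall x, h x = (h 0 * height g x)%g.
Proof.
move=> hg x; have [n] := ubnP (l1norm x); elim: n x => [//|n IH] x lt_xn.
have [_ kg k0] := heightP g.
have [->|/rV0Pn[k xk]] := eqVneq x 0; first by rewrite k0 mulg1.
pose y := x - Num.sg (x 0 k) *: delta_mx 0 k.
have yE j : y 0 j = x 0 j - Num.sg (x 0 k) *+ (j == k).
  by rewrite /y !mxE eqxx /= mulr_natr.
have lt_yx : (l1norm y < l1norm x)%N.
  rewrite /l1norm (bigD1 k)//= [X in (_ < X)%N](bigD1 k)//= yE eqxx mulr1n.
  rewrite (eq_bigr (fun j => `|x 0%R j|)%N) => [|j /negbTE jk]; last first.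
    by rewrite yE jk subr0.
  by rewrite ltn_add2r; case: (sgrP (x 0 k)) xk => //; lia.
have yx : l1norm (y - x) == 1%N.
  rewrite /l1norm (bigD1 k)//= !mxE big1 => [|j /negbTE jk]; last first.
    by rewrite !mxE eqxx /= jk mulr0 subr0 subrr.
  by rewrite !eqxx /=; case: (sgrP (x 0 k)) xk => //; lia.
have := hg (OEdge yx); have := kg (OEdge yx) => /= -> ->.
by rewrite mulgA IH//; exact: leq_trans lt_yx _.
Qed.

End Height.

Section GibbsMeasures.
Variables (R : realType) (m d : nat) (hd : (2 <= d)%N).
Implicit Types (g : gradient m hd) (h : 'rV[int]_m -> freeinv d)
  (L : set 'rV[int]_m).

Definition cylinders : set (set (gradient m hd)) :=
  [set A | exists (e : oedge m) (c : 'I_d), A = [set g : gradient m hd | g e = c]].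

Definition gradient_space := g_sigma_algebraType cylinders.

Lemma shift_oedgeP (v : 'rV[int]_m) (e : oedge m) :
  l1norm ((src e + v) - (tgt e + v)) == 1%N.
Proof. by rewrite opprD addrACA subrr addr0 oedgeP. Qed.

Definition shift_oedge v e := OEdge (shift_oedgeP v e).

Lemma translateP v g :
  exists h, is_hom h /\ dual_map h (fun e => g (shift_oedge v e)).
Proof.
have [h [hh hg]] := gradientP g; exists (fun x => h (x + v)); split.
- by move=> x y xy; apply: hh; rewrite opprD addrACA subrr addr0.
- by move=> e; exact: (hg (shift_oedge v e)).
Qed.

Definition translate v g : gradient m hd := Gradient hd (translateP v g).

(* The sigma-algebra of h outside L, modulo left multiplication: it is
   generated by all h(x)^-1 h(y) with x, y outside L, not merely by the
   gradient on the edges outside L, since the complement of L may be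
   disconnected. *)
Definition outside L : set (set gradient_space) :=
  <<s [set A | exists x y w, [/\ ~ L x, ~ L y &
         A = [set g | (height g x)^-1 * height g y = w]%g]] >>.

Definition choices L h : set ('rV[int]_m -> freeinv d) :=
  [set h' | is_hom h' /\ forall x, ~ L x -> h' x = h x].

(* The probability that the gradient lies in A when h is redrawn uniformly
   in L; choices L h is finite when L is finite and m > 0. *)
Definition uniform_prob L h (A : set gradient_space) : R :=
  #|` fset_set (choices L h `&` [set h' | exists2 g, A g & dual_map h' g])|%N%:R
    / #|` fset_set (choices L h)|%N%:R.

Section Measure.
Variable mu : probability gradient_space R.

(* f is a version of the conditional probability mu(A | F) *)
Definition is_cond_prob (F : set (set gradient_space)) (A : set gradient_space)
    (f : gradient_space -> R) : Prop :=
  (forall Y : set R, measurable Y -> F (f @^-1` Y)) /\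
  (forall B, F B -> (\int[mu]_(g in B) (f g)%:E = mu (A `&` B))%E).

Definition gradient_gibbs : Prop :=
  forall L, finite_set L -> forall A : set gradient_space, measurable A ->
    is_cond_prob (outside L) A (fun g => uniform_prob L (height g) A).

Definition translation_invariant : Prop :=
  forall v (A : set gradient_space), measurable A ->
    mu (translate v @^-1` A) = mu A.

Definition ergodic : Prop :=
  translation_invariant /\
  forall A : set gradient_space, measurable A ->
    (forall v, translate v @^-1` A = A) -> mu A = 0%E \/ mu A = 1%E.

Definition has_slope (s : 'I_m -> R) : Prop :=
  forall k, {ae mu, forall g,
    ((tree_dist (height g 0) (height g (delta_mx 0 k *+ n)))%:R / n%:R : R)
      @[n --> \oo] --> s k}.

End Measure.
End GibbsMeasures.

(* Main.v *)
(* Fix the axis of the translation g = alpha_1 alpha_2 and the Busemann function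
   b of one of its ends.  On the torus of side N = 2M take the uniform measure on
   the homomorphisms with h(x + N e_k) = g^(p_k) h(x), where p_k = floor(M s_k);
   p_k > 0 for some k forces h to return to the axis, so that, up to powers of g,
   there are finitely many.  This measure is invariant under translations and
   under resampling in small sets, and b(h(n e_k)) - b(h(0)) has mean n p_k / M
   for even n.  Its variance is at most 2n: the number of h with given heights
   b o h satisfies the FKG lattice condition (an element of the tree is recorded
   by the labels of its ancestors, and labels are subtracted in Z/(d-1)), so,
   revealing the heights along the segment one by one, each conditional mean is
   monotone in the revealed height and changes by at most 2 when it changes by 2.
   Hence d(h(0), h(n e_k)) = n p_k / M + O(n^(2/3)) in quadratic mean.  A limit
   M -> oo is a translation invariant Gibbs measure mu0 with
   sum_j E(d(h(0), h(n_j e_k)) / n_j - s_k)^2 < oo for n_j = (2j)^3.  Among the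
   invariant measures, a minimiser of this sum plus a strictly concave term is
   ergodic, and it has slope s by Borel-Cantelli and interpolation. *)

Require Import Defs.
From HB Require Import structures.
From mathcomp Require Import all_boot all_order all_algebra.
From mathcomp Require Import all_classical all_reals all_analysis.
From mathcomp Require Import finmap zify ring lra measurable_realfun.

Set Implicit Arguments.
Unset Strict Implicit.
Unset Printing Implicit Defensive.

Import Order.TTheory GRing.Theory Num.Theory.
Import numFieldNormedType.Exports.

Local Open Scope classical_set_scope.
Local Open Scope ring_scope.

(** * The tree and its Busemann function *)

(** Distances in the tree have no lattice structure, the levels of one end do: maxima and minima of
    heights of equal parity again change by one along edges. Moreover the axis translation adds 2 to
    all heights at once, which turns monotonicity of the conditional means into a Lipschitz bound.
    Heights do not determine the homomorphism, so the lattice condition compares numbers of lifts;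
    it comes from an injection of pairs of lifts that uses a reference pair in each fibre of the
    join. Passing from heights to distances requires the maximal height along the segment. In place
    of a maximal inequality it is bounded through the sum of the square deviations at n / r grid
    points, each of order n, and by r ^ 2 for the mesh; n = J ^ 3 and r = J ^ 2 balance both at J ^
    4, so the square error of the distance divided by n is of order J ^ -2, which is summable. The
    Gibbs property is encoded as invariance under local involutions: this is a condition on local
    events, and it survives both limits and conditioning on translation invariant events. *)

Section Words.
Variable d : nat.
Implicit Types (u v w : freeinv d) (i j : 'I_d).

Lemma genM_inj i j : gen i = gen j -> i = j.
Proof. by move=> /(congr1 (@word d)) [->]. Qed.

Lemma genV i : ((gen i)^-1 = gen i)%g.
Proof. by apply: (mulgI (gen i)); rewrite mulgV gen_mulgg. Qed.

Lemma mulgenK u i : (u * gen i * gen i = u)%g.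
Proof. by rewrite -mulgA gen_mulgg mulg1. Qed.

Lemma word_genM i u : word (gen i * u)%g = push i (word u).
Proof. by []. Qed.

Lemma word_mul u v : word (u * v)%g = foldr (@push d) (word v) (word u).
Proof. by []. Qed.

Lemma size_push i s : (size (push i s) <= (size s).+1)%N.
Proof. by case: s => [//|j s] /=; case: ifP => _ /=; lia. Qed.

Lemma size_word_inv u : size (word u^-1%g) = size (word u).
Proof. exact: size_rev. Qed.

Lemma size_wordM u v : (size (word (u * v)%g) <= size (word u) + size (word v))%N.
Proof.
rewrite word_mul; elim: (word u) => [//|i s IH] /=.
exact: leq_trans (size_push _ _) _.
Qed.

Lemma gen_indl (P : freeinv d -> Prop) :
  P 1%g -> (forall u i, P u -> P (gen i * u)%g) -> forall u, P u.
Proof.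
move=> P1 PM [s rs]; elim: s rs => [|i s IH] rs.
  by rewrite (_ : FreeInv rs = 1%g)//; exact: val_inj.
have rs' := reduced_behead rs.
rewrite (_ : FreeInv rs = (gen i * FreeInv rs')%g); first exact: PM.
by apply: val_inj; rewrite /= push_cons.
Qed.

Lemma gen_indr (P : freeinv d -> Prop) :
  P 1%g -> (forall u i, P u -> P (u * gen i)%g) -> forall u, P u.
Proof.
move=> P1 PM u; rewrite -[u]invgK; elim/gen_indl: u^-1%g => [|v i]; first by rewrite invg1.
by rewrite invgM genV; exact: PM.
Qed.

Lemma path_cayley u (s : seq 'I_d) :
  path (@cayley d) u (scanl (fun v i => v * gen i)%g u s).
Proof. by elim: s u => [//|i s IH] u /=; rewrite IH andbT; apply/existsP; exists i. Qed.

Lemma last_scanl_gen u v :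
  last u (scanl (fun v i => v * gen i)%g u (word v)) = (u * v)%g.
Proof.
case: v => s rs; rewrite /=; elim: s rs u => [|i s IH] rs u /=.
  by rewrite (_ : FreeInv rs = 1%g) ?mulg1//; exact: val_inj.
rewrite (IH (reduced_behead rs)) -mulgA; congr (_ * _)%g.
by apply: val_inj; rewrite /= push_cons.
Qed.

Lemma path_cayley_size u p : path (@cayley d) u p ->
  (size (word (u^-1 * last u p)%g) <= size p)%N.
Proof.
elim: p u => [|v p IH] u; first by rewrite [last _ _]/= mulVg.
rewrite [path _ _ _]/= [last _ _]/= => /andP[/existsP[i /eqP uv] /IH].
rewrite -ltnS => /(leq_trans _); apply.
have -> : (u^-1 * last v p = gen i * (v^-1 * last v p))%g.
  by rewrite uv invgM genV !mulgA gen_mulgg mul1g.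
by rewrite word_genM; exact: size_push.
Qed.

(** A walk spelling [u^-1 * v] realises this length, and one edge of a walk changes the length of a
    reduced word by at most one. *)
Lemma tree_distE u v : tree_dist u v = size (word (u^-1 * v)%g).
Proof.
rewrite /tree_dist /gdist; case: pselect => [w|[]]; last first.
  exists (size (word (u^-1 * v)%g)); apply/asboolP.
  exists (scanl (fun v i => v * gen i)%g u (word (u^-1 * v)%g)); split.
  - exact: path_cayley.
  - by rewrite last_scanl_gen mulgA mulgV mul1g.
  - by rewrite size_scanl.
case: ex_minnP => n /asboolP[p [pp lp sp]] nmin; apply/eqP; rewrite eqn_leq.
apply/andP; split; last by rewrite -lp -sp; exact: path_cayley_size.
apply: nmin; apply/asboolP.
exists (scanl (fun v i => v * gen i)%g u (word (u^-1 * v)%g)); split.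
- exact: path_cayley.
- by rewrite last_scanl_gen mulgA mulgV mul1g.
- by rewrite size_scanl.
Qed.

Lemma tree_dist_mull w u v : tree_dist (w * u)%g (w * v)%g = tree_dist u v.
Proof. by rewrite !tree_distE invgM -!mulgA (mulgA w^-1%g) mulVg mul1g. Qed.

Lemma tree_distC u v : tree_dist u v = tree_dist v u.
Proof. by rewrite !tree_distE -size_word_inv invgM invgK. Qed.

Lemma tree_distxx u : tree_dist u u = 0%N.
Proof. by rewrite tree_distE mulVg. Qed.

Lemma tree_dist_triangle v u w : (tree_dist u w <= tree_dist u v + tree_dist v w)%N.
Proof.
rewrite !tree_distE (_ : (u^-1 * w = (u^-1 * v) * (v^-1 * w))%g) ?size_wordM//.
by rewrite -mulgA (mulgA v) mulgV mul1g.
Qed.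

Definition adj u v : Prop := exists i, v = (u * gen i)%g.

Lemma adjC u v : adj u v -> adj v u.
Proof. by move=> [i ->]; exists i; rewrite mulgenK. Qed.

Lemma adj_mull w u v : adj u v -> adj (w * u)%g (w * v)%g.
Proof. by move=> [i ->]; exists i; rewrite mulgA. Qed.

Lemma adj_mullE w u v : adj (w * u)%g (w * v)%g -> adj u v.
Proof. by move=> /(adj_mull w^-1%g); rewrite !mulgA mulVg !mul1g. Qed.

End Words.

HB.instance Definition _ (d : nat) := [Countable of freeinv d by <:].

(* The Busemann function of the end [ax n], n -> oo, of the axis of the
   translation c0 c1, read off the geodesics from u to [ax n]. *)
Section Busemann.
Variable q : nat.
Notation d := q.+2.
Notation G := (freeinv d).
Implicit Types (u v w : G) (i : 'I_d) (k t : int).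

Definition c0 : 'I_d := ord0.
Definition c1 : 'I_d := Ordinal (isT : (1 < q.+2)%N).

Definition gz t : G :=
  match t with
  | Posz n => ((gen c0 * gen c1) ^+ n)%g
  | Negz n => ((gen c0 * gen c1) ^- n.+1)%g
  end.

Lemma gz0 : gz 0 = 1%g. Proof. by []. Qed.

Lemma gzS t : gz (t + 1) = (gz t * (gen c0 * gen c1))%g.
Proof.
case: t => [n|[|n]].
- by rewrite -PoszD addn1 /gz expgSr.
- by rewrite (_ : Negz 0 + 1 = 0)// /gz expg1 mulVg.
- rewrite (_ : Negz n.+1 + 1 = Negz n); last by rewrite !NegzE; lia.
  by rewrite /gz [in RHS]expgS invgM -mulgA mulVg mulg1.
Qed.

Lemma gzD t t' : gz (t + t') = (gz t * gz t')%g.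
Proof.
elim/int_ind: t' => [|n IH|n IH]; first by rewrite addr0 mulg1.
  have -> : (n.+1)%:Z = n%:Z + 1 by lia.
  by rewrite addrA !gzS IH -[LHS]mulgA.
have := gzS (t + - (n.+1)%:Z); have := gzS (- (n.+1)%:Z).
have -> : - (n.+1)%:Z + 1 = - n%:Z by lia.
have -> : t - (n.+1)%:Z + 1 = t - n%:Z by lia.
by rewrite IH => -> /eqP; rewrite mulgA => /eqP /mulIg ->.
Qed.

Lemma gzN t : gz (- t) = (gz t)^-1%g.
Proof. by apply: (mulgI (gz t)); rewrite mulgV -gzD subrr. Qed.

Lemma gzC t t' : (gz t * gz t' = gz t' * gz t)%g.
Proof. by rewrite -!gzD addrC. Qed.

Definition axcol k : 'I_d := if odd `|k|%N then c1 else c0.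

Definition ax k : G :=
  (gz (k %/ 2)%Z * (if odd `|k|%N then gen c0 else 1))%g.

Lemma ax0 : ax 0 = 1%g. Proof. by rewrite /ax /= mulg1. Qed.

Lemma axS k : ax (k + 1) = (ax k * gen (axcol k))%g.
Proof.
rewrite /ax /axcol; have -> : odd `|(k + 1)%R|%N = ~~ odd `|k|%N by lia.
have [ok|ek] := boolP (odd `|k|%N) => /=.
  have -> : ((k + 1) %/ 2)%Z = (k %/ 2)%Z + 1 by lia.
  by rewrite gzS mulg1 mulgA.
by have -> : ((k + 1) %/ 2)%Z = (k %/ 2)%Z; [lia|rewrite mulg1].
Qed.

Lemma gz_ax t k : (gz t * ax k = ax (k + 2 * t))%g.
Proof.
rewrite /ax mulgA -gzD; have -> : odd `|(k + 2 * t)%R|%N = odd `|k|%N by lia.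
by congr (gz _ * _)%g; lia.
Qed.

Lemma word_ax (n : nat) : word (ax n) = [seq axcol (Posz j) | j <- iota 0 n].
Proof.
have rd : reduced [seq axcol (Posz j) | j <- iota 0 n].
  case: n => [//|n]; rewrite /reduced /=; elim: n 0%N => [//|n IH] j /=.
  by rewrite IH andbT /axcol /=; case: odd.
elim: n rd => [|n IH] rd; first by rewrite ax0.
have -> : (n.+1)%:Z = n%:Z + 1 by lia.
rewrite axS word_mul.
have ioS : iota 0 n.+1 = rcons (iota 0 n) n by rewrite -cats1 -[n.+1]addn1 iotaD.
move: rd; rewrite ioS map_rcons => rd.
rewrite IH; last by move: rd; rewrite /reduced -cats1 => /cat_sorted2[].
have -> : word (gen (axcol n)) = foldr (@push d) [::] [:: axcol n] by [].
by rewrite -foldr_cat cats1 foldr_push_nil.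
Qed.

(** The letters of [s] are too few to cancel a longer axis word, so a further axis letter is merely
    appended and the first letter stays. Hence the limits behind [bus] and [par] are reached at a
    finite stage. *)
Lemma foldr_ax_stable (s : seq 'I_d) (n : nat) : (size s < n)%N ->
  let W n := foldr (@push d) (word (ax n)) s in
  W n.+1 = rcons (W n) (axcol n) /\ (0 < size (W n))%N.
Proof.
elim: s n => [|i s IH] n sn W.
  have ioS : iota 0 n.+1 = rcons (iota 0 n) n by rewrite -cats1 -[n.+1]addn1 iotaD.
  by rewrite /W !word_ax ioS map_rcons; split=> //; rewrite [foldr _ _ _]/= size_map size_iota.
have WE k : W k = push i (foldr (@push d) (word (ax k)) s) by [].
have [] := IH n; first exact: ltnW.
have [] := IH n.-1; first by move: sn => /=; case: n.
have -> : n.-1.+1 = n by case: n sn.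
rewrite !WE => -> + ->; set V := foldr _ _ _; case: V => [//|j V] _ _ /=.
by case: eqVneq => _ /=; rewrite ?size_rcons.
Qed.

Definition busN u : nat := (size (word u)).+1.
(** The usual Busemann function with the opposite sign: it grows by one along each step towards the
    end. [par u] is the first colour on the way to the end; its default [c0] is never taken, by
    [busparP]. *)
Definition bus u : int := (busN u)%:Z - (size (word (u^-1 * ax (busN u))%g))%:Z.
Definition par u : 'I_d := head c0 (word (u^-1 * ax (busN u))%g).

Lemma busparP u (n : nat) : (busN u <= n)%N ->
  [/\ bus u = n%:Z - (size (word (u^-1 * ax n)%g))%:Z,
      par u = head c0 (word (u^-1 * ax n)%g) &
      (0 < size (word (u^-1 * ax n)%g))%N].
Proof.
have su : size (word u^-1%g) = size (word u) by exact: size_word_inv.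
move=> /subnKC <-; elim: (n - _)%N => [|k [-> -> sgt0]].
    rewrite addn0; split=> //; rewrite word_mul.
  by have [|_] := @foldr_ax_stable (word u^-1%g) (busN u); first by rewrite su.
have [|+ _] := @foldr_ax_stable (word u^-1%g) (busN u + k).
  by rewrite su leq_addr.
rewrite -!word_mul addnS => ->; rewrite size_rcons; split=> //.
  by rewrite !intS opprD addrACA subrr add0r.
by case: (word _) sgt0.
Qed.

Lemma bus_gen u i : bus (u * gen i)%g = bus u + (if i == par u then 1 else - 1).
Proof.
pose n := maxn (busN u) (busN (u * gen i)%g).
have [-> _ _] := @busparP (u * gen i)%g n (leq_maxr _ _).
have [-> -> +] := @busparP u n (leq_maxl _ _).
rewrite invgM genV -mulgA word_genM; case: (word _) => [//|j s] _ /=.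
by case: eqVneq => _ /=; lia.
Qed.

Lemma par_gen u i : i != par u -> par (u * gen i)%g = i.
Proof.
pose n := maxn (busN u) (busN (u * gen i)%g).
have [_ -> _] := @busparP (u * gen i)%g n (leq_maxr _ _).
have [_ -> +] := @busparP u n (leq_maxl _ _).
rewrite invgM genV -mulgA word_genM; case: (word _) => [//|j s] _ /=.
by case: eqVneq.
Qed.

Lemma buspar_gz t u : bus (gz t * u)%g = bus u + 2 * t /\ par (gz t * u)%g = par u.
Proof.
pose n := (busN u + busN (gz t * u)%g + 2 * `|t|%N)%N.
have [|-> -> _] := @busparP (gz t * u)%g n; first by rewrite /n; lia.
have [|-> -> _] := @busparP u `|(n%:Z - 2 * t)%R|%N; first by rewrite /n; lia.
have nt : n%:Z - 2 * t = `|(n%:Z - 2 * t)%R|%N by rewrite /n; lia.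
have -> : ((gz t * u)^-1 * ax n = u^-1 * ax `|(n%:Z - 2 * t)%R|%N)%g.
  by rewrite invgM -gzN -mulgA gz_ax -nt; congr (_ * ax _)%g; lia.
by split=> //; rewrite -nt; lia.
Qed.

Lemma bus_gz t u : bus (gz t * u)%g = bus u + 2 * t. Proof. by case: (buspar_gz t u). Qed.
Lemma par_gz t u : par (gz t * u)%g = par u. Proof. by case: (buspar_gz t u). Qed.

Lemma buspar1 : bus 1%g = 0 /\ par 1%g = c0.
Proof.
have [|-> -> _] := @busparP 1%g 1%N; first by [].
by rewrite invg1 mul1g word_ax.
Qed.

Lemma buspar_ax k : bus (ax k) = k /\ par (ax k) = axcol k.
Proof.
rewrite {1 2}/ax bus_gz par_gz /axcol; have [b1 p1] := buspar1.
have [ok|ek] := boolP (odd `|k|%N); last by rewrite b1 p1; split=> //; lia.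
have g1 : gen c0 = (1 * gen c0)%g by rewrite mul1g.
(* [par_gen] covers only steps away from the end, so this vertex is reached from [gz 1] through the
   colour [c1]. *)
have g2 : gen c0 = (gz 1 * (1 * gen c1))%g.
  by rewrite mul1g /gz /= expg1 mulgenK.
split; first by rewrite g1 bus_gen b1 p1 eqxx; lia.
by rewrite g2 par_gz par_gen // p1.
Qed.

Definition parent u : G := (u * gen (par u))%g.

Lemma bus_parent u : bus (parent u) = bus u + 1.
Proof. by rewrite bus_gen eqxx. Qed.

Lemma parent_gz t u : parent (gz t * u)%g = (gz t * parent u)%g.
Proof. by rewrite /parent par_gz mulgA. Qed.

Lemma parent_ax k : parent (ax k) = ax (k + 1).
Proof. by rewrite /parent (buspar_ax k).2 axS. Qed.

Lemma adj_parent u v : adj u v ->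
  (v = parent u /\ bus v = bus u + 1) \/ (u = parent v /\ bus v = bus u - 1).
Proof.
move=> [i ->]; have := bus_gen u i; have [->|ip] := eqVneq i (par u).
  by move=> b; left.
move=> b; right; split=> //; rewrite /parent par_gen//; last by rewrite mulgenK.
Qed.

Lemma bus_mul u v : `|bus (u * v)%g - bus u| <= (size (word v))%:Z.
Proof.
case: v => s rs /=; elim: s rs u => [|i s IH] rs u.
  by rewrite (_ : FreeInv rs = 1%g) ?mulg1 ?subrr//; exact: val_inj.
have rs' := reduced_behead rs.
rewrite (_ : FreeInv rs = (gen i * FreeInv rs')%g); last first.
  by apply: val_inj; rewrite /= push_cons.
have := IH rs' (u * gen i)%g; rewrite mulgA bus_gen /=.
by move: (bus (_ * FreeInv rs')%g) (bus u) (size s) => a b c; case: ifP => _; lia.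
Qed.

Lemma bus_lip u v : `|bus u - bus v| <= (tree_dist u v)%:Z.
Proof.
rewrite tree_distE distrC; have := bus_mul u (u^-1 * v)%g.
by rewrite mulgA mulgV mul1g.
Qed.

Definition anc (n : nat) u : G := iter n parent u.

Lemma bus_anc n u : bus (anc n u) = bus u + n%:Z.
Proof. by elim: n => [|n IH] /=; rewrite ?addr0// bus_parent IH; lia. Qed.

Lemma anc_gz n t u : anc n (gz t * u)%g = (gz t * anc n u)%g.
Proof. by elim: n => [//|n IH] /=; rewrite IH parent_gz. Qed.

Lemma ancS n u : anc n.+1 u = anc n (parent u).
Proof. by rewrite /anc iterSr. Qed.

Lemma anc_ax n k : anc n (ax k) = ax (k + n%:Z).
Proof. by elim: n => [|n IH] /=; rewrite ?addr0// IH parent_ax; congr ax; lia. Qed.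

Lemma tree_dist_anc n u : (tree_dist u (anc n u) <= n)%N.
Proof.
elim: n => [|n IH] /=; first by rewrite tree_distxx.
apply: leq_trans (tree_dist_triangle (anc n u) _ _) _.
by rewrite -(addn1 n) leq_add// tree_distE mulgA mulVg mul1g.
Qed.

(** A step to the parent does not delay the generation at which the line of ancestors has joined the
    axis, a step to a child delays it by one. *)
Lemma anc_axE u : exists n, forall k : nat, (n <= k)%N -> anc k u = ax (bus u + k%:Z).
Proof.
suff [n h] : exists n, anc n u = ax (bus u + n%:Z).
  exists n => k /subnK <-; rewrite /anc iterD -/(anc n u) h -/(anc _ _) anc_ax.
  by congr ax; lia.
elim/gen_indr: u => [|u i [n IH]]; first by exists 0%N; rewrite buspar1.1 /= ax0.
have [ip|ip] := eqVneq i (par u).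
  exists n; rewrite ip -/(parent u) -ancS /= IH parent_ax bus_parent; congr ax; lia.
exists n.+1; rewrite ancS /parent par_gen// mulgenK IH bus_gen (negbTE ip).
by congr ax; lia.
Qed.

(* The ancestor of u at level k; meaningful only if [bus u <= k]. *)
Definition up k u : G := anc `|(k - bus u)%R|%N u.

Lemma bus_up k u : bus u <= k -> bus (up k u) = k.
Proof. by move=> h; rewrite bus_anc; lia. Qed.

Lemma up_bus u : up (bus u) u = u. Proof. by rewrite /up subrr. Qed.

Lemma up_anc (n : nat) u : up (bus u + n%:Z) u = anc n u.
Proof. by rewrite /up addrAC subrr add0r. Qed.

Lemma up_gz k t u : up (k + 2 * t) (gz t * u)%g = (gz t * up k u)%g.
Proof. by rewrite /up bus_gz -anc_gz; congr anc; lia. Qed.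

Lemma up_parent k u : bus u + 1 <= k -> up k (parent u) = up k u.
Proof.
by move=> h; rewrite /up bus_parent -ancS; congr anc; lia.
Qed.

Lemma up_upD (n : nat) k u : bus u <= k -> up (k + n%:Z) u = anc n (up k u).
Proof. by move=> h; rewrite /up /anc -iterD; congr iter; lia. Qed.

Lemma up_adj k u v : adj u v -> bus u <= k -> bus v <= k -> up k u = up k v.
Proof.
by move=> /adj_parent[[-> b]|[-> b]] ku kv; rewrite up_parent//; move: ku kv; lia.
Qed.

(* The index of v among the q + 1 children of its parent; u is determined by
   [bus u] and the labels [lab u k], k >= bus u, of its ancestors. *)
Definition lb v : 'I_q.+1 := odflt ord0 (unlift (par (parent v)) (par v)).

Lemma par_parent v : par (parent v) != par v.
Proof.
have := bus_gen (parent v) (par v); rewrite bus_parent {1}/parent mulgenK eq_sym.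
by case: eqVneq => // _; lia.
Qed.

Definition child w (l : 'I_q.+1) : G := (w * gen (lift (par w) l))%g.

Lemma child_lb v : child (parent v) (lb v) = v.
Proof.
rewrite /child /lb; have [l hl ->] := unlift_some (par_parent v).
by rewrite /= -hl /parent mulgenK.
Qed.

Lemma par_child w l : par (child w l) = lift (par w) l.
Proof. by rewrite par_gen// eq_sym neq_lift. Qed.

Lemma parent_child w l : parent (child w l) = w.
Proof. by rewrite /parent par_child mulgenK. Qed.

Lemma lb_child w l : lb (child w l) = l.
Proof. by rewrite /lb parent_child par_child liftK. Qed.

Lemma bus_child w l : bus (child w l) = bus w - 1.
Proof. by have := bus_parent (child w l); rewrite parent_child => ->; lia. Qed.

Lemma lb_gz t v : lb (gz t * v)%g = lb v.
Proof. by rewrite /lb parent_gz !par_gz. Qed.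

Definition lab u k : 'I_q.+1 := lb (up k u).

Lemma lab_gz t u k : lab (gz t * u)%g (k + 2 * t) = lab u k.
Proof. by rewrite /lab up_gz lb_gz. Qed.

Lemma lab_adj u v k : adj u v -> bus u <= k -> bus v <= k -> lab u k = lab v k.
Proof. by move=> uv ku kv; rewrite /lab (up_adj uv). Qed.

Lemma lab_axE u : exists n : int, forall k, n <= k -> lab u k = lb (ax k).
Proof.
have [n h] := anc_axE u; exists (bus u + n%:Z) => k nk.
by rewrite /lab /up h; [congr (lb (ax _)); lia|lia].
Qed.

(** Both lines of ancestors end on the axis, hence meet; from the common ancestor the labels
    prescribe the same descent. *)
Lemma lab_inj u v : bus u = bus v ->
  (forall k, bus u <= k -> lab u k = lab v k) -> u = v.
Proof.
have [n hu] := anc_axE u; have [n' hv] := anc_axE v.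
move=> b; have : anc (n + n') u = anc (n + n') v by rewrite hu ?hv ?b// ?leq_addr ?leq_addl.
elim: (n + n')%N => [//|k IH] /= hk hl; apply: (IH _ hl).
rewrite -(child_lb (anc k u)) -(child_lb (anc k v)) hk; congr child.
have := hl (bus u + k%:Z); rewrite /lab up_anc b up_anc; apply.
by rewrite lerDl.
Qed.

(** The vertex is built downwards from [ax n], taking at each level the child with the prescribed
    label; an ancestor then gives the level [k]. *)
Lemma lab_ex (k : int) (f : int -> 'I_q.+1) (n : int) :
  (forall j, n <= j -> f j = lb (ax j)) ->
  exists u, bus u = k /\ forall j, k <= j -> lab u j = f j.
Proof.
move=> hf; suff H (t : nat) : exists u, bus u = n - t%:Z /\
    forall j, n - t%:Z <= j -> lab u j = f j.
  have [t kt] : exists t : nat, n - t%:Z <= k by exists `|(n - k)%R|%N; lia.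
  have [u [bu hu]] := H t; exists (up k u); split; first by rewrite bus_up// bu.
  move=> j kj; rewrite -hu; last by lia.
  have -> : j = k + `|(j - k)%R|%N%:Z by lia.
  have uk : bus u <= k by rewrite bu.
  rewrite /lab; congr lb; rewrite /up bus_anc.
  by rewrite /anc -iterD; congr iter; lia.
elim: t => [|t [u [bu hu]]].
  exists (ax n); rewrite (buspar_ax n).1 subr0; split=> // j nj.
  by rewrite hf// /lab /up (buspar_ax n).1 anc_ax; congr (lb (ax _)); lia.
pose u' := child u (f (n - t.+1%:Z)).
have bu' : bus u' = n - t.+1%:Z by rewrite bus_child bu; lia.
exists u'; split=> // j; rewrite le_eqVlt => /orP[/eqP <-|nj].
  by rewrite /lab -bu' up_bus lb_child -bu'.
rewrite -hu; last by lia.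
rewrite /lab -(parent_child u (f (n - t.+1%:Z))) up_parent//.
by rewrite bu'; lia.
Qed.

End Busemann.

(** * Homomorphisms and gradients *)

Section Homs.
Variables (m d : nat).
Notation site := 'rV[int]_m.
Implicit Types (h : site -> freeinv d) (x y : site).

Lemma l1norm_sym x y : l1norm (x - y) = l1norm (y - x).
Proof. by apply: eq_bigr => k _; rewrite !mxE distnC. Qed.

Lemma l1norm0 : l1norm (0 : site) = 0%N.
Proof. by rewrite /l1norm big1// => k _; rewrite mxE. Qed.

Lemma l1norm_step x : x != 0 ->
  exists2 y, (l1norm y).+1 = l1norm x & l1norm (y - x) = 1%N.
Proof.
move=> /rV0Pn[k xk]; exists (x - Num.sg (x 0 k) *: delta_mx 0 k).
  have yE j : (x - Num.sg (x 0 k) *: delta_mx 0 k) 0 j = x 0 j - Num.sg (x 0 k) *+ (j == k).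
    by rewrite !mxE eqxx /= mulr_natr.
  rewrite /l1norm (bigD1 k)//= [X in _ = X](bigD1 k)//= yE eqxx mulr1n.
  rewrite (eq_bigr (fun j => `|x 0%R j|)%N) => [|j /negbTE jk]; last first.
    by rewrite yE jk subr0.
  by rewrite -addSn; congr addn; case: (sgrP (x 0 k)) xk => //; lia.
rewrite /l1norm (bigD1 k)//= !mxE big1 => [|j /negbTE jk]; last first.
  by rewrite !mxE eqxx /= jk mulr0 subr0 subrr.
by rewrite !eqxx /=; case: (sgrP (x 0 k)) xk => //; lia.
Qed.

Lemma l1norm_delta (k : 'I_m) : l1norm (delta_mx 0 k : site) = 1%N.
Proof.
rewrite /l1norm (bigD1 k)//= !mxE !eqxx big1// => j /negbTE jk.
by rewrite mxE jk andbF.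
Qed.

Lemma l1norm_delta_mulrn (k : 'I_m) n : l1norm (delta_mx 0 k *+ n : site) = n.
Proof.
rewrite /l1norm (bigD1 k)//= big1 => [|j /negbTE jk].
  by rewrite addn0 mulmxnE mxE !eqxx mulr1n natz.
by rewrite mulmxnE mxE jk andbF /= mul0rn.
Qed.

Lemma is_homP h : is_hom h <-> forall x y, l1norm (x - y) = 1%N -> adj (h x) (h y).
Proof. by split=> hh x y /hh; rewrite tree_dist1. Qed.

Lemma hom_mull u h : is_hom h -> is_hom (fun x => u * h x)%g.
Proof. by move=> hh x y xy; rewrite tree_dist_mull; exact: hh. Qed.

Lemma hom_shift v h : is_hom h -> is_hom (fun x => h (x + v)).
Proof. by move=> hh x y xy; apply: hh; rewrite opprD addrACA subrr addr0. Qed.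

Lemma hom_lip h : is_hom h -> forall x y, (tree_dist (h x) (h y) <= l1norm (x - y))%N.
Proof.
move=> hh x y; have [n] := ubnP (l1norm (x - y)); elim: n x => [//|n IH] x xn.
have [/eqP|/l1norm_step[z zx zx1]] := eqVneq (x - y) 0.
  by rewrite subr_eq0 => /eqP ->; rewrite tree_distxx.
have xz : l1norm (x - (z + y)) = 1%N.
  by rewrite opprD addrA addrAC l1norm_sym.
apply: leq_trans (tree_dist_triangle (h (z + y)) _ _) _.
rewrite (hh _ _ xz) -zx -{2}(addrK y z) add1n ltnS; apply: IH.
by rewrite addrK; move: xn; rewrite -zx.
Qed.

End Homs.

Section Gradients.
Variables (m d : nat) (hd : (2 <= d)%N).
Notation site := 'rV[int]_m.
Notation grad := (gradient m hd).
Implicit Types (h : site -> freeinv d) (g : grad) (x y : site) (C : set grad).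

Lemma gradient_ext g g' : (forall e, g e = g' e) -> g = g'.
Proof.
case: g g' => [c hc] [c' hc'] /= /funext cc'; case: _ / cc' in hc' *.
by congr Gradient; exact: Prop_irrelevance.
Qed.

Lemma dual_map_ext h g g' : dual_map h g -> dual_map h g' -> g = g'.
Proof.
move=> hg hg'; apply: gradient_ext => e; apply: genM_inj; apply: (mulgI (h (src e))).
by rewrite -hg hg'.
Qed.

Lemma gradient_of_hom h : is_hom h -> exists g : grad, dual_map h g.
Proof.
move=> hh; have hc (e : oedge m) : exists i, h (tgt e) = (h (src e) * gen i)%g.
  by apply/tree_dist1/hh/eqP/oedgeP.
have [c hhc] := choice hc.
have hcP : exists h, is_hom h /\ dual_map h c by exists h.
by exists (Gradient hd hcP).
Qed.

(** A default gradient when [h] is not a homomorphism. *)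
Definition gr h : grad := get [set g : grad | dual_map h g].

Lemma grP h : is_hom h -> dual_map h (gr h).
Proof. by move=> /gradient_of_hom[g hg]; exact: (getPex (P := [set g : grad | dual_map h g])) (ex_intro _ g hg). Qed.

Lemma height_hom g : is_hom (height g). Proof. by case: (heightP g). Qed.
Lemma height0 g : height g 0 = 1%g. Proof. by case: (heightP g). Qed.
Lemma dual_height g : dual_map (height g) g. Proof. by case: (heightP g). Qed.

Lemma gr_dual h g : is_hom h -> dual_map h g -> gr h = g.
Proof. by move=> hh; apply: dual_map_ext; exact: grP. Qed.

Lemma gr_height g : gr (height g) = g.
Proof. by apply: gr_dual; [exact: height_hom|exact: dual_height]. Qed.

Lemma height_gr h x : is_hom h -> height (gr h) x = ((h 0)^-1 * h x)%g.
Proof. by move=> /grP hg; rewrite (dual_map_height hg x) mulgA mulVg mul1g. Qed.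

Lemma height_gr1 h : is_hom h -> h 0 = 1%g -> height (gr h) = h.
Proof. by move=> hh h0; apply/funext => x; rewrite height_gr// h0 invg1 mul1g. Qed.

Lemma height_inj g g' : height g =1 height g' -> g = g'.
Proof. by move=> /funext e; rewrite -(gr_height g) e gr_height. Qed.

Lemma gr_mull u h : is_hom h -> gr (fun x => u * h x)%g = gr h.
Proof.
move=> hh; apply: gr_dual; first exact: hom_mull.
by move=> e; rewrite (grP hh) mulgA.
Qed.

Lemma translate_gr v g : translate v g = gr (fun x => height g (x + v)).
Proof.
apply/esym/gr_dual; first exact/hom_shift/height_hom.
by move=> e; exact: (dual_height g (shift_oedge v e)).
Qed.

Lemma height_translate v g x :
  height (translate v g) x = ((height g v)^-1 * height g (x + v))%g.
Proof.
rewrite translate_gr height_gr ?add0r//; exact/hom_shift/height_hom.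
Qed.

Definition depends_on (r : seq site) C : Prop :=
  forall g g', {in r, height g =1 height g'} -> C g -> C g'.

(** These are the clopen events of the space of gradients, which is compact because an edge has
    finitely many colours. Limits of measures are taken on them. *)
Definition local C : Prop := exists r, depends_on r C.

Lemma depends_onS r r' C : {subset r <= r'} -> depends_on r C -> depends_on r' C.
Proof. by move=> rr' dC g g' gg'; apply: dC => x /rr'; exact: gg'. Qed.

Lemma localC C : local C -> local (~` C).
Proof.
move=> [r rC]; exists r => g g' gg' nC Cg'; apply: nC; apply: rC Cg' => x xr.
by rewrite gg'.
Qed.

Lemma localI C C' : local C -> local C' -> local (C `&` C').
Proof.
move=> [r rC] [r' rC']; exists (r ++ r') => g g' gg' [Cg C'g]; split.
- by apply: rC Cg => x xr; apply: gg'; rewrite mem_cat xr.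
- by apply: rC' C'g => x xr; apply: gg'; rewrite mem_cat xr orbT.
Qed.

Lemma localU C C' : local C -> local C' -> local (C `|` C').
Proof. by move=> lC lC'; rewrite -[X in local X]setCK setCU; apply/localC/localI; exact: localC. Qed.

Lemma local0 : local set0. Proof. by exists [::]. Qed.
Lemma localT : local setT. Proof. by exists [::]. Qed.

Lemma localD C C' : local C -> local C' -> local (C `\` C').
Proof. by move=> lC lC'; rewrite setDE; apply: localI => //; exact: localC. Qed.

Lemma local_height (P : freeinv d -> Prop) x : local [set g | P (height g x)].
Proof. by exists [:: x] => g g' /= e; rewrite (e x)// inE. Qed.

Definition cyl (l : seq (site * freeinv d)) : set grad :=
  [set g | forall p, p \in l -> height g p.1 = p.2].

Lemma local_cyl l : local (cyl l).
Proof.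
exists (map fst l) => g g' gg' Cg p pl; rewrite -(Cg p)// gg'//; exact: map_f.
Qed.

Lemma cyl_nil : cyl [::] = setT.
Proof. by apply/seteqP; split. Qed.

Lemma cylI l l' : cyl l `&` cyl l' = cyl (l ++ l').
Proof.
apply/seteqP; split => [g [hl hl'] p|g hl].
  by rewrite mem_cat => /orP[/hl|/hl'].
by split=> p pl; apply: hl; rewrite mem_cat pl ?orbT.
Qed.

End Gradients.

Section Measurability.
Variables (m d : nat) (hd : (2 <= d)%N).
Notation site := 'rV[int]_m.
Notation grad := (gradient m hd).
Notation gspace := (gradient_space m hd).
Implicit Types (g : grad) (x y : site).

Lemma measurable_height x w : measurable ([set g | height g x = w] : set gspace).
Proof.
have [n] := ubnP (l1norm x); elim: n x w => [//|n IH] x w xn.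
have [->|/l1norm_step[y yx y1]] := eqVneq x 0.
  have [<-|w1] := eqVneq 1%g w.
    rewrite (_ : [set _ | _] = setT); first exact: measurableT.
    by apply/seteqP; split=> // g _; exact: height0.
  rewrite (_ : [set _ | _] = set0); first exact: measurable0.
  by apply/seteqP; split=> // g /=; rewrite height0 => /eqP; rewrite (negbTE w1).
pose e := OEdge (introT eqP y1).
rewrite (_ : [set _ | _] = \bigcup_(i : 'I_d)
  ([set g : gspace | height g y = (w * gen i)%g] `&` [set g : gspace | g e = i])).
  apply: countable_bigcupT_measurable => // i; apply: measurableI.
    by apply: IH; move: xn; rewrite -yx.
  by apply: sub_sigma_algebra; exists e, i.
apply/seteqP; split=> [g /= gw|g [i _ [/= gy ge]]].
  exists (g e) => //; split=> //=; rewrite -gw (dual_height g e) /=.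
  by rewrite mulgenK.
by have /= -> := dual_height g e; rewrite gy ge mulgenK.
Qed.

Lemma measurable_cyl l : measurable (cyl l : set gspace).
Proof.
elim: l => [|p l IH]; first by rewrite cyl_nil; exact: measurableT.
rewrite -cat1s -cylI; apply: measurableI => //.
rewrite (_ : cyl _ = [set g | height g p.1 = p.2]); first exact: measurable_height.
apply/seteqP; split=> [g|g gp q]; first by apply; rewrite inE.
by rewrite inE => /eqP ->.
Qed.

Lemma depends_on_cyl r (C : set grad) : depends_on r C ->
  C = \bigcup_(s in [set s : seq (freeinv d) | exists2 g, C g & s = map (height g) r])
        cyl (zip r s).
Proof.
move=> rC; apply/seteqP; split=> [g Cg|g [s [g' Cg' ->] /= gs]].
  exists (map (height g) r); first by exists g.
  move=> p; rewrite -[X in zip X _]map_id zip_map => /mapP[x xr ->] //.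
apply: rC Cg' => x xr; apply/esym.
apply: (gs (x, height g' x)); rewrite -[X in zip X _]map_id zip_map.
by apply/mapP; exists x.
Qed.

Lemma measurable_local (C : set grad) : local C -> measurable (C : set gspace).
Proof.
move=> [r /depends_on_cyl ->]; rewrite bigcup_mkcond.
apply: countable_bigcupT_measurable => [|s]; first exact: countableP.
by case: ifP => _; [exact: measurable_cyl|exact: measurable0].
Qed.

(** Unlike the events that fix one colour, the cylinders of heights are stable under finite
    intersections, as uniqueness of measures requires. *)
Lemma gradient_measurableE :
  @measurable _ gspace = <<s [set cyl l | l in [set: seq (site * freeinv d)]] >>.
Proof.
apply/seteqP; split; last first.
  apply: smallest_sub; first exact: sigma_algebra_measurable.
  by move=> _ [l _ <-]; exact: measurable_cyl.
apply: smallest_sub; first exact: smallest_sigma_algebra.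
move=> _ [e [c ->]].
rewrite (_ : [set _ | _] = \bigcup_(w : freeinv d)
    cyl [:: (src e, w); (tgt e, (w * gen c)%g)]); last first.
  apply/seteqP; split=> [g /= gc|g [w _ gw] /=].
    exists (height g (src e)) => //= p; rewrite !inE => /orP[] /eqP -> //=.
    by rewrite (dual_height g e) gc.
  have := gw (src e, w); have := gw (tgt e, (w * gen c)%g).
  rewrite !inE !eqxx orbT /= => /(_ isT) + /(_ isT) ws.
  by rewrite (dual_height g e) ws => /mulgI /genM_inj.
have := @countable_bigcupT_measurable _ (g_sigma_algebraType [set @cyl m d hd l | l in [set: seq (site * freeinv d)]]) _ (fun w : freeinv d => cyl [:: (src e, w); (tgt e, (w * gen c)%g)]).
apply; first exact: countableP.
by move=> w; apply: sub_sigma_algebra; exists [:: (src e, w); (tgt e, (w * gen c)%g)].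
Qed.

Lemma measure_cyl_unique (R : realType) (mu nu : {measure set gspace -> \bar R}) :
  (mu setT < +oo)%E -> (forall l, mu (cyl l) = nu (cyl l)) ->
  forall A, measurable A -> mu A = nu A.
Proof.
move=> mufin munu.
apply: (@measure_unique _ R gspace [set cyl l | l in [set: seq (site * freeinv d)]] (fun=> setT)).
- exact: gradient_measurableE.
- by move=> _ _ [l _ <-] [l' _ <-]; exists (l ++ l') => //; rewrite cylI.
- by move=> _; exists [::] => //; rewrite cyl_nil.
- by rewrite bigcup_const//; exists 0%N.
- by move=> _ [l _ <-].
- by move=> _.
Qed.

End Measurability.

(** * Limits of measures along an ultrafilter *)

Section Ultralimits.
Variable U : set_system nat.
Hypothesis Uultra : UltraFilter U.
#[local] Existing Instance ultra_proper.

Lemma ultra_fin (T : finType) (f : nat -> T) : exists w, U [set n | f n = w].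
Proof.
suff [//|fN] : (exists w, U [set n | f n = w]) \/ U [set n | f n \notin enum T].
  have [n /=] := filter_ex fN; by rewrite mem_enum.
elim: (enum T) => [|w s [?|IH]]; [right|by left|].
  by apply: filterS filterT.
have [fw|fw] := @in_ultra_setVsetC _ U [set n | f n = w] _; first by left; exists w.
right; apply: filterS (filterI fw IH) => n [/= nw ns].
by rewrite inE negb_or ns andbT; apply/eqP.
Qed.

Lemma ultra_cvg (R : realType) (a : nat -> R) (b : R) :
  (forall n, 0 <= a n <= b) -> exists l : R, a n @[n --> U] --> l.
Proof.
move=> a01; have /(_ (a @ U) _)[] := @segment_compact R 0 b.
  apply: (@filterE nat U _ (a @^-1` `[0, b])) => n.
  by rewrite /= in_itv /=; exact: a01.
move=> l [_ cl]; exists l => V Vl.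
have [//|aV] := @in_ultra_setVsetC _ U (a @^-1` V) _.
by have [x [/= Vx]] := cl (~` V) V aV Vl.
Qed.

Lemma ulim_ge (R : realType) (a : nat -> R) (l c : R) :
  a n @[n --> U] --> l -> U [set n | c <= a n] -> c <= l.
Proof.
by move=> al ca; rewrite -(cvg_lim _ al)//; apply: limr_ge => //; apply/cvg_ex; exists l.
Qed.

Lemma ulim_le (R : realType) (a : nat -> R) (l c : R) :
  a n @[n --> U] --> l -> U [set n | a n <= c] -> l <= c.
Proof.
by move=> al ca; rewrite -(cvg_lim _ al)//; apply: limr_le => //; apply/cvg_ex; exists l.
Qed.

Lemma ulim_unique (R : realType) (a : nat -> R) (l l' : R) :
  a n @[n --> U] --> l -> a n @[n --> U] --> l' -> l = l'.
Proof. by move=> al al'; rewrite -(cvg_lim _ al)// -(cvg_lim _ al'). Qed.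

End Ultralimits.

Section Compactness.
Variables (m d : nat) (hd : (2 <= d)%N).
Notation site := 'rV[int]_m.
Notation grad := (gradient m hd).
Notation gspace := (gradient_space m hd).
Implicit Types (g : grad) (x y : site) (C : set grad).

(** An edge has finitely many colours, so the ultrafilter selects one; the heights follow along a
    path from 0, where they are normalised. This is the compactness of the space of gradients. *)
Lemma ultra_gradient (U : set_system nat) (gs : nat -> grad) : UltraFilter U ->
  exists g, forall x, U [set n | height (gs n) x = height g x].
Proof.
move=> UF; have PF := ultra_proper.
have hx x : exists w, U [set n | height (gs n) x = w].
  have [n] := ubnP (l1norm x); elim: n x => [//|n IH] x xn.
  have [->|/l1norm_step[y yx y1]] := eqVneq x 0.
    by exists 1%g; apply: filterE => k; exact: height0.
  have [|w Uw] := IH y; first by move: xn; rewrite -yx.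
  pose e := OEdge (introT eqP y1).
  have [c Uc] := ultra_fin UF (fun n => gs n e).
  exists (w * gen c)%g; apply: filterS (filterI Uw Uc) => k [/= <- <-].
  exact: (dual_height (gs k) e).
have [H HU] := choice hx.
have Hhom : is_hom H.
  move=> x y xy; have [n [/= <- <-]] := filter_ex (filterI (HU x) (HU y)).
  exact: height_hom.
have H0 : H 0 = 1%g by have [n /= <-] := filter_ex (HU 0); exact: height0.
by exists (gr hd H) => x; rewrite height_gr1.
Qed.

Lemma ultra_depends (U : set_system nat) (gs : nat -> grad) g C : UltraFilter U ->
  (forall x, U [set n | height (gs n) x = height g x]) -> local C ->
  U [set n | C (gs n)] -> C g.
Proof.
move=> UF Ug [r rC] UC; have PF := ultra_proper.
have Ur : U [set n | {in r, height (gs n) =1 height g}].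
  elim: r {rC} => [|x r IH]; first by apply: filterE => n x; rewrite in_nil.
  apply: filterS (filterI (Ug x) IH) => n [/= hx hr] y.
  by rewrite inE => /orP[/eqP ->|/hr].
by have [n [/= /rC Cgg]] := filter_ex (filterI Ur UC); exact: Cgg.
Qed.

Lemma local_compact (F : nat -> set grad) : (forall n, local (F n)) ->
  (forall n, F n !=set0) -> (forall n, F n.+1 `<=` F n) -> exists g, forall n, F n g.
Proof.
move=> lF /choice[gs Fgs] decF.
have [U [UF Uoo]] := @ultraFilterLemma nat \oo _.
have [g Ug] := ultra_gradient gs UF; exists g => n.
apply: (ultra_depends UF Ug) => //; apply: Uoo; exists n => // k /= nk.
have: forall j, F (n + j)%N `<=` F n.
  by elim=> [|j IH]; [rewrite addn0|rewrite addnS => ? /decF /IH].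
by move=> /(_ (k - n)%N); rewrite subnKC//; apply; exact: Fgs.
Qed.

(** What remains of the union without its first [n] members is local and decreasing with empty
    intersection, so it is empty for some [n]. Countable additivity on local events thus reduces to
    finite additivity. *)
Lemma local_cover (F : nat -> set grad) : (forall n, local (F n)) ->
  trivIset setT F -> local (\bigcup_n F n) -> exists N, forall n, (N <= n)%N -> F n = set0.
Proof.
move=> lF tF lUF; pose E n := \bigcup_n F n `\` \big[setU/set0]_(i < n) F i.
have lE n : local (E n).
  apply: localD => //; elim/big_ind: _ => //; [exact: local0|exact: localU].
have [N EN] : exists N, ~ (E N !=set0).
  apply: contrapT => /forallNP En; have [|n g|g Eg] := local_compact lE.
  - by move=> n; apply: contrapT; exact: En.
  - by rewrite /E big_ord_recr /= => -[gU /not_orP[gn _]].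
  have [[n _ Fng] _] := Eg 0%N; have [_] := Eg n.+1.
  by rewrite big_ord_recr /=; apply; right.
exists N => n Nn; rewrite -subset0 => g Fng; apply: EN; exists g; split; first by exists n.
move=> gN; have [i /= iN Fig] : exists2 i : nat, (i < N)%N & F i g.
  by move: gN; rewrite -bigcup_mkord => -[i /= iN Fi]; exists i.
have in_ : i = n by apply: tF => //; exists g.
by move: iN; rewrite in_ ltnNge Nn.
Qed.

End Compactness.

(** A copy of the type of gradients that carries the algebra of local events, from which finitely
    additive functions are extended. *)
Definition local_space (m d : nat) (hd : (2 <= d)%N) := gradient m hd.
Definition local_display : measure_display. Proof. exact: default_measure_display. Qed.

Section LocalSpace.
Variables (m d : nat) (hd : (2 <= d)%N).

HB.instance Definition _ := Pointed.copy (local_space m hd) (gradient m hd).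
HB.instance Definition _ := isAlgebraOfSets.Build local_display (local_space m hd)
  (@local0 m d hd) (@localU m d hd) (@localC m d hd).

End LocalSpace.

Section Extension.
Variables (R : realType) (m d : nat) (hd : (2 <= d)%N).
Notation grad := (gradient m hd).
Notation gspace := (gradient_space m hd).
Implicit Types (C : set grad).
Variable p : set grad -> R.
Hypothesis p_ge0 : forall C, 0 <= p C.
Hypothesis pT : p setT = 1.
Hypothesis pU : forall C C', local C -> local C' -> C `&` C' = set0 ->
  p (C `|` C') = p C + p C'.

Let p0 : p set0 = 0.
Proof.
have := pU (@local0 m d hd) (@local0 m d hd) (setI0 _).
by rewrite setU0 => /eqP; rewrite -subr_eq0 opprD addrA subrr sub0r oppr_eq0 => /eqP.
Qed.

Let pc (C : set (local_space m hd)) : \bar R := (p C)%:E.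

Let pc_sigma_additive : semi_sigma_additive pc.
Proof.
move=> F lF' tF lUF; have lF i : local (F i) := lF' i.
have [N FN] := local_cover lF tF lUF.
have FU n : p (\big[setU/set0]_(i < n) F i) = \sum_(i < n) p (F i).
  elim: n => [|n IH]; first by rewrite !big_ord0 p0.
  rewrite !big_ord_recr /= pU ?IH//.
    by elim/big_ind: _ => //; [exact: local0|exact: localU].
  rewrite -subset0 => g [gU Fng].
  have [i /= iN Fig] : exists2 i : nat, (i < n)%N & F i g.
    by move: gU; rewrite -bigcup_mkord => -[i /= iN Fi]; exists i.
  have in_ : i = n by apply: tF => //; exists g.
  by move: iN; rewrite in_ ltnn.
have UN : \bigcup_n F n = \big[setU/set0]_(i < N) F i.
  rewrite -bigcup_mkord; apply/seteqP; split=> g [i _ Fig]; last by exists i.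
  by exists i => //=; rewrite ltnNge; apply/negP => /FN Fi0; move: Fig; rewrite Fi0.
rewrite /pc UN FU; apply: cvg_near_cst; exists N => // n /= Nn.
rewrite sumEFin; congr EFin; rewrite (big_cat_nat (n := N))//=.
have -> : \sum_(N <= i < n) p (F i) = 0.
  by rewrite big_nat_cond big1// => i /andP[/andP[/FN -> _] _].
by rewrite addr0 big_mkord.
Qed.

HB.instance Definition _ := isMeasure.Build local_display (local_space m hd) R pc
  (congr1 EFin p0) (fun C => p_ge0 C) pc_sigma_additive.

Let mu (C : set gspace) : \bar R := measure_extension pc C.

Let local_gspace : @measurable _ gspace = <<s @measurable local_display (local_space m hd) >>.
Proof.
rewrite gradient_measurableE; apply/seteqP; split.
  apply: smallest_sub; first exact: smallest_sigma_algebra.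
  by move=> _ [l _ <-]; apply: sub_gen_smallest; exact: local_cyl.
apply: smallest_sub; first exact: smallest_sigma_algebra.
by move=> C lC; rewrite -gradient_measurableE; exact: measurable_local.
Qed.

Let mu0 : mu set0 = 0%E. Proof. exact: measure0. Qed.
Let mu_ge0 C : (0 <= mu C)%E. Proof. exact: measure_ge0. Qed.
Let mu_sigma : semi_sigma_additive mu.
Proof.
move=> F mF tF mUF; apply: (@measure_semi_sigma_additive _ _ _ (measure_extension pc)) => //.
  by move=> i; move: (mF i); rewrite local_gspace.
by move: mUF; rewrite local_gspace.
Qed.

HB.instance Definition _ := isMeasure.Build _ gspace R mu mu0 mu_ge0 mu_sigma.

Let muE C : local C -> mu C = (p C)%:E.
Proof. by move=> lC; rewrite /mu /measure_extension measurable_mu_extE. Qed.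

Let muT : mu setT = 1%E.
Proof. by rewrite muE ?pT//; exact: localT. Qed.

HB.instance Definition _ := Measure_isProbability.Build _ gspace R mu muT.

(** Caratheodory's extension applies, since [local_cover] makes [p] countably additive on local
    events. *)
Lemma local_extension : exists mu : probability gspace R,
  forall C, local C -> mu C = (p C)%:E.
Proof. by exists mu. Qed.

End Extension.

Section UltralimitMeasure.
Variables (R : realType) (m d : nat) (hd : (2 <= d)%N).
Notation grad := (gradient m hd).
Notation gspace := (gradient_space m hd).
Implicit Types (C : set grad).
Variable U : set_system nat.
Hypothesis Uultra : UltraFilter U.
#[local] Existing Instance ultra_proper.
Variable p : nat -> set grad -> R.
Hypothesis p_ge0 : forall n C, 0 <= p n C.
Hypothesis p_le1 : forall n C, p n C <= 1.
Hypothesis pT : forall n, p n setT = 1.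
Hypothesis pU : forall n C C', local C -> local C' -> C `&` C' = set0 ->
  p n (C `|` C') = p n C + p n C'.

Lemma ultralimit_measure : exists mu : probability gspace R,
  forall C, local C -> p n C @[n --> U] --> fine (mu C).
Proof.
have /choice[l pl] : forall C, exists l : R, p n C @[n --> U] --> l.
  by move=> C; apply: (@ultra_cvg U Uultra R _ 1) => n; rewrite p_ge0 p_le1.
have [C|||mu muE] := @local_extension R m d hd l.
- by apply: (ulim_ge Uultra (pl C)); apply: filterE => n; exact: p_ge0.
- apply: (ulim_unique Uultra (pl setT)).
  by rewrite (_ : (fun _ => _) = cst 1); [exact: cvg_cst|apply/funext => n; exact: pT].
- move=> C C' lC lC' CC'; apply: (ulim_unique Uultra (pl (C `|` C'))).
  rewrite (_ : (fun n => p n _) = (fun n => p n C + p n C')).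
    by apply: cvgD; exact: pl.
  by apply/funext => n; exact: pU.
by exists mu => C lC; rewrite muE//=; exact: pl.
Qed.

End UltralimitMeasure.

(** * Resampling in a finite set *)

Section Cubes.
Variable m : nat.
Notation site := 'rV[int]_m.
Implicit Types (x y v : site) (r : nat).

Definition cube r : seq site :=
  [seq \row_k ((f k : nat)%:Z - r%:Z) | f : {ffun 'I_m -> 'I_(r + r).+1} <- enum {: {ffun 'I_m -> 'I_(r + r).+1}}].

Lemma mem_cube r x : x \in cube r = [forall k, (`|x 0%R k| <= r)%N].
Proof.
apply/mapP/forallP => [[f _ ->] k|xr].
  by rewrite mxE; case: (f k) => j /= jr; lia.
exists [ffun k => inord `|(x 0 k + r%:Z)%R|%N]; first by rewrite mem_enum.
apply/rowP => k; have := xr k; rewrite mxE ffunE; move: (x 0 k) => a ar.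
by rewrite inordK; lia.
Qed.

Lemma cubeP r x : reflect (forall k, (`|x 0%R k| <= r)%N) (x \in cube r).
Proof. by rewrite mem_cube; exact: forallP. Qed.

Lemma cube_le r r' : (r <= r')%N -> {subset cube r <= cube r'}.
Proof. by move=> rr x /cubeP xr; apply/cubeP => k; apply: leq_trans (xr k) rr. Qed.

Lemma cube0 r : 0 \in cube r.
Proof. by apply/cubeP => k; rewrite mxE. Qed.

Lemma cubeD r r' x y : x \in cube r -> y \in cube r' -> x + y \in cube (r + r').
Proof. move=> /cubeP xr /cubeP yr; apply/cubeP => k; rewrite mxE; have := xr k; have := yr k.
by move: (x 0 k) (y 0 k) => a b; lia. Qed.

Lemma cubeN r x : x \in cube r -> - x \in cube r.
Proof. by move=> /cubeP xr; apply/cubeP => k; rewrite mxE abszN. Qed.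

Lemma cube_l1norm x : x \in cube (l1norm x).
Proof. by apply/cubeP => k; rewrite /l1norm (bigD1 k)//= leq_addr. Qed.

Lemma seq_cube (s : seq site) : exists r, {subset s <= cube r}.
Proof.
elim: s => [|x s [r IH]]; first by exists 0%N.
exists (l1norm x + r)%N => y; rewrite inE => /orP[/eqP ->|/IH].
  exact: cube_le (leq_addr _ _) _ (cube_l1norm x).
exact: cube_le (leq_addl _ _) _.
Qed.

End Cubes.

Section Swaps.
Variables (m d : nat) (hd : (2 <= d)%N).
Notation site := 'rV[int]_m.
Notation grad := (gradient m hd).
Implicit Types (h : site -> freeinv d) (g : grad) (x y : site) (C : set grad).

Lemma local_cube C : local C <-> exists r, depends_on (cube m r) C.
Proof.
split=> [[s sC]|[r rC]]; last by exists (cube m r).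
by have [r sr] := seq_cube s; exists r; exact: depends_onS sC.
Qed.

Lemma local_translate v C : local C -> local (translate v @^-1` C).
Proof.
move=> [r rC]; exists (v :: map (fun x => x + v) r) => g g' gg'; apply: rC => x xr.
rewrite !height_translate (gg' v) ?inE ?eqxx// (gg' (x + v))// inE.
by apply/orP; right; apply/mapP; exists x.
Qed.

Section Swap.
Variables (L : seq site) (x0 : site) (z z' : site -> freeinv d).

(** Interiors are read relative to the value at [x0], so that patching commutes with left
    multiplication and hence acts on gradients. *)
Definition patch (z : site -> freeinv d) h : site -> freeinv d :=
  fun y => if y \in L then (h x0 * z y)%g else h y.

Definition fits (z : site -> freeinv d) h : Prop :=
  forall y, y \in L -> h y = (h x0 * z y)%g.

(* Exchanges the interiors z and z' of L, read relative to the value at x0;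
   invariance of a measure under all swaps amounts to the Gibbs property. *)
Definition sw h : site -> freeinv d :=
  if `[< fits z h /\ is_hom (patch z' h) >] then patch z' h
  else if `[< fits z' h /\ is_hom (patch z h) >] then patch z h else h.

Definition swap g : grad := gr hd (sw (height g)).

Lemma sw_hom h : is_hom h -> is_hom (sw h).
Proof. by rewrite /sw; case: asboolP => [c|c]; [case: c|case: asboolP => [c'|c']; [case: c'|]]. Qed.

Lemma sw_out h y : y \notin L -> sw h y = h y.
Proof.
by move=> /negbTE yL; rewrite /sw; case: asboolP => _; [|case: asboolP => _]; rewrite /patch ?yL.
Qed.

Lemma patch_mull w u h : patch w (fun x => u * h x)%g = (fun x => u * patch w h x)%g.
Proof. by apply/funext => y; rewrite /patch; case: ifP => _ //; rewrite mulgA. Qed.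

Lemma fits_mull w u h : fits w (fun x => u * h x)%g <-> fits w h.
Proof.
by split=> wh y yL; have := wh y yL; rewrite -mulgA; [move/mulgI|move=> ->].
Qed.

Lemma hom_mullE u h : is_hom (fun x => u * h x)%g <-> is_hom h.
Proof.
split; last exact: hom_mull.
by move=> /(hom_mull u^-1%g) hh x y /hh; rewrite !mulgA mulVg !mul1g.
Qed.

Lemma sw_mull u h : sw (fun x => u * h x)%g = (fun x => u * sw h x)%g.
Proof.
rewrite /sw !patch_mull.
have E w w' : (fits w (fun x => u * h x)%g /\ is_hom (fun x => u * patch w' h x)%g) =
              (fits w h /\ is_hom (patch w' h)).
  by apply/propext; rewrite fits_mull hom_mullE.
by rewrite !E; case: asboolP => // _; case: asboolP.
Qed.

Hypothesis x0L : x0 \notin L.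

Lemma fits_patch w h : fits w (patch w h).
Proof. by move=> y yL; rewrite /patch yL (negbTE x0L). Qed.

Lemma patch_patch w w' h : patch w (patch w' h) = patch w h.
Proof. by apply/funext => y; rewrite /patch (negbTE x0L); case: (y \in L). Qed.

Lemma patch_fits w h : fits w h -> patch w h = h.
Proof. by move=> wh; apply/funext => y; rewrite /patch; case: ifP => // /wh. Qed.

(** After an exchange the map fits the other interior, and patching back restores [h] because [x0]
    lies outside [L] and keeps its value. If both interiors fit, they agree on [L] and nothing
    moves. *)
Lemma swK h : is_hom h -> sw (sw h) = h.
Proof.
move=> hh; rewrite {2}/sw; case: asboolP => [[zh z'h]|nz].
  rewrite /sw patch_patch patch_patch (patch_fits zh).
  case: asboolP => [[+ _]|_].
    by move=> /patch_fits <-; rewrite patch_patch patch_fits.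
  by case: asboolP => // -[]; split=> //; exact: fits_patch.
case: asboolP => [[z'h zh]|nz'].
  rewrite /sw !patch_patch (patch_fits z'h).
  by case: asboolP => // -[]; split=> //; exact: fits_patch.
by rewrite /sw; case: asboolP => // _; case: asboolP.
Qed.

Lemma patch_homP w h : is_hom h ->
  (is_hom (patch w h) <->
   forall y z, y \in L -> l1norm (y - z) = 1%N -> adj (patch w h y) (patch w h z)).
Proof.
move=> hh; rewrite is_homP; split=> [ph y t _|ph x y xy]; first exact: ph.
have [xL|xL] := boolP (x \in L); first exact: ph.
have [yL|yL] := boolP (y \in L); first by apply: adjC; apply: ph => //; rewrite l1norm_sym.
by rewrite /patch (negbTE xL) (negbTE yL); apply/tree_dist1/hh.
Qed.

(** Whether the exchange is allowed depends only on the values at [x0], on [L] and at the neighbours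
    of [L]; the strict [r < r'] makes room for the neighbours. *)
Lemma sw_cube h h' r r' : is_hom h -> is_hom h' ->
  {subset L <= cube m r} -> x0 \in cube m r -> (r < r')%N ->
  {in cube m r', h =1 h'} -> {in cube m r', sw h =1 sw h'}.
Proof.
move=> hh hh' Lr x0r rr' E.
have Er : {in cube m r, h =1 h'} by move=> x xr; apply: E; exact: cube_le (ltnW rr') _ xr.
have Ep w : {in cube m r', patch w h =1 patch w h'}.
  by move=> x xr; rewrite /patch Er//; case: ifP => // _; exact: E.
have Ef w : fits w h = fits w h'.
  by apply/propext; split=> wh y yL; move: (wh y yL); rewrite !Er//; exact: Lr.
have Eh w : is_hom (patch w h) = is_hom (patch w h').
  have nb y t : y \in L -> l1norm (y - t) = 1%N -> y \in cube m r' /\ t \in cube m r'.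
    move=> yL yt; split; first exact: cube_le (ltnW rr') _ (Lr _ yL).
    apply: (cube_le rr'); rewrite -(addn1 r) -(subrKC y t); apply: cubeD; first exact: Lr.
    by have := cube_l1norm (t - y); rewrite l1norm_sym yt.
  apply/propext; rewrite (patch_homP w hh) (patch_homP w hh').
  by split=> P y t yL yt; have [yr tr] := nb y t yL yt; move: (P y t yL yt); rewrite !Ep.
move=> x xr; rewrite /sw !Ef !Eh.
by case: asboolP => _; [exact: Ep|case: asboolP => _; [exact: Ep|exact: E]].
Qed.

Lemma height_swap g x : height (swap g) x = ((sw (height g) 0)^-1 * sw (height g) x)%g.
Proof. by rewrite /swap height_gr//; apply/sw_hom/height_hom. Qed.

Lemma swap_gr h : is_hom h -> swap (gr hd h) = gr hd (sw h).
Proof.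
move=> hh; rewrite /swap (_ : height (gr hd h) = (fun x => (h 0)^-1 * h x)%g).
  by rewrite sw_mull gr_mull//; exact: sw_hom.
by apply/funext => x; exact: height_gr.
Qed.

Lemma swapK g : swap (swap g) = g.
Proof.
rewrite {2}/swap swap_gr; last exact/sw_hom/height_hom.
by rewrite swK ?gr_height//; exact: height_hom.
Qed.

Lemma local_swap C : local C -> local (swap @^-1` C).
Proof.
move=> /local_cube[r rC]; have [r1 Lr1] := seq_cube (x0 :: L).
apply/local_cube; exists (r + r1).+1 => g g' gg'; apply: rC => x xr.
have E : {in cube m (r + r1).+1, sw (height g) =1 sw (height g')}.
  apply: (@sw_cube _ _ r1); rewrite ?ltnS ?leq_addl//; try exact: height_hom.
    by move=> y yL; apply: Lr1; rewrite inE yL orbT.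
  by apply: Lr1; rewrite inE eqxx.
rewrite !height_swap !E ?cube0//; apply: cube_le xr.
by apply: leqW; rewrite leq_addr.
Qed.

Lemma swap_outside g x y : x \notin L -> y \notin L ->
  ((height (swap g) x)^-1 * height (swap g) y = (height g x)^-1 * height g y)%g.
Proof.
move=> xL yL; rewrite !height_swap invgM invgK -mulgA (mulgA (sw _ 0)) mulgV mul1g.
by rewrite !sw_out.
Qed.

End Swap.

End Swaps.

Section RealProbability.
Context d (T : measurableType d) (R : realType) (mu : probability T R).
Implicit Types A B : set T.

Definition Pr A : R := fine (mu A).

Lemma PrE A : measurable A -> mu A = (Pr A)%:E.
Proof. by move=> mA; rewrite /Pr fineK// fin_num_measure. Qed.

Lemma Pr_ge0 A : 0 <= Pr A. Proof. exact/fine_ge0/measure_ge0. Qed.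

Lemma PrT : Pr setT = 1. Proof. by rewrite /Pr probability_setT. Qed.

Lemma Pr0 : Pr set0 = 0. Proof. by rewrite /Pr measure0. Qed.

Lemma PrS A B : measurable A -> measurable B -> A `<=` B -> Pr A <= Pr B.
Proof. move=> mA mB AB; rewrite -lee_fin -!PrE//; apply: le_measure => //; exact: mem_set. Qed.

Lemma Pr_le1 A : measurable A -> Pr A <= 1.
Proof. by move=> mA; rewrite -PrT; exact: PrS. Qed.

Lemma PrU A B : measurable A -> measurable B -> A `&` B = set0 ->
  Pr (A `|` B) = Pr A + Pr B.
Proof.
move=> mA mB AB; apply: EFin_inj; rewrite EFinD -!PrE//; last exact: measurableU.
by rewrite measureU//; apply/eqP.
Qed.

Lemma PrU_le A B : measurable A -> measurable B -> Pr (A `|` B) <= Pr A + Pr B.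
Proof.
move=> mA mB; rewrite -lee_fin EFinD -!PrE//; last exact: measurableU.
exact: measureU2.
Qed.

Lemma Pr_split A B : measurable A -> measurable B ->
  Pr B = Pr (B `&` A) + Pr (B `&` ~` A).
Proof.
move=> mA mB; have {1}-> : B = (B `&` A) `|` (B `&` ~` A) by rewrite -setIUr setUv setIT.
rewrite PrU//; first exact: measurableI.
- by apply: measurableI => //; exact: measurableC.
- by rewrite setIACA setICr setI0.
Qed.

Lemma PrC A : measurable A -> Pr (~` A) = 1 - Pr A.
Proof.
by move=> mA; rewrite -PrT (Pr_split mA measurableT) !setTI addrC addKr.
Qed.

Lemma measurableY A B : measurable A -> measurable B -> measurable (A `+` B).
Proof. by move=> mA mB; apply: measurableU; exact: measurableD. Qed.

Lemma Pr_triangle A B C : measurable A -> measurable B -> measurable C ->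
  Pr (A `+` C) <= Pr (A `+` B) + Pr (B `+` C).
Proof.
move=> mA mB mC; apply: le_trans (PrU_le _ _); try exact: measurableY.
apply: PrS; [exact: measurableY|apply: measurableU; exact: measurableY|].
move=> x [[Ax nCx]|[Cx nAx]]; have [Bx|nBx] := pselect (B x).
- by right; left. - by left; left. - by left; right. - by right; right.
Qed.

Lemma Pr_setY0 A B : measurable A -> measurable B -> Pr (A `+` B) = 0 -> Pr A = Pr B.
Proof.
have le A' B' : measurable A' -> measurable B' -> Pr (A' `+` B') = 0 -> Pr A' <= Pr B'.
  move=> mA mB AB0; rewrite -[Pr B']addr0 -AB0.
  apply: le_trans (PrU_le _ _) => //; last exact: measurableY.
  apply: PrS => //; first by apply: measurableU => //; exact: measurableY.
  by move=> x A'x; have [?|?] := pselect (B' x); [left|right; left].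
by move=> mA mB AB0; apply/eqP; rewrite eq_le !le//; rewrite setYC.
Qed.

Section Conditional.
Variable A : set T.
Hypotheses (mA : measurable A) (A0 : 0 < Pr A).
Let nu : set T -> \bar R := mscale (NngNum (ltW (divr_gt0 ltr01 A0))) (mrestr mu mA).
HB.instance Definition _ := Measure.on nu.
Let nuT : nu setT = 1%E.
Proof.
by rewrite /nu /mscale/= /mrestr setTI PrE// -EFinM mul1r mulVf// gt_eqF.
Qed.
HB.instance Definition _ := Measure_isProbability.Build _ T R nu nuT.

Lemma conditional_probability :
  exists nu : probability T R, forall B, measurable B -> fine (nu B) = Pr (B `&` A) / Pr A.
Proof.
exists nu => B mB; rewrite /= /nu /mscale/= /mrestr PrE; last exact: measurableI.
by rewrite -EFinM/= mul1r mulrC.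
Qed.

End Conditional.

End RealProbability.

(** * Measures invariant under translations and swaps *)

Section Invariance.
Variables (R : realType) (m d : nat) (hd : (2 <= d)%N).
Notation site := 'rV[int]_m.
Notation grad := (gradient m hd).
Notation gspace := (gradient_space m hd).
Implicit Types (C : set grad) (A : set gspace) (S : gspace -> gspace).

Section Pushforward.
Variables (mu : probability gspace R) (S : gspace -> gspace).
Hypothesis mS : measurable_fun setT S.
Let nu A := mu (S @^-1` A).
Let mpre A : measurable A -> measurable (S @^-1` A).
Proof. by move=> mA; rewrite -[X in measurable X]setTI; exact: mS. Qed.
Let nu0 : nu set0 = 0%E. Proof. by rewrite /nu preimage_set0 measure0. Qed.
Let nu_ge0 A : (0 <= nu A)%E. Proof. exact: measure_ge0. Qed.
Let nu_sigma : semi_sigma_additive nu.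
Proof.
move=> F mF tF mUF; rewrite /nu preimage_bigcup.
apply: measure_semi_sigma_additive.
- by move=> n; exact: mpre.
- apply/trivIsetP => /= i j _ _ ij; rewrite -preimage_setI.
  by move/trivIsetP : tF => /(_ _ _ _ _ ij) ->//; rewrite preimage_set0.
- by rewrite -preimage_bigcup; exact: mpre.
Qed.
HB.instance Definition _ := isMeasure.Build _ gspace R nu nu0 nu_ge0 nu_sigma.

Lemma invariant_measurable : (forall C, local C -> mu (S @^-1` C) = mu C) ->
  forall A, measurable A -> mu (S @^-1` A) = mu A.
Proof.
move=> SC; apply: (@measure_cyl_unique m d hd R nu mu).
  by rewrite /= /nu preimage_setT probability_setT ltry.
by move=> l; apply: SC; exact: local_cyl.
Qed.

End Pushforward.

Lemma local_measurable_fun S : (forall C, local C -> local (S @^-1` C)) ->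
  measurable_fun setT S.
Proof.
move=> SC; apply: (@measurability _ _ gspace gspace setT S _ (@gradient_measurableE m d hd)).
move=> _ [_ [l _ <-] <-]; rewrite setTI; apply: measurable_local.
exact/SC/local_cyl.
Qed.

Lemma measurable_translate v : measurable_fun setT (translate v : gspace -> gspace).
Proof. by apply: local_measurable_fun => C; exact: local_translate. Qed.

Lemma measurable_swap (L : seq site) x0 z z' : x0 \notin L ->
  measurable_fun setT (swap L x0 z z' : gspace -> gspace).
Proof. by move=> x0L; apply: local_measurable_fun => C; exact: local_swap. Qed.

Lemma measurable_pre S A : measurable_fun setT S -> measurable A -> measurable (S @^-1` A).
Proof. by move=> mS mA; rewrite -[X in measurable X]setTI; exact: mS. Qed.

(** Required on local events only, where it passes to ultralimits; [invariant_measurable] extends it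
    to all measurable events. *)
Definition invariant (mu : probability gspace R) : Prop :=
  (forall v C, local C -> mu (translate v @^-1` C) = mu C) /\
  (forall (L : seq site) x0 z z' C, x0 \notin L -> local C ->
     mu (swap L x0 z z' @^-1` C) = mu C).

Lemma Pr_translate mu v A : invariant mu -> measurable A ->
  Pr mu (translate v @^-1` A) = Pr mu A.
Proof.
move=> [It _] mA; rewrite /Pr; congr fine; apply: invariant_measurable => //.
  exact: measurable_translate.
by move=> C lC; exact: It.
Qed.

Lemma Pr_swap mu (L : seq site) x0 z z' A : x0 \notin L -> invariant mu -> measurable A ->
  Pr mu (swap L x0 z z' @^-1` A) = Pr mu A.
Proof.
move=> x0L [_ Is] mA; rewrite /Pr; congr fine; apply: invariant_measurable => //.
  exact: measurable_swap.
by move=> C lC; exact: Is.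
Qed.

(** The events that can be approximated form a sigma-algebra: a countable union is first replaced by
    a finite one, whose members are approximated in turn. *)
Lemma local_approx (mu : probability gspace R) A e : measurable A -> 0 < e ->
  exists2 C, local C & Pr mu (A `+` C) < e.
Proof.
pose K := [set A : set gspace | measurable A /\
  forall e, 0 < e -> exists2 C, local C & Pr mu (A `+` C) < e].
suff KM : @measurable _ gspace `<=` K by move=> /KM[_]; exact.
have KC B : K B -> K (~` B).
  move=> [mB KB]; split=> [|e' e0]; first exact: measurableC.
  have [C lC BC] := KB _ e0; exists (~` C); first exact: localC.
  by rewrite /setY !setDE !setCK setIC [X in _ `|` X]setIC setUC -!setDE.
have KU B B' : K B -> K B' -> K (B `|` B').
  move=> [mB KB] [mB' KB']; split=> [|e' e0]; first exact: measurableU.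
  have e20 : 0 < e' / 2 by rewrite divr_gt0.
  have [C lC BC] := KB _ e20; have [C' lC' BC'] := KB' _ e20.
  have mC := measurable_local lC; have mC' := measurable_local lC'.
  exists (C `|` C'); first exact: localU.
  rewrite (splitr e'); apply: le_lt_trans (ltrD BC BC').
  apply: le_trans (PrU_le _ _ _); try exact: measurableY.
  apply: PrS.
  - by apply: measurableY; exact: measurableU.
  - by apply: measurableU; exact: measurableY.
  move=> x [[[Bx|Bx] /not_orP[nC nC']]|[[Cx|Cx] /not_orP[nB nB']]].
  - by left; left. - by right; left. - by left; right. - by right; right.
rewrite gradient_measurableE; apply: smallest_sub; last first.
  move=> _ [l _ <-]; split=> [|e' e0]; first exact: measurable_cyl.
  by exists (cyl l); [exact: local_cyl|rewrite setYK Pr0].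
split.
- by split=> [|e' e0]; [exact: measurable0|exists set0; [exact: local0|rewrite setYK Pr0]].
- by move=> B KB; rewrite setTD; exact: KC.
move=> F0; set F : nat -> set gspace := F0 => KF.
have mF i : measurable (F i) by case: (KF i).
have mUF : measurable (\bigcup_k F k) by exact: bigcupT_measurable.
split=> // e' e0.
pose B n := \big[setU/set0]_(i < n.+1) F i.
have KB n : K (B n).
  rewrite /B; elim: n => [|n IH]; first by rewrite big_ord_recr big_ord0 /= set0U.
  by rewrite big_ord_recr /=; exact: KU.
have mB n : measurable (B n) by case: (KB n).
have UB : \bigcup_k B k = \bigcup_k F k.
  apply/seteqP; split=> x [k _].
    by rewrite /B -bigcup_mkord => -[i _ Fi]; exists i.
  by move=> Fk; exists k => //; rewrite /B big_ord_recr; right.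
have cB : Pr mu (B n) @[n --> \oo] --> Pr mu (\bigcup_k F k).
  have := @nondecreasing_cvg_mu _ gspace R mu B mB; rewrite UB => /(_ mUF) cv.
  suff /fine_cvgP[_] : mu \o B @ \oo --> (Pr mu (\bigcup_k F k))%:E by [].
  rewrite -PrE//; apply: cv; apply/nondecreasing_seqP => n; rewrite subsetEset => x Bx.
  by rewrite /B big_ord_recr /=; left.
have e20 : 0 < e' / 2 by rewrite divr_gt0.
have /cvgrPdist_lt/(_ _ e20)[N _ /(_ N (leqnn N)) /= BN] := cB.
have [_ /(_ _ e20)[C lC BC]] := KB N; exists C => //.
have mC := measurable_local lC.
rewrite (splitr e'); apply: le_lt_trans (Pr_triangle mu mUF (mB N) mC) _.
apply: ltrD BC; apply: le_lt_trans BN.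
have BU : B N `<=` \bigcup_k F k by rewrite -UB; exact: bigcup_sup.
rewrite (Pr_split mu (mB N) mUF) addrAC -[Pr mu (B N)](_ : Pr mu (\bigcup_k F k `&` B N) = _).
  rewrite subrr add0r ger0_norm ?Pr_ge0// /setY setDE.
  by rewrite (_ : B N `\` _ = set0) ?setU0// -subset0 => x [/BU].
by congr (Pr mu _); rewrite setIC; apply/setIidPl.
Qed.

End Invariance.

(** * Ergodic measures as minimisers *)

Lemma cvg_sumr (R : realType) (T I : Type) (G : set_system T) (GF : Filter G) (r : seq I)
    (P : pred I) (f : I -> T -> R) (l : I -> R) :
  (forall i, f i x @[x --> G] --> l i) ->
  \sum_(i <- r | P i) f i x @[x --> G] --> \sum_(i <- r | P i) l i.
Proof. by move=> fl; apply: cvg_big => //; exact: add_continuous. Qed.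

(* An ergodic measure is found by minimising, over the compact convex set of
   invariant measures, the lower semicontinuous function
   [\sum_i (Q i mu + 2^-i (1 - mu(C_i)^2))]: Q is affine, the rest is strictly
   concave, so a minimiser is extreme. *)
Section Minimiser.
Variables (R : realType) (m d : nat) (hd : (2 <= d)%N).
Hypothesis hm : (0 < m)%N.
Notation site := 'rV[int]_m.
Notation grad := (gradient m hd).
Notation gspace := (gradient_space m hd).
Implicit Types (C : set grad) (A : set gspace) (p : set grad -> R)
  (mu nu : probability gspace R).

Variable Q : nat -> (set grad -> R) -> R.
Hypothesis Q_ge0 : forall i p, (forall C, 0 <= p C) -> 0 <= Q i p.
Hypothesis Q_affine : forall i t p p',
  Q i (fun C => t * p C + (1 - t) * p' C) = t * Q i p + (1 - t) * Q i p'.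
Hypothesis Q_local : forall i p p', (forall C, local C -> p C = p' C) -> Q i p = Q i p'.
Hypothesis Q_cvg : forall (U : set_system nat) (UF : UltraFilter U) i
    (ps : nat -> set grad -> R) p,
  (forall C, local C -> ps n C @[n --> U] --> p C) -> Q i (ps n) @[n --> U] --> Q i p.

(** An enumeration of all cylinders; an integer that codes no list gives the whole space. *)
Definition test_cyl (i : nat) : set grad := cyl (odflt [::] (choice.unpickle i)).

Let wt (i : nat) : R := 2^-1 ^+ i.
Let w i mu : R := Q i (Pr mu) + wt i * (1 - Pr mu (test_cyl i) ^+ 2).
Let F J mu : R := \sum_(i < J) w i mu.

Let wt_gt0 i : 0 < wt i. Proof. by rewrite exprn_gt0// invr_gt0. Qed.

Let sum_wt J : \sum_(i < J) wt i <= 2.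
Proof.
have -> : \sum_(i < J) wt i = 2 - 2 * wt J.
  elim: J => [|J IH]; first by rewrite big_ord0 /wt expr0; lra.
  by rewrite big_ord_recr /= IH /wt exprS; field.
by rewrite gerBl mulr_ge0// ltW// wt_gt0.
Qed.

Let local_test i : local (test_cyl i). Proof. exact: local_cyl. Qed.

Let sq_test mu i : 0 <= Pr mu (test_cyl i) ^+ 2 <= 1.
Proof.
rewrite sqr_ge0 /= expr_le1 ?Pr_ge0//; apply: Pr_le1.
exact: measurable_local.
Qed.

Let w_ge0 i mu : 0 <= w i mu.
Proof.
apply: addr_ge0; first by apply: Q_ge0 => C; exact: Pr_ge0.
by rewrite mulr_ge0 ?(ltW (wt_gt0 i))// subr_ge0; case/andP: (sq_test mu i).
Qed.

Let F_mono mu J J' : (J <= J')%N -> F J mu <= F J' mu.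
Proof.
move=> /subnKC <-; elim: (J' - J)%N => [|k IH]; first by rewrite addn0.
by rewrite addnS; apply: le_trans IH _; rewrite /F big_ord_recr /= lerDl.
Qed.

(** A bound on all partial sums stands for a bound on the series, which may diverge for some
    measures. Each partial sum is continuous along an ultrafilter, so upper bounds survive the limit
    of a minimising sequence. *)
Lemma minimiser_exists mu0 B : invariant mu0 ->
  (forall J, \sum_(i < J) Q i (Pr mu0) <= B) ->
  exists mu c, [/\ invariant mu, forall J, F J mu <= c &
    forall nu c', invariant nu -> (forall J, F J nu <= c') -> c <= c'].
Proof.
move=> inv0 B0.
pose E := [set c | exists mu, invariant mu /\ forall J, F J mu <= c].
have E_inf : has_inf E.
  split; last by exists 0 => c [mu [_ /(_ 0%N)]]; rewrite /F big_ord0.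
  exists (B + 2), mu0; split=> // J; rewrite /F big_split /= lerD ?B0//.
  apply: le_trans _ (sum_wt J); apply: ler_sum => i _.
  rewrite ler_piMr ?(ltW (wt_gt0 i))// gerBl; by case/andP: (sq_test mu0 i).
have /choice[mus hmus] : forall n : nat, exists mu, invariant mu /\
    forall J, F J mu <= inf E + n.+1%:R^-1.
  move=> n; have [|c [mu [imu Fmu]] cE] := inf_adherent (eps := n.+1%:R^-1) _ E_inf.
    by rewrite invr_gt0.
  by exists mu; split=> // J; apply: le_trans (Fmu J) (ltW cE).
have [U [UF Uoo]] := @ultraFilterLemma nat \oo _.
have PF := @ultra_proper _ _ UF.
(* [ultralimit_measure] asks for values at most 1 on all sets, [Pr] has this bound on measurable
   ones; truncation reconciles the two without changing local events. *)
have le1 n C : local C -> Num.min (Pr (mus n) C) 1 = Pr (mus n) C.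
  by move=> lC; apply/min_idPl; apply: Pr_le1; exact: measurable_local.
have [||||mu muE] := @ultralimit_measure R m d hd U UF
    (fun n C => Num.min (Pr (mus n) C) 1).
- by move=> n C; rewrite le_min Pr_ge0 ler01.
- by move=> n C; rewrite ge_min lexx orbT.
- by move=> n; rewrite PrT minxx.
- move=> n C C' lC lC' CC'; rewrite !le1//; last exact: localU.
  by apply: PrU => //; exact: measurable_local.
have cvmu C : local C -> Pr (mus n) C @[n --> U] --> Pr mu C.
  move=> lC; have := muE C lC.
  by rewrite (_ : (fun n => Num.min _ _) = (fun n => Pr (mus n) C))//; apply/funext => n; exact: le1.
have inv_lim (S : grad -> grad) C : local C -> local (S @^-1` C) ->
    (forall n, mus n (S @^-1` C) = mus n C) -> mu (S @^-1` C) = mu C.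
  move=> lC lSC eS; rewrite PrE; last exact: measurable_local.
  rewrite [RHS]PrE; last exact: measurable_local.
  congr EFin; apply: (ulim_unique UF (cvmu _ lSC)).
  by under eq_fun do rewrite /Pr eS; exact: cvmu.
exists mu, (inf E); split.
- split=> [v C lC|L x0 z z' C x0L lC].
    apply: inv_lim => //; first exact: local_translate.
    by move=> n; have [[It _] _] := hmus n; exact: It.
  apply: inv_lim => //; first exact: local_swap.
  by move=> n; have [[_ Is] _] := hmus n; exact: Is.
- move=> J; have cvF : F J (mus n) @[n --> U] --> F J mu.
    rewrite /F; apply: (@cvg_sumr R nat _ U _ _ _ (fun (i : 'I_J) n => w i (mus n)) (fun i => w i mu)) => i.
    apply: cvgD; first exact: Q_cvg.
    apply: cvgM; first exact: cvg_cst.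
    apply: cvgB; first exact: cvg_cst.
    by rewrite expr2; under eq_fun do rewrite expr2; apply: cvgM; exact: cvmu.
  apply/ler_addgt0Pr => e e0; apply: (ulim_le UF cvF); apply: Uoo.
  have [N Ne] : exists N : nat, N.+1%:R^-1 < e.
    by have [N _ /(_ N (leqnn N))] := near_infty_natSinv_lt (PosNum e0); exists N.
  exists N => // n /= Nn; have [_ /(_ J) h] := hmus n; apply: le_trans h _.
  rewrite lerD2l; apply: ltW; apply: le_lt_trans Ne.
  by rewrite lef_pV2 ?posrE// ler_nat.
- move=> nu c' inu Fnu; apply: ge_inf; first by case: E_inf.
  by exists nu.
Qed.

(** If two components had values at least [c] and differed on a cylinder, strict concavity would
    give their mixture [mu] a value above [c]. *)
Lemma minimiser_extreme mu c nu nu' t : 0 < t < 1 ->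
  (forall J, F J mu <= c) ->
  (forall c', (forall J, F J nu <= c') -> c <= c') ->
  (forall c', (forall J, F J nu' <= c') -> c <= c') ->
  (forall C, local C -> Pr mu C = t * Pr nu C + (1 - t) * Pr nu' C) ->
  forall i, Pr nu (test_cyl i) = Pr nu' (test_cyl i).
Proof.
move=> /andP[t0 t1] Fmu min_nu min_nu' muE i0.
(* The concavity gap: [t x ^ 2 + (1 - t) y ^ 2] exceeds the square of [t x + (1 - t) y] by
   [t (1 - t) (x - y) ^ 2]. *)
pose D i : R := wt i * (t * (1 - t)) * (Pr nu (test_cyl i) - Pr nu' (test_cyl i)) ^+ 2.
have D_ge0 i : 0 <= D i.
  by rewrite /D mulr_ge0 ?sqr_ge0// mulr_ge0 ?(ltW (wt_gt0 i))// ltW// mulr_gt0// subr_gt0.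
have FE J : t * F J nu + (1 - t) * F J nu' + \sum_(i < J) D i = F J mu.
  rewrite /F !mulr_sumr -!big_split /=; apply: eq_bigr => i _.
  rewrite /w /D muE//.
  rewrite (Q_local i (p := Pr mu) (p' := fun C => t * Pr nu C + (1 - t) * Pr nu' C))//.
  by rewrite Q_affine; ring.
suff Di0 : D i0 <= 0.
  have /eqP : D i0 = 0 by apply/eqP; rewrite eq_le Di0 D_ge0.
  have c0 : wt i0 * (t * (1 - t)) != 0.
    by rewrite gt_eqF// mulr_gt0 ?wt_gt0// mulr_gt0// subr_gt0.
  by rewrite /D mulf_eq0 (negbTE c0) /= sqrf_eq0 subr_eq0 => /eqP.
rewrite leNgt; apply/negP => D0.
pose e := D i0 / 2; have e0 : 0 < e by rewrite divr_gt0.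
have ex_big (ka : probability gspace R) : (forall c', (forall J, F J ka <= c') -> c <= c') ->
    exists J, c - e < F J ka.
  move=> mka; apply: contrapT => /forallNP h.
  have : c <= c - e by apply: mka => J; rewrite leNgt; apply/negP; exact: h.
  by rewrite lerBrDl gerDr leNgt e0.
have [J1 hJ1] := ex_big _ min_nu; have [J2 hJ2] := ex_big _ min_nu'.
pose J := maxn i0.+1 (maxn J1 J2).
have h1 : c - e < F J nu by apply: lt_le_trans hJ1 _; apply: F_mono; rewrite /J; lia.
have h2 : c - e < F J nu' by apply: lt_le_trans hJ2 _; apply: F_mono; rewrite /J; lia.
have h3 : D i0 <= \sum_(i < J) D i.
  have iJ : (i0 < J)%N by rewrite /J; lia.
  by rewrite (bigD1 (Ordinal iJ))//= lerDl sumr_ge0.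
have := Fmu J; rewrite -FE leNgt => /negP; apply.
have h4 : t * (c - e) + (1 - t) * (c - e) < t * F J nu + (1 - t) * F J nu'.
  by rewrite ltrD// ltr_pM2l// subr_gt0.
have h5 : c < c - e + D i0 by rewrite /e; lra.
apply: lt_le_trans h5 _; apply: lerD => //.
by apply: le_trans _ (ltW h4); rewrite -mulrDl subrKC mul1r.
Qed.

(** A local approximation of [A] can be translated far away from [L], where the swap does not see
    it, and it still approximates [A]. So the swap fixes [A] up to a null set. *)
Lemma translation_invariant_swap mu (L : seq site) x0 z z' A : x0 \notin L ->
  invariant mu -> measurable A -> (forall v, translate v @^-1` A = A) ->
  Pr mu (A `+` (swap L x0 z z' @^-1` A)) = 0.
Proof.
move=> x0L imu mA tA; pose S := swap L x0 z z' : gspace -> gspace.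
have mS : measurable_fun setT S by exact: measurable_swap.
apply/eqP; rewrite eq_le Pr_ge0 andbT; apply/ler_addgt0Pr => e e0; rewrite add0r.
have [C lC AC] := local_approx mu mA (divr_gt0 e0 (ltr0n R 2) : 0 < e / 2).
have /local_cube[r rC] := lC; have [r1 Lr1] := seq_cube L.
pose v : site := delta_mx 0 (Ordinal hm) *+ (r + r1).+1.
have vE : v 0 (Ordinal hm) = (r + r1).+1%:Z by rewrite /v mulmxnE mxE !eqxx /=; exact: natz.
have vL x : x \in cube m r -> x + v \notin L.
  move=> /cubeP xr; apply/negP => /Lr1 /cubeP /(_ (Ordinal hm)).
  by have := xr (Ordinal hm); rewrite mxE vE; move: (x _ _) => a; lia.
pose C' := translate v @^-1` C.
have mC : measurable (C : set gspace) by exact: measurable_local.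
have mC' : measurable (C' : set gspace) by apply: measurable_local; exact: local_translate.
have SC' : S @^-1` C' = C'.
  (* The translation moves the base point 0 of the heights to [v], which must avoid [L] as well. *)
  have vL0 : v \notin L by rewrite -[v]add0r vL// cube0.
  by apply/seteqP; split=> g Cg; apply: rC Cg => x xr;
    rewrite !height_translate swap_outside// vL.
have AC' : Pr mu (A `+` C') < e / 2.
  rewrite (_ : A `+` C' = translate v @^-1` (A `+` C)); last first.
    by rewrite /C' -{1}(tA v).
  by rewrite Pr_translate//; exact: measurableY.
have mSA : measurable (S @^-1` A) by exact: measurable_pre.
apply: le_trans (Pr_triangle mu mA mC' mSA) _; rewrite (splitr e); apply: lerD; first exact: ltW.
rewrite (_ : C' `+` S @^-1` A = S @^-1` (A `+` C')); last first.
  by rewrite setYC -{1}SC'.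
by rewrite Pr_swap//; [exact: ltW|exact: measurableY].
Qed.

(** Translations fix [A] exactly and swaps fix it up to a null set, so conditioning on [A] keeps
    both invariances. *)
Lemma invariant_conditional mu nu A : invariant mu -> measurable A -> 0 < Pr mu A ->
  (forall v, translate v @^-1` A = A) ->
  (forall B, measurable B -> Pr nu B = Pr mu (B `&` A) / Pr mu A) -> invariant nu.
Proof.
move=> imu mA A0 tA nuE.
suff H (S : gspace -> gspace) C : measurable_fun setT S -> local C ->
    (forall B, measurable B -> Pr mu (S @^-1` B) = Pr mu B) ->
    Pr mu (A `+` S @^-1` A) = 0 -> nu (S @^-1` C) = nu C.
  split=> [v C lC|L x0 z z' C x0L lC]; apply: H => //.
  - exact: measurable_translate.
  - by move=> B mB; rewrite Pr_translate.
  - by rewrite tA setYK Pr0.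
  - exact: measurable_swap.
  - by move=> B mB; rewrite Pr_swap.
  - exact: translation_invariant_swap.
move=> mS lC SB AS0; have mC := measurable_local lC.
have mSC : measurable (S @^-1` C) by exact: measurable_pre.
have mSA : measurable (S @^-1` A) by exact: measurable_pre.
rewrite !PrE// !nuE//; congr (_ / _)%:E.
rewrite -[RHS]SB; last exact: measurableI.
apply: Pr_setY0; [exact: measurableI| |].
  by apply: measurable_pre => //; exact: measurableI.
apply/eqP; rewrite eq_le Pr_ge0 andbT -AS0; apply: PrS.
- by apply: measurableY; [exact: measurableI|apply: measurable_pre => //; exact: measurableI].
- exact: measurableY.
move=> g [[[Cg Ag] nSg]|[[Cg Ag] nSg]].
  by left; split=> // SAg; apply: nSg.
by right; split=> // SAg; apply: nSg.
Qed.

(** An invariant event of probability strictly between 0 and 1 would write the minimiser as a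
    mixture of two conditional measures. These agree on all cylinders by [minimiser_extreme], yet
    give the event the probabilities 1 and 0. *)
Lemma ergodic_exists mu0 B : invariant mu0 ->
  (forall J, \sum_(i < J) Q i (Pr mu0) <= B) ->
  exists mu c, [/\ invariant mu, ergodic mu & forall J, \sum_(i < J) Q i (Pr mu) <= c].
Proof.
move=> inv0 B0; have [mu [c [imu Fmu min_mu]]] := minimiser_exists inv0 B0.
exists mu, c; split=> //; last first.
  move=> J; apply: le_trans _ (Fmu J); apply: ler_sum => i _; rewrite lerDl.
  by rewrite mulr_ge0 ?(ltW (wt_gt0 i))// subr_ge0; case/andP: (sq_test mu i).
split.
  by move=> v A mA; rewrite PrE ?Pr_translate -?PrE//; apply: measurable_pre => //; exact: measurable_translate.
move=> A mA tA; rewrite !PrE//.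
have [->|A0] := eqVneq (Pr mu A) 0; first by left.
have [->|A1] := eqVneq (Pr mu A) 1; first by right.
exfalso.
have {}A0 : 0 < Pr mu A by rewrite lt_neqAle eq_sym A0 Pr_ge0.
have {}A1 : Pr mu A < 1 by rewrite lt_neqAle A1 Pr_le1.
have mCA : measurable (~` A) by exact: measurableC.
have CA0 : 0 < Pr mu (~` A) by rewrite PrC// subr_gt0.
have tCA v : translate v @^-1` (~` A) = ~` A by rewrite -preimage_setC tA.
have [nu nuE] := conditional_probability mA A0.
have [nu' nuE'] := conditional_probability mCA CA0.
have inu : invariant nu by exact: invariant_conditional nuE.
have inu' : invariant nu' by exact: invariant_conditional nuE'.
have muE (D : set gspace) : measurable D ->
    Pr mu D = Pr mu A * Pr nu D + (1 - Pr mu A) * Pr nu' D.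
  move=> mD; rewrite [Pr nu _]nuE// [Pr nu' _]nuE'// -PrC//.
  by rewrite mulrC divfK ?gt_eqF// mulrC divfK ?gt_eqF// -Pr_split.
have eq_cyl l : Pr nu (cyl l) = Pr nu' (cyl l).
  have := @minimiser_extreme mu c nu nu' (Pr mu A) _ Fmu _ _ _ (choice.pickle l).
  rewrite /test_cyl choice.pickleK; apply; first by rewrite A0.
  - by move=> c'; exact: min_mu.
  - by move=> c'; exact: min_mu.
  - by move=> C lC; apply: muE; exact: measurable_local.
have nuA : nu A = nu' A.
  apply: (@measure_cyl_unique m d hd R nu nu'); last exact: mA.
    by rewrite /= probability_setT ltry.
  by move=> l; have mc := @measurable_cyl m d hd l; rewrite /= !PrE// eq_cyl.
have := nuE A mA; have := nuE' A mA; rewrite nuA => ->.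
by rewrite setIid divff ?gt_eqF// setICr Pr0 mul0r => /eqP; rewrite eq_sym oner_eq0.
Qed.

End Minimiser.

(** * Swap invariance implies the Gibbs property *)

Section FiniteSets.

Lemma finite_funs (X : eqType) (Y : Type) (s : seq X) (V : X -> set Y) (y0 : Y) :
  (forall x, finite_set (V x)) ->
  finite_set [set f : X -> Y | (forall x, x \notin s -> f x = y0) /\
                               forall x, x \in s -> V x (f x)].
Proof.
move=> finV; elim: s => [|a s IH].
  apply: (@sub_finite_set _ _ [set cst y0]); last exact: finite_set1.
  by move=> f [f0 _] /=; apply/funext => x; exact: f0.
pose g (u : Y * (X -> Y)) (x : X) := if x == a then u.1 else u.2 x.
apply: (@sub_finite_set _ _ (g @` (V a `*` [set f : X -> Y |
    (forall x, x \notin s -> f x = y0) /\ forall x, x \in s -> V x (f x)]))).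
  move=> f [f0 fV]; have [as_|as_] := boolP (a \in s).
    exists (f a, f); last by apply/funext => x; rewrite /g; case: eqP => [->|].
    split=> /=; first by apply: fV; rewrite inE eqxx.
    split=> x xs; last by apply: fV; rewrite inE xs orbT.
    by apply: f0; rewrite inE negb_or xs andbT; apply: contraNneq xs => ->.
  exists (f a, fun x => if x == a then y0 else f x).
    split=> /=; first by apply: fV; rewrite inE eqxx.
    split=> x xs; last first.
      case: eqP => [xa|_]; first by rewrite xa (negbTE as_) in xs.
      by apply: fV; rewrite inE xs orbT.
    by case: eqVneq => // xa; apply: f0; rewrite inE negb_or xa.
  by apply/funext => x; rewrite /g /=; case: eqP => [->|].
by apply/finite_image/finite_setX.
Qed.

Lemma finite_words (d n : nat) : finite_set [set w : freeinv d | (size (word w) <= n)%N].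
Proof.
have fin_seq : finite_set [set s : seq 'I_d | (size s <= n)%N].
  elim: n => [|n IH].
    apply: (@sub_finite_set _ _ [set [::]]); last exact: finite_set1.
    by move=> s /=; rewrite leqn0 size_eq0 => /eqP.
  apply: (@sub_finite_set _ _ ([set [::]] `|`
     (fun u : 'I_d * seq 'I_d => u.1 :: u.2) @` ([set: 'I_d] `*` [set s : seq 'I_d | (size s <= n)%N]))).
    by move=> [|i s] /= si; [left|right; exists (i, s)].
  rewrite finite_setU; split; first exact: finite_set1.
  by apply/finite_image/finite_setX => //; exact: finite_finset.
apply: (@finite_preimage _ _ _ (@word d) _ fin_seq) => u v _ _; exact: val_inj.
Qed.

Lemma card_fset_set_seq (T : choiceType) (s : seq T) : uniq s ->
  #|` fset_set [set` s]|%fset = size s.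
Proof.
move=> us; have -> : [set` s] = [set` [fset x | x in s]%fset].
  by apply/seteqP; split=> x /=; rewrite !inE.
by rewrite set_fsetK card_fseq undup_id.
Qed.

(** By induction on the list, splitting [P] along the first event. It serves for quantities computed
    from finitely many indicators: their preimages of arbitrary sets are measurable. *)
Lemma measurable_bool_factor d (T : measurableType d) (I : eqType) (E : I -> set T)
    (s : seq I) (P : set T) : (forall i, i \in s -> measurable (E i)) ->
  (forall g g', (forall i, i \in s -> E i g <-> E i g') -> P g -> P g') -> measurable P.
Proof.
elim: s P => [|i s IH] P mE PE.
  have [[g Pg]|/forallNP nP] := pselect (exists g, P g).
    rewrite (_ : P = setT); first exact: measurableT.
    by apply/seteqP; split=> // g' _; apply: PE Pg.
  rewrite (_ : P = set0); first exact: measurable0.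
  by apply/seteqP; split=> // g' /nP.
pose P1 (Q : set T) := [set g | exists g', [/\ P g', Q g' & forall j, j \in s -> E j g' <-> E j g]].
have mP1 Q : measurable (P1 Q).
  apply: IH => [j js|g g' gg' [h [Ph Qh hg]]]; first by apply: mE; rewrite inE js orbT.
  by exists h; split=> // j js; rewrite hg// gg'.
have mEi : measurable (E i) by apply: mE; rewrite inE eqxx.
rewrite (_ : P = (E i `&` P1 (E i)) `|` (~` E i `&` P1 (~` E i))).
  by apply: measurableU; apply: measurableI => //; exact: measurableC.
apply/seteqP; split=> [g Pg|g [[Eg [g' [Pg' Eg' gg']]]|[Eg [g' [Pg' Eg' gg']]]]].
- by have [Eg|Eg] := pselect (E i g); [left|right]; split=> //; exists g.
- by apply: PE Pg' => j; rewrite inE => /orP[/eqP -> //|/gg'].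
- by apply: PE Pg' => j; rewrite inE => /orP[/eqP -> //|/gg'].
Qed.

End FiniteSets.

Section GibbsFromSwaps.
Variables (R : realType) (m d : nat) (hd : (2 <= d)%N).
Notation site := 'rV[int]_m.
Notation G := (freeinv d).
Notation grad := (gradient m hd).
Notation gspace := (gradient_space m hd).
Implicit Types (h : site -> G) (g : grad) (z : site -> G) (A B : set gspace).
Variables (L : seq site) (x0 : site).
Hypothesis x0L : x0 \notin L.

Let outgen : set (set gspace) := [set A | exists x y w, [/\ ~ [set` L] x, ~ [set` L] y &
         A = [set g | (height g x)^-1 * height g y = w]%g]].
Let Ot := g_sigma_algebraType outgen.
Let outs : set (set gspace) := outside [set` L].

Let outsE (A : set Ot) : measurable A = outs A. Proof. by []. Qed.

(** Heights relative to [x0], itself outside [L]: at sites outside [L] they generate the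
    sigma-algebra [outs]. *)
Let rel g (x : site) : G := ((height g x0)^-1 * height g x)%g.

Let out_local (r : seq site) (P : set gspace) : (forall x, x \in r -> x \notin L) ->
  (forall g g', {in r, rel g =1 rel g'} -> P g -> P g') -> outs P.
Proof.
move=> rL PE; pose E (p : site * G) : set Ot := [set g | rel g p.1 = p.2].
have mE p : p.1 \notin L -> measurable (E p).
  move=> pL; apply: sub_sigma_algebra; exists x0, p.1, p.2; split=> //=; exact/negP.
have PU : P = \bigcup_(s in [set s : seq G | exists2 g, P g & s = map (rel g) r])
   [set g | map (rel g) r = s].
  apply/seteqP; split=> [g Pg|g [s [g' Pg' ->] /= gs]].
    by exists (map (rel g) r) => //; exists g.
  by apply: PE Pg' => x xr; move/eq_in_map: gs => ->.
rewrite -outsE PU bigcup_mkcond.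
apply: countable_bigcupT_measurable => [|s]; first exact: countableP.
case: ifP => _; last exact: measurable0.
elim: r s {PE PU} rL => [|x r IH] [|w s] rL.
- rewrite (_ : [set _ | _] = setT); [exact: measurableT|by apply/seteqP; split].
- rewrite (_ : [set _ | _] = set0); [exact: measurable0|by apply/seteqP; split].
- rewrite (_ : [set _ | _] = set0); [exact: measurable0|by apply/seteqP; split].
rewrite (_ : [set _ | _] = E (x, w) `&` [set g | map (rel g) r = s]).
  apply: measurableI; first by apply: mE; apply: rL; rewrite inE eqxx.
  by apply: IH => y yr; apply: rL; rewrite inE yr orbT.
apply/seteqP; split=> g /=; first by case=> <- <-.
by move=> [+ <-]; rewrite /E /= => ->.
Qed.

Let outs_gspace (A : set gspace) : outs A -> measurable A.
Proof.
apply: smallest_sub; first exact: sigma_algebra_measurable.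
move=> _ [x [y [w [_ _ ->]]]]; apply: measurable_local; exists [:: x; y] => g g' gg' /=.
by rewrite !gg' ?inE ?eqxx ?orbT.
Qed.

Let outs_swap z z' (A : set gspace) : outs A -> swap L x0 z z' @^-1` A = A.
Proof.
apply: (@smallest_sub _ _ outgen [set A : set gspace | swap L x0 z z' @^-1` A = A]).
  split=> [//|B /= BE|F /= FE]; first by rewrite !setTD -preimage_setC BE.
  by rewrite preimage_bigcup; apply: eq_bigcupr => i _; exact: FE.
move=> _ [x [y [w [xL yL ->]]]] /=; apply/seteqP; split=> g /=;
  by rewrite swap_outside//; exact/negP.
Qed.

Let pt z g : site -> G := patch L x0 z (height g).
Let valid z : set gspace := [set g | is_hom (pt z g)].
Let fit z : set gspace := [set g | fits L x0 z (height g)].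
Let hit z A : set gspace := [set g | is_hom (pt z g) /\ A (gr hd (pt z g))].

Let rpt z g (x : site) : G := if x \in L then z x else rel g x.

Let ptE z g x : pt z g x = (height g x0 * rpt z g x)%g.
Proof. by rewrite /pt /patch /rpt /rel; case: ifP => // _; rewrite mulgA mulgV mul1g. Qed.

Let nbhdL : seq site := [seq y <- [seq x + v | x <- L, v <- cube m 1] | y \notin L].

Let mem_nbhdL x y : x \in L -> l1norm (x - y) = 1%N -> y \notin L -> y \in nbhdL.
Proof.
move=> xL xy yL; rewrite mem_filter yL; apply/allpairsP; exists (x, y - x); split=> //=.
  by have := cube_l1norm (y - x); rewrite l1norm_sym xy.
by rewrite addrC subrK.
Qed.

Let validE z g : is_hom (pt z g) <-> forall x y, x \in L -> l1norm (x - y) = 1%N ->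
  adj (rpt z g x) (rpt z g y).
Proof.
rewrite /pt (patch_homP L x0 z (height_hom g)); split=> H x y xL xy; have := H x y xL xy.
  by rewrite -!/(pt z g _) !ptE; exact: adj_mullE.
by rewrite -!/(pt z g _) !ptE; exact: adj_mull.
Qed.

Let valid_rel z g g' : {in nbhdL, rel g =1 rel g'} -> is_hom (pt z g) -> is_hom (pt z g').
Proof.
move=> gg' /validE H; apply/validE => x y xL xy; have := H x y xL xy.
rewrite /rpt xL; case: (boolP (y \in L)) => // yL.
by rewrite gg'//; exact: mem_nbhdL xL xy yL.
Qed.

Let outs_valid z : outs (valid z).
Proof.
apply: (@out_local nbhdL); last by move=> g g'; exact: valid_rel.
by move=> x; rewrite mem_filter => /andP[].
Qed.

(** [A] may depend on the heights in [L], but patching overwrites these. As [hit z] respects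
    countable unions, and complements within [valid z], cylinders suffice. *)
Let outs_hit z A : measurable A -> outs (hit z A).
Proof.
have mV : measurable (valid z : set Ot) by exact: outs_valid.
move: A; rewrite gradient_measurableE; apply: smallest_sub; last first.
  move=> _ [l _ <-].
  apply: (@out_local (nbhdL ++ [seq y <- 0 :: map fst l | y \notin L])).
    by move=> x; rewrite mem_cat !mem_filter => /orP[] /andP[].
  move=> g g' gg' [vg cg].
  have vg' : is_hom (pt z g').
    by apply: valid_rel vg => x xr; apply: gg'; rewrite mem_cat xr.
  split=> // p pl; rewrite -(cg p pl) !height_gr// !ptE !invgM -!mulgA.
  rewrite !(mulgA (height _ x0)^-1%g) !mulVg !mul1g.
  have E x : x \in 0 :: map fst l -> rpt z g' x = rpt z g x.
    move=> xl; rewrite /rpt; case: ifPn => // xL; rewrite gg'//.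
    by rewrite mem_cat mem_filter xL xl orbT.
  by rewrite !E// inE ?eqxx// (map_f fst pl) orbT.
split.
- rewrite (_ : hit z set0 = set0); first exact: (@measurable0 _ Ot).
  by apply/seteqP; split=> // g [].
- move=> B hB; rewrite (_ : hit z _ = valid z `\` hit z B).
    by apply: (@measurableD _ Ot).
  by apply/seteqP; split=> g [vg]; [move=> [_ nB]; split=> // -[]|move=> nB; split=> //; split=> // Bg; apply: nB].
- move=> F hF; rewrite (_ : hit z _ = \bigcup_k hit z (F k)).
    exact: (@bigcupT_measurable _ Ot).
  apply/seteqP; split=> g.
    by move=> [vg [k _ Fg]]; exists k.
  by move=> [k _ [vg Fg]]; split=> //; exists k.
Qed.

(** The length bound is the Lipschitz bound from [x0] and makes the set finite; the value 1 off [L]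
    makes each interior occur once. *)
Let zset : set (site -> G) := [set z | (forall x, x \notin L -> z x = 1%g) /\
  forall x, x \in L -> (size (word (z x)) <= l1norm (x0 - x))%N].

Let zset_fin : finite_set zset.
Proof.
apply: (@finite_funs _ _ L (fun x => [set w : G | (size (word w) <= l1norm (x0 - x))%N])).
by move=> x; exact: finite_words.
Qed.

Let zs : seq (site -> G) := fset_set zset.

Let mem_zs z : z \in zs <-> zset z.
Proof. by have /(congr1 (fun S => S z)) := fset_setK zset_fin; rewrite /= => <-. Qed.

Let zs_uniq : uniq zs. Proof. exact: fset_uniq. Qed.

Let zof h (h' : site -> G) : site -> G := fun x => if x \in L then ((h x0)^-1 * h' x)%g else 1%g.

Let zof_in h h' : is_hom h' -> h' x0 = h x0 -> zset (zof h h').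
Proof.
move=> hh' h0; split=> x xL; rewrite /zof; first by rewrite (negbTE xL).
by rewrite xL -h0 -tree_distE; exact: hom_lip.
Qed.

Let zof_patch h z : zset z -> zof h (patch L x0 z h) = z.
Proof.
move=> [z1 _]; apply/funext => x; rewrite /zof /patch.
by case: (boolP (x \in L)) => xL; [rewrite mulgA mulVg mul1g|rewrite z1].
Qed.

(** All ways to redraw [h] are patches by members of the list [zs], which does not depend on [h];
    only the validity of a member does. *)
Let choices_patch h : choices [set` L] h =
  [set` [seq patch L x0 z h | z <- zs & `[< is_hom (patch L x0 z h) >]]].
Proof.
apply/seteqP; split=> [h' [hh' h'h]|h'] /=.
  have h0 : h' x0 = h x0 by apply: h'h; exact/negP.
  have pE : patch L x0 (zof h h') h = h'.
    apply/funext => x; rewrite /patch /zof; case: (boolP (x \in L)) => xL.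
      by rewrite mulgA mulgV mul1g.
    by rewrite h'h//=; exact/negP.
  apply/mapP; exists (zof h h'); rewrite ?pE// mem_filter pE; apply/andP; split.
    exact/asboolP.
  by apply/mem_zs; exact: zof_in.
move=> /mapP[z]; rewrite mem_filter => /andP[/asboolP hp _ ->]; split=> // x xL.
by rewrite /patch; case: ifP => // xL'; case: xL.
Qed.

Let patch_inj h : {in zs &, injective (fun z => patch L x0 z h)}.
Proof.
move=> z z' /mem_zs Zz /mem_zs Zz' zz'.
by rewrite -(zof_patch h Zz) zz' zof_patch.
Qed.

Let uniform_probE A g : Defs.uniform_prob R [set` L] (height g) A =
  (count (fun z => `[< hit z A g >]) zs)%:R / (count (fun z => `[< valid z g >]) zs)%:R.
Proof.
rewrite /Defs.uniform_prob choices_patch; congr (_%:R / _%:R).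
  rewrite (_ : _ `&` _ = [set` [seq patch L x0 z (height g) | z <- zs & `[< hit z A g >]]]).
    rewrite card_fset_set_seq ?size_map ?size_filter//.
    rewrite map_inj_in_uniq ?filter_uniq//.
    by move=> z z'; rewrite !mem_filter => /andP[_ ?] /andP[_ ?]; exact: patch_inj.
  apply/seteqP; split=> h' /=.
    move=> [/mapP[z]]; rewrite mem_filter => /andP[/asboolP hp zz ->] [g' Ag' pg'].
    apply/mapP; exists z => //; rewrite mem_filter zz andbT; apply/asboolP; split=> //.
    by rewrite (gr_dual hp pg').
  move=> /mapP[z]; rewrite mem_filter => /andP[/asboolP[hp Az] zz ->]; split.
    by apply/mapP; exists z => //; rewrite mem_filter zz andbT; apply/asboolP.
  by exists (gr hd (pt z g)) => //; exact: grP.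
rewrite card_fset_set_seq ?size_map ?size_filter//.
rewrite map_inj_in_uniq ?filter_uniq//.
by move=> z z'; rewrite !mem_filter => /andP[_ ?] /andP[_ ?]; exact: patch_inj.
Qed.

Let nu g : R := ((count (fun z => `[< valid z g >]) zs)%:R)^-1.

Let nu_ge0 g : 0 <= nu g. Proof. by rewrite invr_ge0. Qed.

Let fitE g : exists2 z, z \in zs & forall z', z' \in zs -> (fit z' g <-> z' = z).
Proof.
have Z : zset (zof (height g) (height g)) by apply: zof_in => //; exact: height_hom.
exists (zof (height g) (height g)); first exact/mem_zs.
move=> z' /mem_zs Zz'; split=> [/patch_fits pz|->].
  by rewrite -{2}pz zof_patch.
by move=> x xL; rewrite /zof xL mulgA mulgV mul1g.
Qed.

Let sum_fit g : \sum_(z <- zs) (\1_(fit z) g : R) = 1.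
Proof.
have [z zz zE] := fitE g; rewrite (bigD1_seq z)//= indicE mem_set; last exact/zE.
rewrite big_seq_cond big1 ?addr0// => z' /andP[z'z nz]; rewrite indicE memNset//.
by move/(zE _ z'z) => e; rewrite e eqxx in nz.
Qed.

Let sum_valid g : (\sum_(z <- zs) (\1_(valid z) g : R)) * nu g = 1.
Proof.
have -> : \sum_(z <- zs) (\1_(valid z) g : R) = (count (fun z => `[< valid z g >]) zs)%:R.
  rewrite -sum1_count natr_sum [RHS]big_mkcond/=; apply: eq_bigr => z _.
  by rewrite indicE; case: asboolP => v; [rewrite mem_set|rewrite memNset].
rewrite /nu divff// pnatr_eq0 -lt0n -has_count; apply/hasP.
have [z zz zE] := fitE g; exists z => //; apply/asboolP.
have /patch_fits : fit z g by exact/zE.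
by rewrite /valid /= /pt => ->; exact: height_hom.
Qed.

Let uniform_sum A g : Defs.uniform_prob R [set` L] (height g) A =
  \sum_(z' <- zs) (\1_(hit z' A) g * nu g).
Proof.
rewrite uniform_probE -mulr_suml; congr (_ * _).
rewrite -sum1_count natr_sum [LHS]big_mkcond/=; apply: eq_bigr => z _.
by rewrite indicE; case: asboolP => v; [rewrite mem_set|rewrite memNset].
Qed.

Let uniform_measurable A (Y : set R) : measurable A ->
  outs ((fun g => Defs.uniform_prob R [set` L] (height g) A) @^-1` Y).
Proof.
move=> mA; rewrite -outsE.
apply: (@measurable_bool_factor _ Ot _ (fun u : bool * (site -> G) =>
   if u.1 then hit u.2 A else valid u.2) [seq (b, z) | b <- [:: true; false], z <- zs]).
  by move=> [[] z] _ /=; [exact: outs_hit|exact: outs_valid].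
move=> g g' gg' /=; rewrite !uniform_probE.
have E (b : bool) z : z \in zs -> `[< (if b then hit z A else valid z) g >] =
    `[< (if b then hit z A else valid z) g' >].
  move=> zz; apply: asbool_equiv_eq; apply: (gg' (b, z)).
  by apply/allpairsP; exists (b, z); split=> //=; rewrite !inE; case: (b).
have -> : count (fun z => `[< hit z A g' >]) zs = count (fun z => `[< hit z A g >]) zs.
  by apply: eq_in_count => z zz /=; rewrite (E true).
have -> // : count (fun z => `[< valid z g' >]) zs = count (fun z => `[< valid z g >]) zs.
by apply: eq_in_count => z zz /=; rewrite (E false).
Qed.

Variable mu : probability gspace R.
Hypothesis imu : invariant mu.

(** The configuration lies in [A] and [B], shows the interior [z'], and could have shown [z]; the
    weight [nu] is the probability of each admissible interior. *)
Let Phi A B z z' g : R := \1_(A `&` B `&` fit z' `&` valid z) g * nu g.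

Let swap_fit z z' g : fit z g -> valid z' g ->
  height (swap L x0 z z' g) = (fun x => (pt z' g 0)^-1 * pt z' g x)%g.
Proof.
move=> fg vg; apply/funext => x; rewrite height_swap /sw; case: asboolP => //.
by case; split.
Qed.

Let swap_fit' z z' g : fit z' g -> valid z g ->
  height (swap L x0 z z' g) = (fun x => (pt z g 0)^-1 * pt z g x)%g.
Proof.
move=> fg vg; apply/funext => x; rewrite height_swap /sw; case: asboolP => [[fz _]|_].
  by rewrite /pt (patch_fits fz) (patch_fits fg).
by case: asboolP => // -[].
Qed.

Let fit_swap z z' g w w' : height g = (fun x => (pt w' w 0)^-1 * pt w' w x)%g ->
  fit w' g.
Proof.
move=> e; rewrite /fit /= e; apply/fits_mull; exact: fits_patch.
Qed.

(** When [z] fits and [z'] is admissible, the swap puts in [z'], so membership in [A] becomes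
    [hit z' A]; otherwise both sides vanish. [B] and [nu] depend only on the outside and are
    unchanged. *)
Let Phi_swap A B z z' g : outs B ->
  Phi A B z z' (swap L x0 z z' g) =
  \1_B g * (\1_(fit z) g * (\1_(hit z' A) g * nu g)).
Proof.
move=> oB; set Sg := swap L x0 z z' g.
have nuS : nu Sg = nu g.
  rewrite /nu; congr (_%:R^-1); apply: eq_count => w; apply: asbool_equiv_eq.
  by rewrite -{2}(outs_swap z z' (outs_valid w)).
have BS : B Sg <-> B g by rewrite -{2}(outs_swap z z' oB).
have [[fg vg]|nfv] := pselect (fit z g /\ valid z' g).
  have hS := swap_fit fg vg.
  have fS : fit z' Sg by exact: fit_swap hS.
  have vS : valid z Sg.
    rewrite /valid /pt /= hS patch_mull; apply/hom_mullE.
    by rewrite /pt patch_patch// (patch_fits fg); exact: height_hom.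
  have SE : Sg = gr hd (pt z' g).
    by apply: height_inj => x; rewrite hS height_gr.
  transitivity ((\1_B g * \1_(hit z' A) g) * nu g); last first.
    by rewrite [\1_(fit z) g]indicE (mem_set fg) mul1r mulrA.
  rewrite /Phi nuS; congr (_ * _); rewrite !indicE -natrM mulnb; congr (nat_of_bool _)%:R.
  apply/idP/andP => [/set_mem[[[AS BSg] _] _]|[/set_mem Bg /set_mem[_ Ag]]].
    split; apply: mem_set; first exact/BS.
    by split=> //; rewrite -SE.
  by apply: mem_set; split=> //; split=> //; split; [rewrite SE|apply/BS].
have L0 : \1_(fit z) g * (\1_(hit z' A) g * nu g) = 0 :> R.
  rewrite !indicE; have [fg|fg] := pselect (fit z g); last by rewrite memNset ?mul0r.
  have -> : (g \in hit z' A) = false by apply: memNset => -[vg _]; apply: nfv.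
  by rewrite mul0r mulr0.
rewrite L0 mulr0 /Phi indicE memNset ?mul0r// => -[[[_ _] fS] vS]; apply: nfv.
have := swap_fit' fS vS; rewrite swapK// => hg.
split; first exact: fit_swap hg.
rewrite /valid /pt /= hg patch_mull; apply/hom_mullE.
by rewrite /pt patch_patch// (patch_fits fS); exact: height_hom.
Qed.

Let m_fit z : measurable (fit z).
Proof.
apply: measurable_local; exists (x0 :: L) => g g' gg' fg x xL.
have E y : y \in x0 :: L -> height g' y = height g y by move=> /gg' ->.
by rewrite !E ?inE ?eqxx ?xL ?orbT//; exact: fg.
Qed.

Let m_valid z : measurable (valid z). Proof. by apply: outs_gspace; exact: outs_valid. Qed.

Let m_nu : measurable_fun setT (nu : gspace -> R).
Proof.
move=> _ Y mY; rewrite setTI; apply: (@measurable_bool_factor _ gspace _ valid zs).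
  by move=> z _; exact: m_valid.
move=> g g' gg'; rewrite /= /nu.
have -> // : count (fun z => `[< valid z g' >]) zs = count (fun z => `[< valid z g >]) zs.
by apply: eq_in_count => z zz /=; apply: asbool_equiv_eq; have [] := gg' z zz.
Qed.

Let m_Phi A B z z' : measurable A -> measurable B -> measurable_fun setT (Phi A B z z' : gspace -> R).
Proof.
move=> mA mB; apply: measurable_funM => //; apply: measurable_indic.
by apply: measurableI => //; apply: measurableI => //; exact: measurableI.
Qed.

Let Phi_ge0 A B z z' g : (0 <= (Phi A B z z' g)%:E)%E.
Proof. by rewrite lee_fin mulr_ge0. Qed.

Let int_swap z z' (f : gspace -> R) : measurable_fun setT f -> (forall g, 0 <= f g) ->
  (\int[mu]_g (f (swap L x0 z z' g))%:E = \int[mu]_g (f g)%:E)%E.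
Proof.
move=> mf f0; have mS := @measurable_swap m d hd L x0 z z' x0L.
have mEf : measurable_fun setT (EFin \o f : gspace -> \bar R) by exact/measurable_EFinP.
have := @ge0_integral_pushforward _ _ gspace gspace R _ mS mu setT (EFin \o f) measurableT mEf.
move=> /(_ _)/esym; rewrite preimage_setT => -> //; last by move=> g _; rewrite /= lee_fin.
apply: eq_measure_integral => A mA _; apply: (@invariant_measurable R m d hd mu) => //.
by move=> C lC; case: imu => _; exact.
Qed.

(** Mass transport: drawing [z'] when [z] is present carries the same mass as drawing [z] when [z']
    is present. Summing over [z] and [z'], the first side gives the integral of the uniform
    probability over [B], the second gives [mu (A & B)], because exactly one interior fits and the
    admissible ones have total weight 1. *)
Lemma swap_invariant_cond_prob A : measurable A ->
  is_cond_prob mu (outside [set` L]) A (fun g => Defs.uniform_prob R [set` L] (height g) A).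
Proof.
move=> mA; split=> [Y mY|B oB]; first exact: uniform_measurable.
have mB : measurable B by exact: outs_gspace.
have E1 : (\int[mu]_(g in B) (Defs.uniform_prob R [set` L] (height g) A)%:E =
   \int[mu]_g (\sum_(u <- [seq (z, z') | z <- zs, z' <- zs])
       (Phi A B u.1 u.2 (swap L x0 u.1 u.2 g))%:E))%E.
  rewrite integral_mkcond; apply: eq_integral => g _; rewrite patchE.
  transitivity ((\1_B g * Defs.uniform_prob R [set` L] (height g) A)%:E).
    by rewrite indicE; case: ifP => _; rewrite ?mul1r ?mul0r.
  rewrite sumEFin; congr EFin; rewrite big_allpairs/=.
  rewrite uniform_sum -[in LHS](mul1r (\sum_(z' <- zs) _)) -(sum_fit g) mulr_suml mulr_sumr.
  apply: eq_bigr => z _; rewrite mulr_sumr mulr_sumr; apply: eq_bigr => z' _.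
  by rewrite Phi_swap.
have E2 : (\int[mu]_g (\sum_(u <- [seq (z, z') | z <- zs, z' <- zs])
       (Phi A B u.1 u.2 g)%:E) = mu (A `&` B))%E.
  rewrite -[A `&` B]setIT -integral_indic//; last exact: measurableI.
  apply: eq_integral => g _; rewrite sumEFin; congr EFin; rewrite big_allpairs/=.
  rewrite exchange_big/= -[RHS]mulr1 -(sum_fit g) mulr_sumr; apply: eq_bigr => z' _.
  rewrite -[RHS]mulr1 -(sum_valid g) mulrA mulr_sumr mulr_suml; apply: eq_bigr => z _.
  by rewrite /Phi !indicI.
rewrite E1 -E2 !ge0_integral_sum//.
- by apply: eq_bigr => -[z z'] _ /=; apply: int_swap; [exact: m_Phi|move=> g; rewrite -lee_fin].
- by move=> u; apply/measurable_EFinP; exact: m_Phi.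
- move=> u; apply/measurable_EFinP.
  apply: (@measurableT_comp _ _ _ gspace gspace _ (Phi A B u.1 u.2)); first exact: m_Phi.
  exact: measurable_swap.
Qed.

End GibbsFromSwaps.

Lemma invariant_gibbs (R : realType) (m d : nat) (hd : (2 <= d)%N)
    (mu : probability (gradient_space m hd) R) : (0 < m)%N -> invariant mu -> gradient_gibbs mu.
Proof.
move=> hm imu L /finite_seqP[s ->] A mA.
have [r sr] := seq_cube s.
pose x0 : 'rV[int]_m := delta_mx 0 (Ordinal hm) *+ r.+1.
have x0s : x0 \notin s.
  apply/negP => /sr /cubeP /(_ (Ordinal hm)).
  rewrite /x0 mulmxnE mxE !eqxx /= (_ : (1 *+ r.+1 : int) = r.+1%:Z); last exact: natz.
  by rewrite absz_nat ltnn.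
exact: swap_invariant_cond_prob x0s _ imu _ mA.
Qed.

(** * Homomorphisms on the torus *)

Lemma l1norm1 (m : nat) (v : 'rV[int]_m) : l1norm v = 1%N ->
  exists k, `|v 0 k| = 1 /\ forall j, j != k -> v 0 j = 0.
Proof.
move=> v1; have /rV0Pn[k vk] : v != 0.
  by apply/eqP => v0; move: v1; rewrite v0 l1norm0.
exists k; move: v1; rewrite /l1norm (bigD1 k)//= => e.
have k1 : (0 < `|v 0%R k|)%N by rewrite absz_gt0.
have s0 : (\sum_(i < m | i != k) `|v 0%R i|)%N = 0%N.
  by move: e k1; move: (bigop _ _ _) (`|v 0%R k|)%N => a b; lia.
split; first by move: e; rewrite s0 addn0; move: (v 0 k) => a; lia.
by move=> j jk; move: s0; rewrite (bigD1 j)//= => /eqP; rewrite addn_eq0 absz_eq0 => /andP[/eqP].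
Qed.

Lemma perm_map_can (T : eqType) (s : seq T) (f g : T -> T) : uniq s ->
  (forall x, x \in s -> f x \in s) -> (forall x, x \in s -> g (f x) = x) ->
  perm_eq (map f s) s.
Proof.
move=> us fs gf.
have fi : {in s &, injective f} by move=> x y xs ys e; rewrite -(gf x)// e gf.
have sub : {subset map f s <= s} by move=> _ /mapP[x xs ->]; exact: fs.
have um : uniq (map f s) by rewrite map_inj_in_uniq.
have [_ e] := uniq_min_size um sub (eq_leq (esym (size_map f s))).
exact: uniq_perm.
Qed.

(* Homs with [h (x + N v) = g^(tw v) h x]: the gradients of the N-periodic
   torus with holonomy in the axis translations. *)
Section Torus.
Variables (m q : nat).
Notation d := q.+2.
Notation site := 'rV[int]_m.
Notation G := (freeinv d).
Implicit Types (h : site -> G) (x y v : site).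
Lemma bus_step h x y : is_hom h -> l1norm (x - y) = 1%N -> `|bus (h x) - bus (h y)| = 1.
Proof. by move=> /is_homP hh /hh /adj_parent[] [_ ->]; lia. Qed.

Lemma bus_lip_hom h x y : is_hom h -> `|bus (h x) - bus (h y)| <= (l1norm (x - y))%:Z.
Proof. by move=> hh; apply: le_trans (bus_lip _ _) _; rewrite lez_nat; exact: hom_lip. Qed.

Variables (M : nat) (p : 'I_m -> nat).
Hypothesis M0 : (0 < M)%N.
Hypothesis pM : forall k, (p k <= M)%N.
Let N : int := (2 * M)%N%:Z.

(** The exponent of the holonomy. A power [t] of the axis translation raises [bus] by [2 t] and the
    period is [2 M], so the heights have mean slope [p k / M]. *)
Definition tw v : int := \sum_k (p k)%:Z * v 0 k.

Lemma twD v v' : tw (v + v') = tw v + tw v'.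
Proof. by rewrite /tw -big_split; apply: eq_bigr => k _; rewrite mxE mulrDr. Qed.

Lemma tw0 : tw 0 = 0.
Proof. by rewrite /tw big1// => k _; rewrite mxE mulr0. Qed.

Lemma twN v : tw (- v) = - tw v.
Proof. by apply: (addrI (tw v)); rewrite -twD !subrr tw0. Qed.

Definition torus h : Prop := is_hom h /\ forall v x, h (x + N *: v) = (gz q (tw v) * h x)%g.

Definition red x : site := \row_k (x 0%R k %% N)%Z.
Definition quo x : site := \row_k (x 0%R k %/ N)%Z.

Let N0 : N != 0. Proof. by rewrite /N; lia. Qed.

Lemma red_quo x : red x + N *: quo x = x.
Proof. by apply/rowP => k; rewrite !mxE addrC mulrC -divz_eq. Qed.

Lemma redD x v : red (x + N *: v) = red x.
Proof. by apply/rowP => k; rewrite !mxE addrC mulrC modzMDl. Qed.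

Lemma quoD x v : quo (x + N *: v) = quo x + v.
Proof. by apply/rowP => k; rewrite !mxE addrC mulrC divzMDl// addrC. Qed.

Lemma red_small x : (forall k, 0 <= x 0 k < N) -> red x = x.
Proof. by move=> xs; apply/rowP => k; rewrite mxE modz_small// gtr0_norm ?xs// /N; lia. Qed.

Lemma quo_small x : (forall k, 0 <= x 0 k < N) -> quo x = 0.
Proof.
move=> /red_small r; have := red_quo x; rewrite r => /eqP.
rewrite -subr_eq0 addrAC subrr add0r scalemx_eq0 (negbTE N0) /= => /eqP //.
Qed.

Lemma redE_small x k : 0 <= red x 0 k < N.
Proof. by rewrite mxE modz_ge0//= ltz_pmod// /N; lia. Qed.

Lemma red_red x : red (red x) = red x.
Proof. by apply: red_small => k; exact: redE_small. Qed.

Lemma quo_red x : quo (red x) = 0.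
Proof. by apply: quo_small => k; exact: redE_small. Qed.

Definition box : seq site := [seq x <- cube m (2 * M) | red x == x].

Lemma mem_box x : (x \in box) = (red x == x).
Proof.
rewrite mem_filter; case: eqP => //= rx; apply/cubeP => k.
by have := redE_small x k; rewrite rx /N; move: (x 0 k) => a; lia.
Qed.

Lemma red_box x : red x \in box. Proof. by rewrite mem_box red_red. Qed.

Lemma torus_red h x : torus h -> h x = (gz q (tw (quo x)) * h (red x))%g.
Proof. by move=> [_ th]; rewrite -th red_quo. Qed.

Lemma torus_gz h t : torus h -> torus (fun x => gz q t * h x)%g.
Proof.
move=> [hh th]; split; first exact: hom_mull.
by move=> v x; rewrite th !mulgA gzC.
Qed.

Lemma torus_shift h v : torus h -> torus (fun x => h (x + v)).
Proof.
move=> [hh th]; split; first exact: hom_shift.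
by move=> w x; rewrite addrAC th.
Qed.

Lemma bus_torus h x v : torus h -> bus (h (x + N *: v)) = bus (h x) + 2 * tw v.
Proof. by move=> [_ ->]; rewrite bus_gz. Qed.

(** One representative from each orbit of the axis translations, with height 0 or 1 at the origin;
    the gradient is unchanged. *)
Definition nrm h : site -> G := fun x => (gz q (- (bus (h 0%R) %/ 2)%Z) * h x)%g.

Definition normal h : Prop := torus h /\ (0 <= bus (h 0) < 2).

Lemma nrm_normal h : torus h -> normal (nrm h).
Proof.
move=> th; split; first exact: torus_gz.
by rewrite /nrm bus_gz; move: (bus _) => a; clear; lia.
Qed.

Lemma normal_gz h t : normal h -> normal (fun x => gz q t * h x)%g -> t = 0.
Proof. by move=> [_ h0] [_]; rewrite bus_gz; move: (bus _) h0 => a; clear; lia. Qed.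

Lemma nrm_gr (hd : (2 <= d)%N) h : torus h -> gr hd (nrm h) = gr hd h.
Proof. by move=> [hh _]; rewrite /nrm gr_mull. Qed.

Lemma nrm_cancel (F F' : (site -> G) -> site -> G) h :
  (forall h, torus h -> torus (F h)) -> (forall h, torus h -> torus (F' h)) ->
  (forall h t, F' (fun x => gz q t * h x)%g = (fun x => gz q t * F' h x)%g) ->
  F' (F h) = h -> normal h -> nrm (F' (nrm (F h))) = h.
Proof.
move=> tF tF' F'gz FK nh; have [th _] := nh.
have n2 : normal (nrm (F' (nrm (F h)))).
  by apply/nrm_normal/tF'; case: (nrm_normal (tF h th)).
have [t E] : exists t, nrm (F' (nrm (F h))) = (fun x => gz q t * h x)%g.
  have [c E] : exists c, nrm (F h) = (fun x => gz q c * F h x)%g by eexists.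
  have [c' ->] : exists c', nrm (F' (nrm (F h))) = (fun x => gz q c' * F' (nrm (F h)) x)%g.
    by eexists.
  by exists (c' + c); rewrite E F'gz FK; apply/funext => x; rewrite mulgA -gzD.
by move: n2; rewrite E => /(normal_gz nh) ->; apply/funext => x; rewrite gz0 mul1g.
Qed.

Section Depth.
Variable k0 : 'I_m.
Hypothesis pk0 : (0 < p k0)%N.

(** Along a segment of length [N] in direction [- e] all heights stay below [bus (h x) + N], so all
    its vertices share one ancestor [a] at that level. The segment ends at a translate of [h x],
    whence translating [a] forward gives an ancestor of [a]. Iterated, this reaches the axis;
    translating back, [a] lies on it. *)
Lemma torus_depth h x : torus h -> anc (2 * M) (h x) = ax q (bus (h x) + N).
Proof.
move=> [hh th]; pose e : site := delta_mx 0 k0; pose Lv := bus (h x) + N.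
have stepU (i : nat) : (i <= 2 * M)%N -> up Lv (h (x - e *+ i)) = up Lv (h x) /\
    bus (h (x - e *+ i)) <= bus (h x) + i%:Z.
  elim: i => [|i IH] iN; first by rewrite mulr0n subr0 addr0.
  have [IH1 IH2] := IH (ltnW iN).
  have nb : l1norm ((x - e *+ i) - (x - e *+ i.+1)) = 1%N.
    by rewrite opprB addrC addrA subrK mulrSr addrAC subrr add0r l1norm_delta.
  have b1 : bus (h (x - e *+ i.+1)) <= bus (h x) + i.+1%:Z.
    by have := bus_step hh nb; move: IH2; move: (bus _) (bus _) (bus _) => a b c; lia.
  split=> //; rewrite -IH1; apply: up_adj.
  - by apply: adjC; move/is_homP: hh; exact.
  - by apply: le_trans b1 _; rewrite /Lv /N lerD2l lez_nat.
  - by apply: le_trans IH2 _; rewrite /Lv /N lerD2l lez_nat; exact: ltnW.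
have [/esym U _] := stepU (2 * M)%N (leqnn _).
have Ne : e *+ (2 * M) = N *: e.
  by rewrite /N -scaler_nat; congr (_ *: _); exact: natz.
have tE : tw (- e) = - (p k0)%:Z.
  rewrite twN /tw (bigD1 k0)//= mxE !eqxx mulr1 big1 ?addr0// => j /negbTE jk.
  by rewrite mxE jk andbF mulr0.
rewrite Ne -scalerN th tE in U.
set a := up Lv (h x) in U.
have ba : bus a = Lv by rewrite /a bus_up// /Lv /N; lia.
have ga : (gz q (p k0)%:Z * a = anc (2 * p k0) a)%g.
  by rewrite {1}U -up_gz mulgA -gzD subrr gz0 mul1g /a -up_upD// /Lv /N; lia.
have gan (n : nat) : (gz q (n%:Z * (p k0)%:Z) * a = anc (n * (2 * p k0)) a)%g.
  elim: n => [|n IH]; first by rewrite mul0r gz0 mul1g.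
  have -> : n.+1%:Z * (p k0)%:Z = (p k0)%:Z + n%:Z * (p k0)%:Z by rewrite intS mulrDl mul1r.
  have -> : (n.+1 * (2 * p k0) = n * (2 * p k0) + 2 * p k0)%N by rewrite mulSn addnC.
  by rewrite gzD -mulgA IH -anc_gz ga /anc -iterD.
have [n0 hn0] := anc_axE a.
have := gan n0; rewrite hn0; last by rewrite leq_pmulr// muln_gt0.
rewrite ba (_ : Lv + _ = Lv + 2 * (n0%:Z * (p k0)%:Z)); last first.
  by rewrite PoszM PoszM; ring.
rewrite -gz_ax => /mulgI; rewrite /a /Lv /up => <-.
by congr anc; rewrite addrAC subrr add0r /N absz_nat.
Qed.

Lemma torus_size h x : torus h ->
  (size (word (h x)) <= `|bus (h x)|%N + (2 * M + 2 * M))%N.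
Proof.
move=> th; have D := tree_dist_anc (2 * M) (h x).
have A (n : nat) k : (tree_dist (ax q k) (ax q (k + n%:Z)) <= n)%N.
  by rewrite -anc_ax; exact: tree_dist_anc.
have A0 k : (tree_dist 1%g (ax q k) <= `|k|%N)%N.
  rewrite -(ax0 q); case: (leP 0 k) => k0'.
    by have := A `|k|%N 0; rewrite add0r gez0_abs.
  by rewrite tree_distC; have := A `|k|%N k; rewrite ltz0_abs// addrN.
have -> : size (word (h x)) = tree_dist 1%g (h x) by rewrite tree_distE invg1 mul1g.
apply: leq_trans (tree_dist_triangle (anc (2 * M) (h x)) _ _) _.
rewrite torus_depth// tree_distC in D; rewrite torus_depth//.
apply: leq_trans (leq_add (A0 _) D) _.
by rewrite addnA leq_add2r /N; move: (bus _) => a; lia.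
Qed.

Lemma torus_finite (B : nat) : finite_set [set h | torus h /\ (`|bus (h 0%R)| <= B)%N].
Proof.
pose V (x : site) := [set w : G | (size (word w) <= B + (2 * M + 2 * M) + l1norm x)%N].
pose r h : site -> G := fun x => if x \in box then h x else 1%g.
have fin := @finite_funs _ _ box V 1%g (fun x => finite_words d _).
apply: (@sub_finite_set _ _ ([set h | torus h] `&` r @^-1` [set f | (forall x, x \notin box -> f x = 1%g) /\
   forall x, x \in box -> V x (f x)])).
  move=> h [th hB]; split=> //; split=> x xb; rewrite /r; first by rewrite (negbTE xb).
  rewrite xb /V /= (_ : size _ = tree_dist 1%g (h x)); last by rewrite tree_distE invg1 mul1g.
  apply: leq_trans (tree_dist_triangle (h 0) _ _) _; apply: leq_add.
    rewrite tree_distE invg1 mul1g; apply: leq_trans (torus_size 0 th) _.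
    by rewrite leq_add2r.
  by have := hom_lip th.1 0 x; rewrite l1norm_sym subr0.
pose r' (f : site -> G) : site -> G := fun x => (gz q (tw (quo x)) * f (red x))%g.
apply: (@sub_finite_set _ _ (r' @` [set f | (forall x, x \notin box -> f x = 1%g) /\
   forall x, x \in box -> V x (f x)])); last exact: finite_image.
move=> h [th rh]; exists (r h) => //; apply/funext => x.
by rewrite /r' /r red_box -torus_red.
Qed.

End Depth.

(** A walk with steps of size one that rounds the line of slope [p k / M]: a proportion
    [(M + p k) / (2 M)] of its steps goes up, which is possible since [p k <= M]. *)
Definition stair k (t : int) : int := 2 * ((t * (M + p k)%N%:Z) %/ N)%Z - t.

Lemma stair_step k t : `|stair k (t + 1) - stair k t| = 1.
Proof.
have a_le : (M + p k)%N%:Z <= N by rewrite /N lez_nat mul2n -addnn leq_add2l.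
rewrite /stair; set a := (M + p k)%N%:Z in a_le *.
have a0 : 0 <= a by [].
have N1 : 0 < N by rewrite /N; lia.
have h1 := divz_eq (t * a) N; have h2 := divz_eq ((t + 1) * a) N.
have h3 : 0 <= (t * a %% N)%Z < N by rewrite modz_ge0//= ltz_pmod.
have h4 : 0 <= ((t + 1) * a %% N)%Z < N by rewrite modz_ge0//= ltz_pmod.
move: h1 h2 h3 h4; rewrite mulrDl mul1r.
move: (t * a) (t * a %/ N)%Z (t * a %% N)%Z ((t * a + a) %/ N)%Z ((t * a + a) %% N)%Z.
move=> u c r c' r' h1 h2 h3 h4.
have : c' = c \/ c' = c + 1.
  have : (c' - c) * N = a + r - r' by lia.
  move: (c' - c) => e; nia.
lia.
Qed.

Lemma stairD k (t u : int) : stair k (t + N * u) = stair k t + 2 * ((p k)%:Z * u).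
Proof.
rewrite /stair (_ : (t + N * u) * _ = u * (M + p k)%N%:Z * N + t * (M + p k)%N%:Z).
  by rewrite divzMDl// /N PoszD PoszM; ring.
by ring.
Qed.

Lemma torus_exists : exists h, normal h.
Proof.
pose F x : int := \sum_k stair k (x 0 k).
have FN v x : F (x + N *: v) = F x + 2 * tw v.
  rewrite /F /tw mulr_sumr -big_split /=; apply: eq_bigr => k _.
  by rewrite !mxE stairD.
have Fstep x y : l1norm (x - y) = 1%N -> F x = F y + 1 \/ F y = F x + 1.
  move=> /l1norm1[k [k1 kj]].
  have : F x - F y = stair k (x 0 k) - stair k (y 0 k).
    rewrite /F (bigD1 k)//= [X in _ - X](bigD1 k)//= opprD addrACA.
    rewrite -[RHS]addr0; congr (_ + _); rewrite -sumrB big1// => j /kj.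
    by rewrite !mxE => /eqP; rewrite subr_eq0 => /eqP ->; rewrite subrr.
  have : x 0 k = y 0 k + 1 \/ y 0 k = x 0 k + 1.
    by move: k1; rewrite !mxE; move: (x 0 k) (y 0 k) => a b; lia.
  by case=> ->; have := stair_step k; [move=> /(_ (y 0 k))|move=> /(_ (x 0 k))];
    move: (stair _ _) (stair _ _) (F x) (F y) => a b c e; lia.
suff th : torus (fun x => ax q (F x)) by exists (nrm (fun x => ax q (F x))); exact: nrm_normal.
split=> [|v x]; last by rewrite FN gz_ax.
apply/is_homP => x y /Fstep[] ->; last by rewrite axS; exists (axcol q (F x)).
by apply: adjC; rewrite axS; exists (axcol q (F y)).
Qed.

End Torus.

(** * The uniform measure on the torus and its symmetries *)

Section TorusMeasure.
Variables (R : realType) (m q : nat).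
Notation d := q.+2.
Hypothesis hd : (2 <= d)%N.
Notation site := 'rV[int]_m.
Notation G := (freeinv d).
Notation grad := (gradient m hd).
Implicit Types (h : site -> G) (x y v : site) (C : set grad).
Variables (M : nat) (p : 'I_m -> nat) (k0 : 'I_m).
Hypothesis M0 : (0 < M)%N.
Hypothesis pM : forall k, (p k <= M)%N.
Hypothesis pk0 : (0 < p k0)%N.
Let N : int := (2 * M)%N%:Z.
Notation torus := (@torus m q M p).
Notation normal := (@normal m q M p).
Notation tw := (@tw m p).

Lemma normal_finite : finite_set [set h | normal h].
Proof.
apply: (@sub_finite_set _ _ [set h | torus h /\ (`|bus (h 0%R)| <= 2)%N]); last first.
  exact: torus_finite pk0 _.
move=> h [th h0]; split=> //.
by move: h0; move: (bus _) => a; lia.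
Qed.

Definition Ts : seq (site -> G) := fset_set [set h | normal h].

Lemma mem_Ts h : h \in Ts <-> normal h.
Proof. by have /(congr1 (fun S => S h)) := fset_setK normal_finite; rewrite /= => <-. Qed.

Lemma Ts_uniq : uniq Ts. Proof. exact: fset_uniq. Qed.

Lemma size_Ts : (0 < size Ts)%N.
Proof.
have [h nh] := torus_exists q M0 pM.
by have /mem_Ts : normal h by []; case: Ts.
Qed.

Definition torus_prob C : R :=
  (count (fun h => `[< C (gr hd h) >]) Ts)%:R / (size Ts)%:R.

Let sT0 : 0 < (size Ts)%:R :> R. Proof. by rewrite ltr0n size_Ts. Qed.

Lemma torus_prob_ge0 C : 0 <= torus_prob C.
Proof. by rewrite divr_ge0. Qed.

Lemma torus_prob_le1 C : torus_prob C <= 1.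
Proof. by rewrite ler_pdivrMr// mul1r ler_nat count_size. Qed.

Lemma torus_probT : torus_prob setT = 1.
Proof.
rewrite /torus_prob (_ : count _ _ = size Ts) ?divff ?gt_eqF//.
by apply/eqP; rewrite -all_count; apply/allP => h _; apply/asboolP.
Qed.

Lemma torus_probU C C' : C `&` C' = set0 ->
  torus_prob (C `|` C') = torus_prob C + torus_prob C'.
Proof.
move=> CC'; rewrite /torus_prob -mulrDl -natrD; congr (_%:R / _).
elim: Ts => [//|h s IH] /=; rewrite IH addnACA; congr addn.
case: asboolP => hU; case: asboolP => hC; case: asboolP => hC' //.
- by have : (C `&` C') (gr hd h) by []; rewrite CC'.
- by case: hU.
- by case: hU; left.
- by case: hU; left.
- by case: hU; right.
Qed.

(** A bijection that commutes with the axis translations permutes the representatives [Ts] after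
    normalisation, and normalisation does not affect gradients. *)
Lemma torus_prob_bij (F F' : (site -> G) -> site -> G) C C' :
  (forall h, torus h -> torus (F h)) -> (forall h, torus h -> torus (F' h)) ->
  (forall h t, F' (fun x => gz q t * h x)%g = (fun x => gz q t * F' h x)%g) ->
  (forall h, torus h -> F' (F h) = h) ->
  (forall h, normal h -> (C (gr hd h) <-> C' (gr hd (F h)))) ->
  torus_prob C = torus_prob C'.
Proof.
move=> tF tF' F'gz FK CC'; rewrite /torus_prob; congr (_%:R / _).
have P : perm_eq (map (fun h => nrm (F h)) Ts) Ts.
  apply: (@perm_map_can _ _ _ (fun h => nrm (F' h))).
  - exact: Ts_uniq.
  - by move=> h /mem_Ts [th _]; apply/mem_Ts/nrm_normal/tF.
  - by move=> h /mem_Ts nh; apply: (nrm_cancel tF tF') => //; apply: FK; case: nh.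
rewrite -[RHS](permP P) count_map; apply: eq_in_count => h /mem_Ts nh; apply: asbool_equiv_eq.
by rewrite (nrm_gr hd (tF h nh.1)); exact: CC'.
Qed.

Lemma torus_prob_translate v C : torus_prob (translate v @^-1` C) = torus_prob C.
Proof.
apply: (@torus_prob_bij (fun h x => h (x + v)) (fun h x => h (x - v))) => //.
- by move=> h; exact: torus_shift.
- by move=> h; exact: torus_shift.
- by move=> h th; apply/funext => x; rewrite subrK.
move=> h [[hh _] _]; rewrite /preimage /= translate_gr.
rewrite (_ : (fun x => height (gr hd h) (x + v)) = (fun x => (h 0)^-1 * h (x + v))%g).
  by rewrite gr_mull//; exact: hom_shift.
by apply/funext => x; rewrite height_gr.
Qed.

Section PeriodicSwap.
Variables (L : seq site) (x0 : site) (z z' : site -> G) (r : nat).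
Hypothesis x0L : x0 \notin L.
Hypothesis Lr : {subset L <= cube m r}.
Hypothesis x0r : x0 \in cube m r.
Hypothesis rM : (r.+2 < M)%N.

(** Centres the fundamental domain at 0, so that [L] and its neighbours lie in its interior; this is
    what [r.+2 < M] ensures. *)
Let mid : site := const_mx M%:Z.
Let cred x := red M (x + mid) - mid.
Let cquo x := quo M (x + mid).

Let cred_cquo x : cred x + N *: cquo x = x.
Proof. by rewrite /cred /cquo addrAC red_quo addrK. Qed.

Let cred_small x : x \in cube m M.-1 -> cred x = x /\ cquo x = 0.
Proof.
move=> /cubeP xM; have h k : 0 <= (x + mid) 0 k < (2 * M)%N%:Z.
  by have := xM k; rewrite !mxE; move: (x 0 k) => a; lia.
by rewrite /cred /cquo red_small// quo_small// addrK.
Qed.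

Let credD x v : cred (x + N *: v) = cred x.
Proof. by rewrite /cred addrAC redD. Qed.

Let cquoD x v : cquo (x + N *: v) = cquo x + v.
Proof. by rewrite /cquo addrAC quoD. Qed.

Let s h := sw L x0 z z' h.

(** The swap carried out at all period translates of [L] at once, so that the result is again
    quasi-periodic. *)
Definition torus_swap h : site -> G := fun x => (gz q (tw (cquo x)) * s h (cred x))%g.

Let near_cube x y : cred x \in L -> l1norm (x - y) = 1%N ->
  [/\ cred y \in cube m M.-1, cred y = y - N *: cquo x & cquo y = cquo x].
Proof.
move=> xL xy; have yE : cred x - (y - N *: cquo x) = x - y.
  by rewrite opprB addrA cred_cquo.
have yc : y - N *: cquo x \in cube m M.-1.
  have -> : y - N *: cquo x = cred x + (- (x - y)) by rewrite -yE opprB subrKC.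
  apply: (@cube_le _ (r + 1)); first by lia.
  apply: cubeD; first exact: Lr.
  by apply: cubeN; have := cube_l1norm (x - y); rewrite xy.
have [c1 c2] := cred_small yc.
have cy : cred y = y - N *: cquo x by rewrite -c1 -scalerN credD.
split=> //; first by rewrite cy.
by move: c2; rewrite -scalerN cquoD => /eqP; rewrite subr_eq0 => /eqP.
Qed.

Let torus_swap_out h x : torus h -> cred x \notin L -> torus_swap h x = h x.
Proof.
by move=> [_ th] xL; rewrite /torus_swap /s sw_out// -th cred_cquo.
Qed.

Lemma torus_swap_torus h : torus h -> torus (torus_swap h).
Proof.
move=> th; have [hh _] := th; split; last first.
  by move=> v x; rewrite /torus_swap credD cquoD twD addrC gzD mulgA.
have sh : is_hom (s h) by exact: sw_hom.
have adjL x y : cred x \in L -> l1norm (x - y) = 1%N -> adj (torus_swap h x) (torus_swap h y).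
  move=> xL xy; have [_ yE yq] := near_cube xL xy.
  rewrite /torus_swap yq; apply: adj_mull; move/is_homP: sh; apply.
  by rewrite yE opprB addrA cred_cquo.
apply/is_homP => x y xy; have [xL|xL] := boolP (cred x \in L); first exact: adjL.
have [yL|yL] := boolP (cred y \in L); first by apply/adjC/adjL => //; rewrite l1norm_sym.
by rewrite !torus_swap_out//; move/is_homP: hh; apply.
Qed.

Lemma torus_swap_cube h : {in cube m M.-1, torus_swap h =1 s h}.
Proof.
by move=> x /cred_small[e1 e2]; rewrite /torus_swap e1 e2 tw0 gz0 mul1g.
Qed.

Lemma torus_swapK h : torus h -> torus_swap (torus_swap h) = h.
Proof.
move=> th; have [hh _] := th; have th2 := torus_swap_torus th.
apply/funext => x; have [xL|xL] := boolP (cred x \in L); last first.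
  by rewrite !torus_swap_out.
rewrite {1}/torus_swap (_ : s (torus_swap h) (cred x) = h (cred x)).
  by move: th => [_ th]; rewrite -th cred_cquo.
have sE : {in cube m M.-1, s (torus_swap h) =1 s (s h)}.
  apply: (@sw_cube _ _ L x0 z z' _ _ r) => //; [exact: th2.1|exact: sw_hom|lia|exact: torus_swap_cube].
rewrite sE; last by apply: cube_le (Lr xL); lia.
by rewrite /s swK.
Qed.

Lemma torus_prob_swap C : depends_on (cube m r) C ->
  torus_prob (swap L x0 z z' @^-1` C) = torus_prob C.
Proof.
move=> rC; apply: (@torus_prob_bij torus_swap torus_swap).
- exact: torus_swap_torus.
- exact: torus_swap_torus.
- by move=> h t; apply/funext => x; rewrite /torus_swap /s sw_mull !mulgA gzC.
- exact: torus_swapK.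
move=> h [th _]; have [hh _] := th; have [ths _] := torus_swap_torus th.
have E : {in cube m r, height (swap L x0 z z' (gr hd h)) =1 height (gr hd (torus_swap h))}.
  move=> x xr; have xM : x \in cube m M.-1 by apply: cube_le xr; lia.
  rewrite swap_gr// !height_gr//; last exact: sw_hom.
  by rewrite !torus_swap_cube// cube0.
by split; apply: rC => x xr; rewrite E.
Qed.

End PeriodicSwap.

End TorusMeasure.

(** * The lattice condition for the heights *)

(* [B] is injective on each fibre of [T], but may depend on the fibre through a
   chosen representative. *)
Lemma size_fibre_inj (X Y Z : eqType) (s : seq X) (C : seq Y) (D : seq Z)
    (T : X -> Y) (B : X -> X -> Z) : uniq s ->
  (forall u, u \in s -> T u \in C) ->
  (forall u0 u, u0 \in s -> u \in s -> T u = T u0 -> B u0 u \in D) ->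
  (forall u0 u u', u0 \in s -> u \in s -> u' \in s -> T u = T u0 -> T u' = T u0 ->
     B u0 u = B u0 u' -> u = u') ->
  (size s <= size C * size D)%N.
Proof.
move=> us TC BD Binj; case: s us TC BD Binj => [//|x s'].
set s := x :: s' => us TC BD Binj.
pose base t := nth x s (find (fun u => T u == t) s).
have baseP u : u \in s -> base (T u) \in s /\ T (base (T u)) = T u.
  move=> us'; have h : has (fun v => T v == T u) s by apply/hasP; exists u.
  by split; [rewrite mem_nth// -has_find|apply/eqP; exact: (nth_find x h)].
rewrite -(size_allpairs pair) -(size_map (fun u => (T u, B (base (T u)) u))).
apply: uniq_leq_size => [|_ /mapP[u us' ->]].
  rewrite map_inj_in_uniq// => u u' us1 us2 [e1 e2].
  have [b1 b2] := baseP u us1; apply: (Binj (base (T u))) => //; first by rewrite -e1 b2.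
  by rewrite e2 e1.
have [b1 b2] := baseP u us'.
by apply/allpairsP; exists (T u, B (base (T u)) u); split=> //=; [exact: TC|exact: BD].
Qed.

Lemma subr_swap (V : zmodType) (a b c d : V) : a - b = c - d -> a - c = b - d.
Proof. by move=> E; rewrite -(subrK b a) E addrC addrA addKr addrC. Qed.

Section Realisation.
Variables (m q : nat).
Notation d := q.+2.
Notation site := 'rV[int]_m.
Notation G := (freeinv d).
Implicit Types (h : site -> G) (x y v : site) (phi psi : site -> int).
Variables (M : nat) (p : 'I_m -> nat).
Let N : int := (2 * M)%N%:Z.
Notation torus := (@torus m q M p).
Notation tw := (@tw m p).

Definition al (j : int) : 'I_q.+1 := lb (ax q j).

Lemma alD j t : al (j + 2 * t) = al j.
Proof. by rewrite /al -gz_ax lb_gz. Qed.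

Definition vertex (k : int) (f : int -> 'I_q.+1) : G :=
  xget 1%g [set u | bus u = k /\ forall j, k <= j -> lab u j = f j].

Lemma vertexP k f n : (forall j, n <= j -> f j = al j) ->
  bus (vertex k f) = k /\ forall j, k <= j -> lab (vertex k f) j = f j.
Proof.
move=> /(lab_ex k)[u hu].
by rewrite /vertex; case: xgetP => [w _ //|/(_ u)]; case.
Qed.

(** If [phi y = phi x + 1], the parent of [h x] and the vertex [h y] have the same level and the
    same labels, hence coincide; compatible labels therefore assemble to a homomorphism. *)
Lemma torus_of_labels phi (f : site -> int -> 'I_q.+1) :
  (forall x y, l1norm (x - y) = 1%N -> `|phi x - phi y| = 1) ->
  (forall v x, phi (x + N *: v) = phi x + 2 * tw v) ->
  (forall x, exists n, forall j, n <= j -> f x j = al j) ->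
  (forall x y j, l1norm (x - y) = 1%N -> phi x <= j -> phi y <= j -> f x j = f y j) ->
  (forall v x j, phi x <= j -> f (x + N *: v) (j + 2 * tw v) = f x j) ->
  let h x := vertex (phi x) (f x) in
  [/\ torus h, forall x, bus (h x) = phi x &
      forall x j, phi x <= j -> lab (h x) j = f x j].
Proof.
move=> phi1 phiN fal fadj fN h.
have hP x : bus (h x) = phi x /\ forall j, phi x <= j -> lab (h x) j = f x j.
  by have [n fn] := fal x; exact: vertexP fn.
have hb x := (hP x).1; have hl x := (hP x).2; split=> //; split.
  have hpar x y : l1norm (x - y) = 1%N -> phi y = phi x + 1 -> parent (h x) = h y.
    move=> xy yx; have bp : bus (parent (h x)) = bus (h y) by rewrite bus_parent !hb.
    apply: lab_inj => // j; rewrite bp hb => yj; rewrite hl// -(fadj x y)//; last by rewrite yx in yj; lia.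
    by rewrite /lab up_parent ?hl// ?hb; [rewrite -hl//; rewrite yx in yj; lia|rewrite yx in yj].
  apply/is_homP => x y xy.
  have [yx|xy'] : phi y = phi x + 1 \/ phi x = phi y + 1.
  - by have := phi1 _ _ xy; move: (phi x) (phi y) => a b; lia.
  - by exists (par (h x)); rewrite -(hpar _ _ xy yx).
  - apply: adjC; exists (par (h y)); rewrite -(hpar y x)//.
    by rewrite l1norm_sym.
move=> v x; apply: lab_inj; first by rewrite bus_gz !hb phiN.
move=> j; rewrite hb => vj; rewrite hl//.
have -> : j = (j - 2 * tw v) + 2 * tw v by rewrite subrK.
have xj : phi x <= j - 2 * tw v by rewrite lerBrDr -phiN.
by rewrite lab_gz hl// fN.
Qed.

Lemma torus_lab h v x j : torus h -> lab (h (x + N *: v)) (j + 2 * tw v) = lab (h x) j.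
Proof. by move=> [_ ->]; rewrite lab_gz. Qed.

Lemma bus_parity h h' x : is_hom h -> is_hom h' ->
  (2 %| (bus (h 0%R) - bus (h' 0%R))%R)%Z -> (2 %| (bus (h x) - bus (h' x))%R)%Z.
Proof.
move=> hh hh' h0; have [n] := ubnP (l1norm x); elim: n x => [//|n IH] x xn.
have [->//|/l1norm_step[y yx y1]] := eqVneq x 0.
have := IH y; rewrite -yx in xn => /(_ xn).
have := bus_step hh y1; have := bus_step hh' y1.
by move: (bus (h y)) (bus (h x)) (bus (h' y)) (bus (h' x)) => a b c e; clear; lia.
Qed.

End Realisation.

Section Lattice.
Variables (m q : nat).
Notation d := q.+2.
Notation site := 'rV[int]_m.
Notation G := (freeinv d).
Implicit Types (h g : site -> G) (x y v : site) (phi psi : site -> int).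
Variables (M : nat) (p : 'I_m -> nat).
Let N : int := (2 * M)%N%:Z.
Notation torus := (@torus m q M p).
Notation tw := (@tw m p).

(* Labels are subtracted in Z/(q+1), shifted by those of the axis so that the
   result is again eventually on the axis.  [join] only keeps these differences;
   [meet] keeps those of h1 and h2 with the members of a reference pair (g1, g2)
   having the same join, and at a common level the two differences agree. *)
Let diffs h1 h2 x (j : int) : 'I_q.+1 := lab (h1 x) j - lab (h2 x) j + al q j.
Let glue h1 h2 g1 g2 x (j : int) : 'I_q.+1 :=
  if bus (h1 x) <= j then diffs h1 g1 x j else diffs h2 g2 x j.

Definition join h1 h2 x : G := vertex (Num.max (bus (h1 x)) (bus (h2 x))) (diffs h1 h2 x).
Definition meet g1 g2 h1 h2 x : G :=
  vertex (Num.min (bus (h1 x)) (bus (h2 x))) (glue h1 h2 g1 g2 x).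

Let even h1 h2 := (2 %| (bus (h1 0%R) - bus (h2 0%R))%R)%Z.

Let diffs_al h1 h2 x : exists n, forall j, n <= j -> diffs h1 h2 x j = al q j.
Proof.
have [n1 a1] := lab_axE (h1 x); have [n2 a2] := lab_axE (h2 x).
exists (Num.max n1 n2) => j; rewrite ge_max => /andP[j1 j2].
by rewrite /diffs a1// a2// subrr add0r.
Qed.

Let diffs_adj h1 h2 x y j : is_hom h1 -> is_hom h2 -> l1norm (x - y) = 1%N ->
  bus (h1 x) <= j -> bus (h1 y) <= j -> bus (h2 x) <= j -> bus (h2 y) <= j ->
  diffs h1 h2 x j = diffs h1 h2 y j.
Proof.
move=> /is_homP hh1 /is_homP hh2 xy *.
by rewrite /diffs (lab_adj (hh1 _ _ xy))// (lab_adj (hh2 _ _ xy)).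
Qed.

Let diffsN h1 h2 v x j : torus h1 -> torus h2 ->
  diffs h1 h2 (x + N *: v) (j + 2 * tw v) = diffs h1 h2 x j.
Proof. by move=> t1 t2; rewrite /diffs !(torus_lab _ _ _ t1, torus_lab _ _ _ t2) alD. Qed.

(** Equal parity is essential: if the order of the two heights changes along an edge, they are equal
    at one of its endpoints. *)
Let max_step h1 h2 x y : is_hom h1 -> is_hom h2 -> even h1 h2 -> l1norm (x - y) = 1%N ->
  `|Num.max (bus (h1 x)) (bus (h2 x)) - Num.max (bus (h1 y)) (bus (h2 y))| = 1 /\
  `|Num.min (bus (h1 x)) (bus (h2 x)) - Num.min (bus (h1 y)) (bus (h2 y))| = 1.
Proof.
move=> hh1 hh2 e xy.
have := bus_step hh1 xy; have := bus_step hh2 xy.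
have := bus_parity x hh1 hh2 e; have := bus_parity y hh1 hh2 e.
by move: (bus _) (bus _) (bus _) (bus _) => a b c f; clear; lia.
Qed.

Lemma joinP h1 h2 : torus h1 -> torus h2 -> even h1 h2 ->
  [/\ torus (join h1 h2), forall x, bus (join h1 h2 x) = Num.max (bus (h1 x)) (bus (h2 x)) &
      forall x j, Num.max (bus (h1 x)) (bus (h2 x)) <= j -> lab (join h1 h2 x) j = diffs h1 h2 x j].
Proof.
move=> t1 t2 e; have [hh1 _] := t1; have [hh2 _] := t2.
apply: torus_of_labels => //.
- by move=> x y xy; have [] := max_step hh1 hh2 e xy.
- by move=> v x; rewrite (bus_torus x v t1) (bus_torus x v t2) addr_maxl.
- by move=> x y j xy; rewrite !ge_max => /andP[? ?] /andP[? ?]; exact: diffs_adj.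
- by move=> v x j _; exact: diffsN.
Qed.

Let agree h1 h2 g1 g2 := forall x j, Num.max (bus (h1 x)) (bus (h2 x)) <= j ->
  diffs h1 g1 x j = diffs h2 g2 x j.

(** Equal joins mean that the labels of [h1 - h2] and [g1 - g2] agree at common levels; rearranged,
    [h1 - g1 = h2 - g2] there. *)
Lemma join_agree h1 h2 g1 g2 : torus h1 -> torus h2 -> torus g1 -> torus g2 ->
  even h1 h2 -> (forall x, bus (g1 x) = bus (h1 x)) -> (forall x, bus (g2 x) = bus (h2 x)) ->
  join h1 h2 = join g1 g2 -> agree h1 h2 g1 g2.
Proof.
move=> t1 t2 t1' t2' e b1 b2 jj x j xj.
have e' : even g1 g2 by rewrite /even b1 b2.
have [_ _ /(_ x j xj)] := joinP t1 t2 e; have [_ _ /(_ x j)] := joinP t1' t2' e'.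
rewrite b1 b2 jj => /(_ xj) -> /addIr; rewrite /diffs => E; congr (_ + _).
exact: subr_swap.
Qed.

Lemma meetP h1 h2 g1 g2 : torus h1 -> torus h2 -> torus g1 -> torus g2 -> even h1 h2 ->
  (forall x, bus (g1 x) = bus (h1 x)) -> (forall x, bus (g2 x) = bus (h2 x)) ->
  agree h1 h2 g1 g2 ->
  [/\ torus (meet g1 g2 h1 h2),
      forall x, bus (meet g1 g2 h1 h2 x) = Num.min (bus (h1 x)) (bus (h2 x)) &
      forall x j, Num.min (bus (h1 x)) (bus (h2 x)) <= j ->
        lab (meet g1 g2 h1 h2 x) j = glue h1 h2 g1 g2 x j].
Proof.
move=> t1 t2 t1' t2' e b1 b2 ag; have [hh1 _] := t1; have [hh2 _] := t2.
have [hh1' _] := t1'; have [hh2' _] := t2'.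
apply: torus_of_labels => //.
- by move=> x y xy; have [] := max_step hh1 hh2 e xy.
- by move=> v x; rewrite (bus_torus x v t1) (bus_torus x v t2) addr_minl.
- move=> x; have [n1 a1] := diffs_al h1 g1 x; have [n2 a2] := diffs_al h2 g2 x.
  exists (Num.max n1 n2) => j; rewrite ge_max => /andP[j1 j2].
  by rewrite /glue; case: ifP => _; [exact: a1|exact: a2].
- move=> x y j xy.
  (* The definition of [glue] changes branch between [x'] and [y']. By parity [h2 x'] is then at
     level at most [j] too, where both branches agree. *)
  have one x' y' : l1norm (x' - y') = 1%N -> bus (h1 x') <= j -> j < bus (h1 y') ->
      bus (h2 y') <= j -> diffs h1 g1 x' j = diffs h2 g2 y' j.
    move=> xy' x1 y1 y2; have x2 : bus (h2 x') <= j.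
      have := bus_step hh1 xy'; have := bus_step hh2 xy'.
      have := bus_parity x' hh1 hh2 e; have := bus_parity y' hh1 hh2 e.
      by move: x1 y1 y2; move: (bus _) (bus _) (bus _) (bus _) => a b c f; clear; lia.
    by rewrite ag ?ge_max ?x1// (@diffs_adj h2 g2 x' y')// b2.
  rewrite !ge_min /glue => /orP hx /orP hy.
  case: (leP (bus (h1 x)) j) hx => x1 hx; case: (leP (bus (h1 y)) j) hy => y1 hy.
  + by apply: diffs_adj => //; rewrite b1.
  + by case: hy => // hy; exact: one.
  + by case: hx => // hx; apply/esym/one => //; rewrite l1norm_sym.
  + by case: hx => // hx; case: hy => // hy; apply: diffs_adj => //; rewrite b2.
- move=> v x j _; rewrite /glue (bus_torus x v t1) lerD2r.
  by case: ifP => _; exact: diffsN.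
Qed.

(** The meet returns the labels of [h1], and those of [h2] at levels below [bus (h1 x)]. At the
    other levels the join returns the difference of [h1] and [h2], hence [h2]. *)
Lemma join_meet_inj h1 h2 h1' h2' g1 g2 :
  torus h1 -> torus h2 -> torus h1' -> torus h2' -> torus g1 -> torus g2 -> even h1 h2 ->
  (forall x, bus (g1 x) = bus (h1 x)) -> (forall x, bus (g2 x) = bus (h2 x)) ->
  (forall x, bus (h1' x) = bus (h1 x)) -> (forall x, bus (h2' x) = bus (h2 x)) ->
  join h1 h2 = join g1 g2 -> join h1' h2' = join g1 g2 ->
  meet g1 g2 h1 h2 = meet g1 g2 h1' h2' -> h1 = h1' /\ h2 = h2'.
Proof.
move=> t1 t2 t1' t2' s1 s2 e b1 b2 b1' b2' J J' E.
have e' : even h1' h2' by rewrite /even b1' b2'.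
have ag : agree h1 h2 g1 g2 by exact: join_agree.
have ag' : agree h1' h2' g1 g2 by apply: join_agree => // x; rewrite ?b1' ?b2'.
have [_ _ M1] := meetP t1 t2 s1 s2 e b1 b2 ag.
have [||_ _ M2] := meetP t1' t2' s1 s2 e' _ _ ag'; try by move=> x; rewrite ?b1' ?b2'.
have GE x j : Num.min (bus (h1 x)) (bus (h2 x)) <= j -> glue h1 h2 g1 g2 x j = glue h1' h2' g1 g2 x j.
  by move=> xj; rewrite -M1// E M2// b1' b2'.
have l1 x j : bus (h1 x) <= j -> lab (h1 x) j = lab (h1' x) j.
  move=> xj; have := GE x j; rewrite ge_min xj => /(_ isT).
  by rewrite /glue b1' xj => /addIr /addIr.
split; apply/funext => x; apply: lab_inj; rewrite ?b1' ?b2'// => j xj; first exact: l1.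
have := GE x j; rewrite ge_min xj orbT => /(_ isT); rewrite /glue b1'.
case: (leP (bus (h1 x)) j) => [x1|x1]; last by move=> /addIr /addIr.
have [_ _ /(_ x j)] := joinP t1 t2 e; have [_ _ /(_ x j)] := joinP t1' t2' e'.
rewrite b1' b2' J J' ge_max x1 xj => /(_ isT) -> /(_ isT) /addIr + _.
by rewrite l1// => /addrI /oppr_inj.
Qed.

End Lattice.

(** * The variance of the heights *)

Section RealLemmas.
Variable R : realFieldType.

(** From [(P - u) (P - v) >= 0] one gets [P (u + v) <= P ^ 2 + u v <= P (P + Q)]. *)
Lemma four_functions_pair (u v P Q : R) : 0 <= u -> 0 <= v -> 0 <= Q ->
  u <= P -> v <= P -> u * v <= P * Q -> u + v <= P + Q.
Proof.
move=> u0 v0 Q0 uP vP uvPQ.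
have [P0|P0] := leP P 0; first by lra.
by rewrite -(ler_pM2l P0); nra.
Qed.

(** The Ahlswede-Daykin inequality on a chain: the two mixed terms of each pair are treated together
    by [four_functions_pair]. *)
Lemma four_functions_chain (D : seq int) (a b c e : int -> R) :
  (forall i, 0 <= a i) -> (forall i, 0 <= b i) -> (forall i, 0 <= c i) -> (forall i, 0 <= e i) ->
  (forall i j, a i * b j <= c (Num.max i j) * e (Num.min i j)) ->
  (\sum_(i <- D) a i) * (\sum_(i <- D) b i) <= (\sum_(i <- D) c i) * (\sum_(i <- D) e i).
Proof.
move=> a0 b0 c0 e0 H.
have pair x j : a x * b j + a j * b x <= c x * e j + c j * e x.
  wlog xj : x j / x <= j.
    move=> W; case: (leP x j) => [|/ltW] xj; first exact: W.
    by rewrite addrC [leRHS]addrC; exact: W.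
  rewrite [leRHS]addrC; apply: four_functions_pair; rewrite ?mulr_ge0//.
  - by have := H x j; rewrite max_r// min_l.
  - by have := H j x; rewrite max_l// min_r.
  have := ler_pM (mulr_ge0 (a0 x) (b0 x)) (mulr_ge0 (a0 j) (b0 j)) (H x x) (H j j).
  rewrite !maxxx !minxx => h.
  rewrite [leLHS](_ : _ = a x * b x * (a j * b j)); last by ring.
  by apply: le_trans h _; rewrite [leLHS](_ : _ = c j * e x * (c x * e j)) //; ring.
elim: D => [|x D IH]; first by rewrite !big_nil mul0r.
rewrite !big_cons !mulrDl !mulrDr.
have cross : \sum_(i <- D) (a x * b i + a i * b x) <= \sum_(i <- D) (c x * e i + c i * e x).
  by apply: ler_sum.
rewrite !big_split /= -!mulr_sumr -!mulr_suml in cross.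
have := H x x; rewrite maxxx minxx => Hxx.
lra.
Qed.

(** The law of total variance without normalisation: [Z], [A] and [Q] are the mass and the first two
    moments of each class. The variance of the class means is half their mean square difference over
    independent pairs, at most [2 ^ 2 / 2 = 2]. *)
Lemma variance_mixture (D : seq int) (Q A Z : int -> R) (kappa : R) :
  (forall c, 0 <= Z c) -> (forall c, c \in D -> Q c * Z c - A c ^+ 2 <= kappa * Z c ^+ 2) ->
  (forall c, Z c = 0 -> Q c = 0 /\ A c = 0) ->
  (forall c c', c \in D -> c' \in D -> Z c != 0 -> Z c' != 0 ->
     `|A c * Z c' - A c' * Z c| <= 2 * (Z c * Z c')) ->
  (\sum_(c <- D) Q c) * (\sum_(c <- D) Z c) - (\sum_(c <- D) A c) ^+ 2
    <= (kappa + 2) * (\sum_(c <- D) Z c) ^+ 2.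
Proof.
move=> Z0 QZ Z00 AZ.
have pair c c' : c \in D -> c' \in D ->
    Q c * Z c' + Q c' * Z c - 2 * (A c * A c') <= 2 * (kappa + 2) * (Z c * Z c').
  move=> cD c'D; have [z0|z0] := eqVneq (Z c) 0.
    by have [-> ->] := Z00 _ z0; rewrite z0 !(mul0r, mulr0) addr0 subrr.
  have [z0'|z0'] := eqVneq (Z c') 0.
    by have [-> ->] := Z00 _ z0'; rewrite z0' !(mul0r, mulr0) addr0 subrr.
  have zc : 0 < Z c by rewrite lt_def z0 Z0.
  have zc' : 0 < Z c' by rewrite lt_def z0' Z0.
  have h := AZ _ _ cD c'D z0 z0'.
  have sq : (A c * Z c' - A c' * Z c) ^+ 2 <= 4 * (Z c * Z c') ^+ 2.
    rewrite -real_normK ?num_real// (_ : 4 * _ = (2 * (Z c * Z c')) ^+ 2); last by ring.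
    by rewrite lerXn2r// ?nnegrE// !mulr_ge0// ltW.
  have h1 := QZ _ cD; have h2 := QZ _ c'D.
  rewrite -(ler_pM2l (mulr_gt0 zc zc')).
  have h1' : Q c * Z c * Z c' ^+ 2 <= (kappa * Z c ^+ 2 + A c ^+ 2) * Z c' ^+ 2.
    by rewrite ler_wpM2r ?sqr_ge0//; lra.
  have h2' : Q c' * Z c' * Z c ^+ 2 <= (kappa * Z c' ^+ 2 + A c' ^+ 2) * Z c ^+ 2.
    by rewrite ler_wpM2r ?sqr_ge0//; lra.
  lra.
have H : \sum_(c <- D) \sum_(c' <- D) (Q c * Z c' + Q c' * Z c - 2 * (A c * A c')) <=
         \sum_(c <- D) \sum_(c' <- D) (2 * (kappa + 2) * (Z c * Z c')).
  rewrite [leLHS]big_seq [leRHS]big_seq; apply: ler_sum => c cD.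
  by rewrite [leLHS]big_seq [leRHS]big_seq; apply: ler_sum => c' c'D; exact: pair.
have E1 : \sum_(c <- D) \sum_(c' <- D) (2 * (kappa + 2) * (Z c * Z c')) =
    2 * ((kappa + 2) * (\sum_(c <- D) Z c) ^+ 2).
  rewrite expr2 big_distrlr /= mulrA mulr_sumr; apply: eq_bigr => c _.
  by rewrite mulr_sumr.
have E2 : \sum_(c <- D) \sum_(c' <- D) (Q c * Z c' + Q c' * Z c - 2 * (A c * A c')) =
    2 * ((\sum_(c <- D) Q c) * (\sum_(c <- D) Z c) - (\sum_(c <- D) A c) ^+ 2).
  rewrite mulrBr expr2 !big_distrlr /= !mulr_sumr.
  transitivity (\sum_(i <- D) \sum_(j <- D) Q i * Z j + \sum_(i <- D) \sum_(j <- D) Q j * Z i -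
                \sum_(i <- D) 2 * \sum_(j <- D) A i * A j).
    rewrite -big_split -sumrB /=; apply: eq_bigr => i _.
    by rewrite mulr_sumr -big_split -sumrB.
  congr (_ - _); rewrite [X in _ + X]exchange_big /= -big_split /=.
  by apply: eq_bigr => i _; rewrite mulr2n mulrDl mul1r.
by move: H; rewrite E1 E2 ler_pM2l.
Qed.

End RealLemmas.

Section Variance.
Variables (R : realType) (m q : nat).
Notation d := q.+2.
Notation site := 'rV[int]_m.
Notation G := (freeinv d).
Implicit Types (h : site -> G) (x y v : site) (phi psi eta : site -> int) (r : seq site).
Variables (M : nat) (p : 'I_m -> nat) (k0 : 'I_m).
Hypothesis M0 : (0 < M)%N.
Hypothesis pk0 : (0 < p k0)%N.
Let N : int := (2 * M)%N%:Z.
Notation torus := (@torus m q M p).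
Notation tw := (@tw m p).
Notation red := (red M).
Notation quo := (quo M).
Notation box := (box m M).

Variable a : int.

(** Two heights are allowed at 0, so that boundary heights [eta] and [eta + 2] can be compared
    within one finite family closed under join and meet. *)
Let Hset : set (site -> G) := [set h | torus h /\ (bus (h 0) = a \/ bus (h 0) = a + 2)].

Let Hset_finite : finite_set Hset.
Proof.
apply: (@sub_finite_set _ _ [set h | torus h /\ (`|bus (h 0%R)| <= `|a| + 2)%N]); last first.
  exact: torus_finite pk0 _.
by move=> h [th h0]; split=> //; move: h0; move: (bus _) => b; lia.
Qed.

Let H : seq (site -> G) := fset_set Hset.

Let mem_H h : h \in H <-> Hset h.
Proof. by have /(congr1 (fun S => S h)) := fset_setK Hset_finite; rewrite /= => <-. Qed.

Let H_uniq : uniq H. Proof. exact: fset_uniq. Qed.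

Let lvl phi : seq (site -> G) := [seq h <- H | `[< forall y, bus (h y) = phi y >]].

Let lvlP phi h : h \in lvl phi <-> Hset h /\ forall y, bus (h y) = phi y.
Proof.
rewrite mem_filter; split=> [/andP[/asboolP ? /mem_H]|[hH hphi]] //.
by apply/andP; split; [exact/asboolP|exact/mem_H].
Qed.

Let pmax phi psi x : int := Num.max (phi x) (psi x).
Let pmin phi psi x : int := Num.min (phi x) (psi x).

Let even_H h h' : Hset h -> Hset h' -> (2 %| (bus (h 0%R) - bus (h' 0%R))%R)%Z.
Proof. by move=> [_ h0] [_ h0']; move: h0 h0'; move: (bus _) (bus _) => b c; clear; lia. Qed.

(* The lattice condition behind the FKG inequality for the heights [bus \o h]. *)
Let lattice phi psi :
  (size (lvl phi) * size (lvl psi) <= size (lvl (pmax phi psi)) * size (lvl (pmin phi psi)))%N.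
Proof.
rewrite -(size_allpairs pair (lvl phi) (lvl psi)).
have mem u : u \in [seq (h1, h2) | h1 <- lvl phi, h2 <- lvl psi] ->
    [/\ Hset u.1, Hset u.2, forall y, bus (u.1 y) = phi y & forall y, bus (u.2 y) = psi y].
  by move=> /allpairsP[[h1 h2] /= [/lvlP[? ?] /lvlP[? ?] ->]].
apply: (@size_fibre_inj _ _ _ _ _ _ (fun u => join u.1 u.2)
          (fun g u => meet g.1 g.2 u.1 u.2)).
- apply: allpairs_uniq; [exact: filter_uniq|exact: filter_uniq|].
  by move=> [u1 u2] [v1 v2] _ _ [-> ->].
- move=> u /mem [H1 H2 b1 b2]; apply/lvlP.
  have [tj bj _] := joinP H1.1 H2.1 (even_H H1 H2).
  split; last by move=> y; rewrite bj b1 b2.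
  split=> //; rewrite bj; move: H1.2 H2.2; move: (bus _) (bus _) => b c; clear; lia.
- move=> g u /mem [G1 G2 c1 c2] /mem [H1 H2 b1 b2] J.
  have e := even_H H1 H2.
  have gb1 y : bus (g.1 y) = bus (u.1 y) by rewrite c1 b1.
  have gb2 y : bus (g.2 y) = bus (u.2 y) by rewrite c2 b2.
  have ag := join_agree H1.1 H2.1 G1.1 G2.1 e gb1 gb2 J.
  have [tj bj _] := meetP H1.1 H2.1 G1.1 G2.1 e gb1 gb2 ag.
  apply/lvlP; split; last by move=> y; rewrite bj b1 b2.
  split=> //; rewrite bj; move: H1.2 H2.2; move: (bus _) (bus _) => b c; clear; lia.
- move=> g u u' /mem [G1 G2 c1 c2] /mem [H1 H2 b1 b2] /mem [H1' H2' b1' b2'] J J' E.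
  have e := even_H H1 H2.
  have [||||] := join_meet_inj H1.1 H2.1 H1'.1 H2'.1 G1.1 G2.1 e _ _ _ _ J J' E.
  + by move=> y; rewrite c1 b1.
  + by move=> y; rewrite c2 b2.
  + by move=> y; rewrite b1' b1.
  + by move=> y; rewrite b2' b2.
  by case: u {H1 H2 b1 b2 J E e} => u1 u2; case: u' {H1' H2' b1' b2' J'} => u1' u2' /= -> ->.
Qed.

(* [cs r F eta]: the sum of F over the homs with heights eta off the orbits of
   the sites in r; conditional expectations given those heights are quotients
   of such sums. *)
Let off r eta h : Prop := forall y, red y \notin r -> bus (h y) = eta y.
Let cs r (F : (site -> G) -> R) eta : R := \sum_(h <- H | `[< off r eta h >]) F h.

Let upd eta x (c : int) y : int := if red y == x then c + 2 * tw (quo y) else eta y.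

Let D : seq int := undup [seq bus (h x) | h <- H, x <- box].

Let bus_red h y : torus h -> bus (h y) = bus (h (red y)) + 2 * tw (quo y).
Proof. by move=> th; rewrite -(bus_torus _ _ th) red_quo. Qed.

Let off_upd r x c eta h : torus h -> x \in box -> x \notin r ->
  off r (upd eta x c) h <-> off (x :: r) eta h /\ c = bus (h x).
Proof.
move=> th; rewrite (mem_box M0) => /eqP rx xr; split=> [oh|[oh ->] y yr].
  split=> [y|]; last first.
    have := oh x; rewrite rx => /(_ xr); rewrite /upd rx eqxx.
    have -> : quo x = 0 by rewrite -rx quo_red.
    by rewrite tw0 mulr0 addr0.
  by rewrite inE negb_or => /andP[yx yr]; rewrite oh// /upd (negbTE yx).
rewrite /upd; case: eqVneq => [yx|yx]; first by rewrite bus_red// yx.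
by apply: oh; rewrite inE negb_or yx yr.
Qed.

Let cs_cons r x F eta : x \in box -> x \notin r ->
  cs (x :: r) F eta = \sum_(c <- D) cs r F (upd eta x c).
Proof.
move=> xb xr; rewrite /cs.
under [RHS]eq_bigr do rewrite big_mkcond.
rewrite exchange_big /= big_mkcond /= [LHS]big_seq [RHS]big_seq.
apply: eq_bigr => h hH; have [th _] := (mem_H h).1 hH.
have bD : bus (h x) \in D by rewrite mem_undup; apply/allpairsP; exists (h, x).
rewrite (bigD1_seq (bus (h x))) ?undup_uniq//= big1 => [|c /eqP cb].
  rewrite addr0; congr (if _ then _ else _); apply: asbool_equiv_eq.
  by rewrite (off_upd _ _ th xb xr); split=> [|[]].
by case: asboolP => // /(off_upd _ _ th xb xr)[_ /cb].
Qed.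

Let cs_ge0 r F eta : (forall h, Hset h -> 0 <= F h) -> 0 <= cs r F eta.
Proof.
move=> F0; rewrite /cs big_seq_cond; apply: sumr_ge0 => h /andP[/mem_H hH _].
exact: F0.
Qed.

Let upd_max phi psi x c c' :
  pmax (upd phi x c) (upd psi x c') = upd (pmax phi psi) x (Num.max c c').
Proof. by apply/funext => y; rewrite /pmax /upd; case: ifP => // _; rewrite addr_maxl. Qed.

Let upd_min phi psi x c c' :
  pmin (upd phi x c) (upd psi x c') = upd (pmin phi psi) x (Num.min c c').
Proof. by apply/funext => y; rewrite /pmin /upd; case: ifP => // _; rewrite addr_minl. Qed.

Variables (k : 'I_m) (n : nat).
Hypothesis nN : (n < 2 * M)%N.
Let pt (i : nat) : site := delta_mx 0 k *+ i.
(** The shift makes [ev] nonnegative, as the four functions inequality requires. *)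
Let K : int := `|a| + 2 + n%:Z.
Let ev h : R := (bus (h (pt n)) + K)%:~R.

Let l1norm_pt i : l1norm (pt i) = i. Proof. exact: l1norm_delta_mulrn. Qed.

Let ev_ge0 h : Hset h -> 0 <= ev h.
Proof.
move=> [[hh _] h0]; rewrite /ev ler0z; have := bus_lip_hom (pt n) 0 hh.
rewrite subr0 l1norm_pt; move: h0; rewrite /K; move: (bus _) (bus _) => b c.
by clear; lia.
Qed.

Let one (h : site -> G) : R := 1.

Let cs_nil F phi (c : R) : (forall h, (forall y, bus (h y) = phi y) -> F h = c) ->
  cs [::] F phi = c * (size (lvl phi))%:R.
Proof.
move=> Fc; rewrite /cs (eq_bigr (fun=> c)); last first.
  by move=> h /asboolP oh; apply: Fc => y; exact: oh.
rewrite big_const_seq iter_addr addr0 mulr_natr; congr (_ *+ _).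
rewrite /lvl size_filter; apply: eq_count => h; apply: asbool_equiv_eq.
by split=> oh y; [exact: oh|move=> _; exact: oh].
Qed.

(** Induction on the hidden sites, each summed out by the inequality on a chain; with none hidden it
    is the lattice condition times the monotonicity of [ev]. *)
Let four_functions r phi psi : uniq r -> {subset r <= box} ->
  cs r ev phi * cs r one psi <= cs r ev (pmax phi psi) * cs r one (pmin phi psi).
Proof.
elim: r phi psi => [|x r IH] phi psi ur rb.
  rewrite !(cs_nil (F := one) (c := 1))// !mul1r.
  rewrite (cs_nil (F := ev) (phi := phi) (c := (phi (pt n) + K)%:~R)); last by move=> h e; rewrite /ev e.
  have E : cs [::] ev (pmax phi psi) =
      (pmax phi psi (pt n) + K)%:~R * (size (lvl (pmax phi psi)))%:R.
    by apply: cs_nil => h e; rewrite /ev e.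
  rewrite E.
  (* If no homomorphism has the heights [phi], the left side is zero; otherwise one of them shows
     that the factor at [pt n] is nonnegative. *)
  have [s0|] := posnP (size (lvl phi)).
    by rewrite s0 mulr0 mul0r -E mulr_ge0// cs_ge0.
  rewrite -has_predT => /hasP[h /lvlP[hH he] _].
  have c0 : 0 <= (phi (pt n) + K)%:~R :> R by have := ev_ge0 hH; rewrite /ev he.
  rewrite -!mulrA -!natrM; apply: ler_pM => //; last by rewrite ler_nat lattice.
  by rewrite ler_int lerD2r /pmax le_max lexx.
have xb : x \in box by apply: rb; rewrite inE eqxx.
have xr : x \notin r by case/andP: ur.
have {}ur : uniq r by case/andP: ur.
have {}rb : {subset r <= box} by move=> y yr; apply: rb; rewrite inE yr orbT.
rewrite !cs_cons//; apply: four_functions_chain => [c|c|c|c|c c'].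
- exact: cs_ge0 ev_ge0.
- by apply: cs_ge0 => h _; exact: ler01.
- exact: cs_ge0 ev_ge0.
- by apply: cs_ge0 => h _; exact: ler01.
by rewrite -upd_max -upd_min; exact: IH.
Qed.

(** The FKG conclusion: the conditional mean of [ev] increases with the heights that are given. *)
Let cs_mono r phi psi : uniq r -> {subset r <= box} -> (forall y, phi y <= psi y) ->
  cs r ev phi * cs r one psi <= cs r ev psi * cs r one phi.
Proof.
move=> ur rb le; have := four_functions phi psi ur rb.
have -> : pmax phi psi = psi by apply/funext => y; rewrite /pmax max_r.
by have -> : pmin phi psi = phi by apply/funext => y; rewrite /pmin min_l.
Qed.

(** Since the height at 0 is given and equals [a], left multiplication by the axis translation
    matches the homomorphisms over [eta] with those over [eta + 2], both inside [Hset]. *)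
Let cs_shift r F eta : 0 \notin r -> eta 0 = a ->
  cs r F (fun y => eta y + 2) = cs r (fun h => F (fun x => gz q 1 * h x)%g) eta.
Proof.
move=> r0 e0; have red0 : red (0 : site) = 0 by apply: red_small => j; rewrite mxE; move: M0; clear; lia.
rewrite /cs -[LHS]big_filter -[RHS]big_filter -[RHS](big_map (fun h x => gz q 1 * h x)%g predT F).
apply: perm_big; apply: uniq_perm.
- exact: filter_uniq.
- rewrite map_inj_uniq ?filter_uniq// => h h' /funeqP e.
  by apply/funext => x; have /mulgI := e x.
move=> h; apply/idP/mapP => [|[g + ->]].
  rewrite mem_filter => /andP[/asboolP oh /mem_H[th h0]].
  have b0 : bus (h 0) = a + 2 by rewrite oh ?red0// e0.
  exists (fun x => gz q (-1) * h x)%g; last first.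
    by apply/funext => x; rewrite mulgA -gzD subrr mul1g.
  rewrite mem_filter; apply/andP; split.
    by apply/asboolP => y yr; rewrite bus_gz oh//; move: (eta y) => b; clear; lia.
  apply/mem_H; split; first exact: torus_gz.
  by left; rewrite bus_gz b0; clear; lia.
rewrite !mem_filter => /andP[/asboolP og /mem_H[tg g0]].
have b0 : bus (g 0) = a by rewrite og ?red0.
apply/andP; split; first by apply/asboolP => y yr; rewrite bus_gz og.
by apply/mem_H; split; [exact: torus_gz|right; rewrite bus_gz b0].
Qed.

(** The mean for [psi] lies between those for [phi] and [phi + 2], and the latter is the mean for
    [phi] plus 2. *)
Let cs_lip r phi psi : uniq r -> {subset r <= box} -> 0 \notin r -> phi 0 = a ->
  (forall y, phi y <= psi y <= phi y + 2) ->
  `|cs r ev psi * cs r one phi - cs r ev phi * cs r one psi| <=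
    2 * (cs r one phi * cs r one psi).
Proof.
move=> ur rb r0 p0 le.
have le1 y : phi y <= psi y by case/andP: (le y).
have le2 y : psi y <= phi y + 2 by case/andP: (le y).
rewrite ger0_norm ?subr_ge0; last exact: cs_mono.
have := cs_mono ur rb le2; rewrite !cs_shift//.
have -> : cs r (fun h => ev (fun x => gz q 1 * h x)%g) phi = cs r ev phi + 2 * cs r one phi.
  rewrite /cs mulr_sumr -big_split /=; apply: eq_bigr => h _.
  rewrite -[LHS]/((bus (gz q 1 * h (pt n))%g + K)%:~R) bus_gz /one !mulr1 addrAC intrD; congr (_ + _).
rewrite mulrDl => h; rewrite lerBlDl [2 * _]mulrA; exact: h.
Qed.

(** The sites still hidden when the heights at [pt 0] to [pt i] are known, with the path in front:
    increasing [i] removes the head. *)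
Let rest (i : nat) : seq site :=
  [seq pt j | j <- iota i.+1 (n - i)] ++
  [seq y <- box | y \notin [seq pt j | j <- iota 0 n.+1]].

Let pt_inj : injective pt.
Proof. by move=> i j e; rewrite -(l1norm_pt i) e l1norm_pt. Qed.

Let pt_box i : (i <= n)%N -> pt i \in box.
Proof.
move=> i_n; rewrite (mem_box M0); apply/eqP/red_small => j.
rewrite /pt mulmxnE mxE; case: (j == k); rewrite ?andbF ?andbT /= ?mul0rn.
  by rewrite mulr1n natz; move: nN i_n; clear; lia.
by move: M0; clear; lia.
Qed.

Let rest_cons i : (i < n)%N -> rest i = pt i.+1 :: rest i.+1.
Proof. by move=> i_n; rewrite /rest -(subnSK i_n). Qed.

Let mem_rest_pt i j : (j <= n)%N -> pt j \in rest i -> (i < j)%N.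
Proof.
move=> jn; rewrite mem_cat => /orP[/mapP[l + /pt_inj ->]|].
  by rewrite mem_iota => /andP[].
rewrite mem_filter => /andP[/negP[]]; apply: map_f.
by rewrite mem_iota /= add0n ltnS.
Qed.

Let rest_box i : {subset rest i <= box}.
Proof.
move=> y; rewrite mem_cat => /orP[/mapP[j + ->]|]; last by rewrite mem_filter => /andP[].
by rewrite mem_iota => /andP[ij jn]; apply: pt_box; move: ij jn; clear; lia.
Qed.

Let rest_uniq i : uniq (rest i).
Proof.
rewrite cat_uniq (map_inj_uniq pt_inj) iota_uniq /= filter_uniq ?andbT; last first.
  apply: filter_uniq; rewrite map_inj_uniq ?enum_uniq// => f g e.
  apply/ffunP => j; apply: val_inj; move/matrixP: e => /(_ 0 j); rewrite !mxE.
  by move=> /addIr [].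
apply/hasPn => y; rewrite mem_filter => /andP[ypt _]; apply: contra ypt => /mapP[j + ->].
rewrite mem_iota => /andP[ij jn]; apply: (@map_f _ _ pt (iota 0 n.+1) j); rewrite mem_iota add0n /=.
by move: ij jn; clear; lia.
Qed.

Let pt0 : pt 0 = 0. Proof. by rewrite /pt mulr0n. Qed.

Let cs_variance i eta : (i <= n)%N -> eta 0 = a ->
  cs (rest i) (fun h => ev h ^+ 2) eta * cs (rest i) one eta - cs (rest i) ev eta ^+ 2 <=
    (2 * (n - i))%:R * cs (rest i) one eta ^+ 2.
Proof.
move=> i_n; move kE : (n - i)%N => l; elim: l i eta i_n kE => [|l IH] i eta i_n kE e0.
  have {}i_n : i = n by apply/eqP; rewrite eqn_leq i_n -subn_eq0 kE.
  rewrite i_n muln0 mul0r.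
  have evE h : off (rest n) eta h -> ev h = (eta (pt n) + K)%:~R.
    have rp : red (pt n) = pt n by apply/eqP; rewrite -(mem_box M0) pt_box.
    move=> oh; rewrite /ev oh// rp; apply/negP => /(mem_rest_pt (leqnn n)).
    by rewrite ltnn.
  have -> : cs (rest n) (fun h => ev h ^+ 2) eta = (eta (pt n) + K)%:~R ^+ 2 * cs (rest n) one eta.
    by rewrite /cs mulr_sumr; apply: eq_bigr => h /asboolP /evE ->; rewrite mulr1.
  have -> : cs (rest n) ev eta = (eta (pt n) + K)%:~R * cs (rest n) one eta.
    by rewrite /cs mulr_sumr; apply: eq_bigr => h /asboolP /evE ->; rewrite mulr1.
  by rewrite exprMn expr2 [X in _ - X]mulrC expr2 mulrACA -!expr2 [X in X - _]mulrC
    (_ : _ - _ = 0)//; ring.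
have {}i_n : (i < n)%N by rewrite -subn_gt0 kE.
have rb1 := @rest_box i.+1; have ru1 := rest_uniq i.+1.
have ptn j : (j <= i.+1)%N -> pt j \notin rest i.+1.
  move=> ji; apply/negP => /(mem_rest_pt (leq_trans ji i_n)).
  by rewrite ltnNge ji.
have rpt j : (j <= n)%N -> red (pt j) = pt j by move=> jn; apply/eqP; rewrite -(mem_box M0) pt_box.
rewrite rest_cons// !cs_cons//; try exact: pt_box; try exact: ptn.
have -> : (2 * l.+1)%:R = (2 * l)%:R + 2 :> R by rewrite mulnS addnC natrD.
have u0 c : upd eta (pt i.+1) c 0 = a.
  by rewrite /upd -pt0 rpt// (inj_eq pt_inj) pt0.
apply: variance_mixture.
- by move=> c; apply: cs_ge0 => h _; exact: ler01.
- by move=> c _; apply: IH => //; rewrite subnS kE.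
- move=> c; rewrite /cs => /eqP; rewrite psumr_eq0// => /allP z0.
  have F0 F : \sum_(h <- H | `[< off (rest i.+1) (upd eta (pt i.+1) c) h >]) F h = 0 :> R.
    by rewrite big_seq_cond big1// => h /andP[/z0 /implyP zh /zh]; rewrite /one oner_eq0.
  by rewrite !F0.
(* Two possible values of the next height are both at distance one from the last revealed height, so
   they are equal or 2 apart. *)
have near c : cs (rest i.+1) one (upd eta (pt i.+1) c) != 0 -> `|c - eta (pt i)| = 1.
  move=> nz; have [h [hH oh]] : exists h, Hset h /\ off (rest i.+1) (upd eta (pt i.+1) c) h.
    apply: contrapT => /forallNP nh; move/eqP: nz; apply.
    rewrite /cs big_seq_cond big1// => h /andP[/mem_H hH /asboolP oh].
    by case: (nh h).
  have := oh (pt i.+1); rewrite rpt// => /(_ (ptn _ (leqnn _))) b1.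
  have := oh (pt i); rewrite rpt ?(ltnW i_n)// => /(_ (ptn _ (leqnSn _))) b2.
  have xy : l1norm (pt i.+1 - pt i) = 1%N by rewrite /pt mulrS addrK l1norm_delta.
  have := bus_step hH.1.1 xy; rewrite b1 b2 /upd !rpt ?(ltnW i_n)// eqxx (inj_eq pt_inj).
  have -> : quo (pt i.+1) = 0 by rewrite -(rpt i.+1)// (quo_red M0).
  by rewrite (ltn_eqF (ltnSn i)) tw0 mulr0 addr0.
move=> c c' cD c'D z z'.
have n1 := near _ z; have n2 := near _ z'.
have le12 b b' : b <= b' <= b + 2 -> forall y,
    upd eta (pt i.+1) b y <= upd eta (pt i.+1) b' y <= upd eta (pt i.+1) b y + 2.
  by move=> bb y; rewrite /upd; case: ifP => _; move: bb; [move: (tw _) => t|move: (eta y) => t]; clear; lia.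
have /orP[cc|cc] : (c <= c' <= c + 2) || (c' <= c <= c' + 2).
  by move: n1 n2; move: (eta _) => t; clear; lia.
- rewrite distrC; apply: le_trans (cs_lip ru1 rb1 _ (u0 c) (le12 _ _ cc)) _ => //.
  by rewrite -pt0; exact: ptn.
- apply: le_trans (cs_lip ru1 rb1 _ (u0 c') (le12 _ _ cc)) _; first by rewrite -pt0; exact: ptn.
  by rewrite [X in 2 * X]mulrC.
Qed.

(* The heights at [pt 1], ..., [pt n] are revealed one by one: each of them adds
   at most 2 to the variance, by [variance_mixture] and [cs_lip]. *)
Lemma torus_variance (s : seq (site -> G)) :
  uniq s -> (forall h, h \in s <-> torus h /\ bus (h 0) = a) ->
  (\sum_(h <- s) (bus (h (pt n)) - a)%:~R ^+ 2) * (size s)%:R -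
    (\sum_(h <- s) (bus (h (pt n)) - a)%:~R) ^+ 2 <= (2 * n)%:R * (size s)%:R ^+ 2 :> R.
Proof.
(* Only the values of [eta] on the orbit of 0 matter, since [rest 0] contains every other site of
   the box. *)
move=> us mem_s; pose eta y := a + 2 * tw (quo y).
have quo0 : quo (0 : site) = 0 by apply: (quo_small M0) => j; rewrite mxE; move: M0; clear; lia.
have red0 : red (0 : site) = 0 by apply: red_small => j; rewrite mxE; move: M0; clear; lia.
have e0 : eta 0 = a by rewrite /eta quo0 tw0 mulr0 addr0.
have offE h : Hset h -> off (rest 0) eta h <-> bus (h 0) = a.
  move=> [th _]; split=> [oh|h0 y yr].
    rewrite oh ?e0// red0 -pt0; apply/negP => /(mem_rest_pt (leq0n n)).
    by rewrite ltnn.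
  rewrite (bus_red y th) /eta; congr (_ + _); rewrite -h0; congr (bus (h _)).
  move: yr; rewrite mem_cat negb_or mem_filter (red_box M0) andbT negbK => /andP[n1 /mapP[j]].
  rewrite mem_iota add0n /= ltnS => jn yj; rewrite yj in n1 *.
  case: j jn yj n1 => [|j] jn yj; first by rewrite pt0.
  by rewrite map_f// mem_iota /= subn0 add1n ltnS.
have csE F : cs (rest 0) F eta = \sum_(h <- s) F h.
  rewrite /cs -big_filter; apply: perm_big; apply: uniq_perm => //; first exact: filter_uniq.
  move=> h; rewrite mem_filter; apply/andP/idP => [[/asboolP oh /mem_H hH]|].
    by apply/mem_s; split; [case: hH|exact/offE].
  move=> /mem_s[th h0]; have hH : Hset h by split=> //; left.
  by split; [exact/asboolP/offE|exact/mem_H].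
have := cs_variance (leq0n n) e0; rewrite !csE subn0.
have -> : \sum_(h <- s) one h = (size s)%:R :> R.
  by rewrite /one big_const_seq count_predT iter_addr addr0.
pose b : R := (a + K)%:~R.
have evE h : ev h = (bus (h (pt n)) - a)%:~R + b.
  by rewrite /ev /b -intrD; congr (_%:~R); ring.
set X := fun h : site -> G => (bus (h (pt n)) - a)%:~R : R.
have -> : \sum_(h <- s) ev h = \sum_(h <- s) X h + b * (size s)%:R.
  rewrite (eq_bigr (fun h => X h + b)) => [|h _]; last exact: evE.
  by rewrite big_split /= big_const_seq count_predT iter_addr addr0 mulr_natr.
have -> : \sum_(h <- s) ev h ^+ 2 =
    \sum_(h <- s) X h ^+ 2 + 2 * b * \sum_(h <- s) X h + b ^+ 2 * (size s)%:R.
  rewrite (eq_bigr (fun h => X h ^+ 2 + 2 * b * X h + b ^+ 2)) => [|h _]; last first.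
    by rewrite evE -/(X h); ring.
  by rewrite !big_split /= -mulr_sumr big_const_seq count_predT iter_addr addr0 mulr_natr.
by move=> h; lra.
Qed.

End Variance.

(** * The slope *)

Section TorusSlope.
Variables (R : realType) (m q : nat).
Notation d := q.+2.
Hypothesis hd : (2 <= d)%N.
Notation site := 'rV[int]_m.
Notation G := (freeinv d).
Notation grad := (gradient m hd).
Implicit Types (h : site -> G) (x y v : site) (C : set grad).
Variables (M : nat) (p : 'I_m -> nat) (k0 : 'I_m).
Hypothesis M0 : (0 < M)%N.
Hypothesis pM : forall k, (p k <= M)%N.
Hypothesis pk0 : (0 < p k0)%N.
Variable k : 'I_m.
Notation torus := (@torus m q M p).
Notation normal := (@normal m q M p).
Notation tw := (@tw m p).
Notation pt i := (delta_mx 0 k *+ i : site).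
Let sigma : R := (p k)%:R / M%:R.

Let S (a : nat) : seq (site -> G) := [seq h <- Ts q M p | bus (h 0) == a%:Z].

Let mem_S a h : (a < 2)%N -> h \in S a <-> torus h /\ bus (h 0) = a%:Z.
Proof.
move=> a2; rewrite mem_filter; split=> [/andP[/eqP e /(mem_Ts hd M0 pk0)[th _]] //|[th e]].
rewrite e eqxx; apply/(mem_Ts hd M0 pk0); split=> //; rewrite e.
by move: a2; clear; lia.
Qed.

Let S_uniq a : uniq (S a). Proof. exact/filter_uniq/Ts_uniq. Qed.

Let inc i h : int := bus (h (pt i)) - bus (h 0).

Let pt_step i : l1norm (pt i.+1 - pt i) = 1%N.
Proof. by rewrite mulrSr addrAC subrr add0r l1norm_delta. Qed.

Let inc_parity i h : is_hom h -> (2 %| (inc i h - i%:Z)%R)%Z.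
Proof.
move=> hh; elim: i => [|i]; first by rewrite /inc mulr0n !subrr.
have := bus_step hh (pt_step i); rewrite /inc.
by move: (bus _) (bus _) (bus _) => a b c; clear; lia.
Qed.

(* Even translations preserve the parity of [bus (h 0)]. *)
Let sum_shift a i j : (a < 2)%N ->
  \sum_(h <- S a) (inc (2 * i + j) h - inc (2 * i) h) = \sum_(h <- S a) inc j h.
Proof.
move=> a2; pose F v h : site -> G := nrm (fun x => h (x + v)).
pose v := pt (2 * i).
have ev h : h \in S a -> (2 %| (bus (h v) - bus (h 0%R))%R)%Z.
  move=> /(mem_S _ a2)[[hh _] _]; have := inc_parity (2 * i) hh; rewrite /inc -/v.
  by move: (bus _) (bus _) => b c; clear; lia.
have P : perm_eq (map (F v) (S a)) (S a).
  apply: (@perm_map_can _ _ _ (F (- v))) => // h hS.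
    have /(mem_S _ a2)[th h0] := hS; apply/(mem_S _ a2).
    have [? n0] := nrm_normal (torus_shift v th); split=> //.
    move: (ev h hS) n0; rewrite h0 /F /nrm bus_gz add0r; move: (bus _) a2 => b; clear; lia.
  move: hS => /(mem_S _ a2)[th h0].
  apply: (@nrm_cancel _ _ M p (fun h x => h (x + v)) (fun h x => h (x - v))) => //.
  - by move=> g; exact: torus_shift.
  - by move=> g; exact: torus_shift.
  - by apply/funext => x; rewrite subrK.
  - by split=> //; rewrite h0; move: a2; clear; lia.
rewrite -[RHS](perm_big _ P) big_map; apply: eq_bigr => h _.
rewrite /inc /F /nrm !bus_gz add0r /v addrC -mulrnDr addnC.
by move: (bus _) (bus _) (bus _) (_ %/ _)%Z => b c e t; clear; lia.
Qed.

Let sum_even a i : (a < 2)%N -> \sum_(h <- S a) inc (2 * i) h = (\sum_(h <- S a) inc 2 h) *+ i.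
Proof.
move=> a2; elim: i => [|i IH].
  by rewrite muln0 mulr0n big1// => h _; rewrite /inc mulr0n subrr.
rewrite mulrSr -IH -(sum_shift i 2 a2) -big_split /=; apply: eq_bigr => h _.
by rewrite mulnS addnC addrC subrK.
Qed.

(** By stationarity under even translations the mean increment is linear in [i], and over a full
    period the increment is exactly [2 p k]. *)
Let mean a i : (a < 2)%N ->
  \sum_(h <- S a) (inc (2 * i) h)%:~R = (size (S a))%:R * ((2 * i)%:R * sigma) :> R.
Proof.
move=> a2; rewrite -(big_morph (fun z : int => z%:~R : R) (intrD R) (mulr0z 1)) sum_even//.
have : \sum_(h <- S a) inc (2 * M) h = (size (S a))%:Z * (2 * (p k)%:Z).
  rewrite big_seq (eq_bigr (fun=> 2 * (p k)%:Z)) => [|h /(mem_S _ a2)[th _]].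
    by rewrite -big_seq big_const_seq count_predT iter_addr addr0 -[LHS]mulr_natl natz.
  have -> : inc (2 * M) h = bus (h (0 + (2 * M)%N%:Z *: delta_mx 0 k)) - bus (h 0).
    by rewrite add0r /inc -scaler_nat; congr (bus (h (_ *: _)) - _); exact: natz.
  rewrite (bus_torus _ _ th) addrAC subrr add0r /tw (bigD1 k)//= mxE !eqxx mulr1.
  by rewrite big1 ?addr0// => j /negbTE jk; rewrite mxE jk andbF mulr0.
rewrite !sum_even//; move: (bigop _ _ _) (size _) => D n /(congr1 (fun z : int => z%:~R : R)).
rewrite rmorphMn /= !intrM -!pmulrn => e.
have M1 : M%:R != 0 :> R by rewrite pnatr_eq0 -lt0n.
rewrite rmorphMn /= natrM; apply: (mulIf M1).
by rewrite -[_ *+ i]mulr_natr mulrAC (mulr_natr _ M) e /sigma; field.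
Qed.

Let dev i h : R := (inc i h)%:~R - i%:R * sigma.

Let class_deviation a i : (a < 2)%N -> (2 * i < 2 * M)%N ->
  \sum_(h <- S a) dev (2 * i) h ^+ 2 <= (2 * (2 * i))%:R * (size (S a))%:R.
Proof.
move=> a2 iM; have := torus_variance R M0 pk0 k iM (S_uniq a) (fun h => mem_S h a2).
have incE h : h \in S a -> (bus (h (pt (2 * i))) - a%:Z)%:~R = (inc (2 * i) h)%:~R :> R.
  by move=> /(mem_S _ a2)[_ h0]; rewrite /inc h0.
rewrite big_seq (eq_bigr (fun h => (inc (2 * i) h)%:~R ^+ 2)); last first.
  by move=> h /incE ->.
rewrite -big_seq [X in _ - X ^+ 2]big_seq (eq_bigr _ incE) -big_seq mean//.
set n : R := _%:R * sigma.
have -> : \sum_(h <- S a) dev (2 * i) h ^+ 2 =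
    \sum_(h <- S a) (inc (2 * i) h)%:~R ^+ 2 - n ^+ 2 * (size (S a))%:R.
  rewrite /dev -/n (eq_bigr (fun h => (inc (2 * i) h)%:~R ^+ 2 +
    (- (2 * n) * (inc (2 * i) h)%:~R + n ^+ 2))) => [|h _]; last by ring.
  rewrite !big_split /= -mulr_sumr mean// -/n big_const_seq count_predT iter_addr addr0.
  by rewrite -mulr_natr; ring.
have [/size0nil ->|s0] := posnP (size (S a)).
  by rewrite !big_nil !mulr0 subrr.
have {}s0 : 0 < (size (S a))%:R :> R by rewrite ltr0n.
set V := \sum_(h <- _) _; move=> h.
rewrite -(ler_pM2r s0); apply: le_trans _ (le_trans h _); rewrite le_eqVlt; apply/orP; left;
  by apply/eqP; ring.
Qed.

Let sum_classes (F : (site -> G) -> R) :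
  \sum_(h <- Ts q M p) F h = \sum_(h <- S 0) F h + \sum_(h <- S 1) F h.
Proof.
rewrite (bigID (fun h => bus (h 0) == 0)) /= !big_filter; congr (_ + _).
rewrite big_seq_cond [RHS]big_seq_cond; apply: eq_bigl => h.
case: (boolP (h \in _)) => //= /(mem_Ts hd M0 pk0)[_].
by move: (bus _) => b; clear; lia.
Qed.

Let deviation i : (2 * i < 2 * M)%N ->
  \sum_(h <- Ts q M p) dev (2 * i) h ^+ 2 <= (2 * (2 * i))%:R * (size (Ts q M p))%:R.
Proof.
move=> iM; rewrite sum_classes.
have -> : (size (Ts q M p))%:R = (size (S 0))%:R + (size (S 1))%:R :> R.
  have sumE s : \sum_(h <- s : seq (site -> G)) 1 = (size s)%:R :> R.
    by rewrite big_const_seq count_predT iter_addr addr0.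
  by rewrite -!sumE sum_classes.
by rewrite mulrDr lerD// class_deviation.
Qed.

Let dist n h : R := (tree_dist (h 0) (h (pt n)))%:R.

Let l1norm_ptB i j : l1norm (pt (j + i) - pt j) = i.
Proof. by rewrite mulrnDr addrAC subrr add0r l1norm_delta_mulrn. Qed.

(* All the [h (pt i)] have a common ancestor at a level K close to the maximum
   of [bus] along the path, which is controlled by the points of a grid. *)
Let dist_deviation r J h : is_hom h -> (0 < r)%N ->
  (dist (r * J) h - (r * J)%:R * sigma) ^+ 2 <=
    18 * (\sum_(l < J.+1) dev (r * l) h ^+ 2) + 8 * r%:R ^+ 2.
Proof.
move=> hh r0; set V := \sum_(l < _) _; set n := (r * J)%N.
have s0 : 0 <= sigma by rewrite divr_ge0.
pose A := Num.sqrt V.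
have V0 : 0 <= V by apply: sumr_ge0 => l _; exact: sqr_ge0.
have A2 : A ^+ 2 = V by rewrite sqr_sqrtr.
have A0 : 0 <= A by exact: sqrtr_ge0.
have devA l : (l <= J)%N -> `|dev (r * l) h| <= A.
  move=> lJ; rewrite -sqrtr_sqr; apply: ler_wsqrtr.
  rewrite /V (bigD1 (Ordinal (lJ : (l < J.+1)%N)))//= lerDl.
  by apply: sumr_ge0 => ? _; exact: sqr_ge0.
(* As [sigma] is nonnegative, [f] bounds the height increments at all grid points; the extra [r] in
   [K] covers the sites between them. *)
pose f : int := Num.floor (A + n%:R * sigma).
pose K : int := bus (h 0) + f + r%:Z.
have leK i : (i <= n)%N -> bus (h (pt i)) <= K.
  move=> i_n; have lJ : (i %/ r <= J)%N by rewrite -[leqRHS](mulKn J r0) leq_div2r.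
  have : inc (r * (i %/ r)) h <= f.
    rewrite /f floor_ge_int -lerBlDr; apply: le_trans (le_trans (ler_norm _) (devA _ lJ)).
    by rewrite /dev lerD2l lerN2 ler_wpM2r// ler_nat /n leq_mul2l lJ orbT.
  have := bus_lip_hom (pt (r * (i %/ r) + i %% r)) (pt (r * (i %/ r))) hh.
  rewrite l1norm_ptB mulnC -divn_eq /inc /K; have := ltn_pmod i r0.
  by move: (i %% r)%N (bus _) (bus _) (bus _) => t b c e; clear; lia.
have common i : (i <= n)%N -> up K (h (pt i)) = up K (h 0).
  elim: i => [//|i IH] i_n; rewrite -IH ?(ltnW i_n)//; apply: up_adj.
  - by move/is_homP: hh; apply; exact: pt_step.
  - exact: leK.
  - by apply: leK; exact: ltnW.
have upper : (tree_dist (h 0) (h (pt n)))%:Z <= 2 * f + 2 * r%:Z - inc n h.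
  have d0 := tree_dist_anc `|K - bus (h 0%R)|%N (h 0).
  have dn := tree_dist_anc `|K - bus (h (pt n))|%N (h (pt n)).
  rewrite -/(up K (h 0)) in d0; rewrite -/(up K _) common// tree_distC in dn.
  have := tree_dist_triangle (up K (h 0)) (h 0) (h (pt n)).
  have := leK _ (leqnn n); have := leK _ (leq0n n); rewrite mulr0n => K0 Kn t.
  move: (leq_trans t (leq_add d0 dn)) K0 Kn; rewrite /inc /K.
  by move: (bus _) (bus _) (tree_dist _ _) => b c e; clear; lia.
have lower : inc n h <= (tree_dist (h 0) (h (pt n)))%:Z.
  have := bus_lip (h (pt n)) (h 0); rewrite /inc tree_distC.
  by move: (bus _) (bus _) (tree_dist _ _) => b c e; clear; lia.
have fle : f%:~R <= A + n%:R * sigma by exact: floor_le.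
have := devA J (leqnn J); rewrite -/n ler_norml /dev => /andP[dl du].
have {}upper : dist n h <= 2 * f%:~R + 2 * r%:R - (inc n h)%:~R.
  move: upper; rewrite -(ler_int R) intrB intrD !intrM -!pmulrn; exact.
have {}lower : (inc n h)%:~R <= dist n h by move: lower; rewrite -(ler_int R) -!pmulrn.
have rr : 0 <= r%:R :> R by [].
set X := dist n h - _.
have X1 : - (3 * A + 2 * r%:R) <= X by rewrite /X; lra.
have X2 : X <= 3 * A + 2 * r%:R by rewrite /X; lra.
(* The constants come from [(3 A + 2 r) ^ 2 + (3 A - 2 r) ^ 2 = 18 A ^ 2 + 8 r ^ 2]. *)
have X3 : 0 <= (3 * A + 2 * r%:R - X) * (X + (3 * A + 2 * r%:R)) by apply: mulr_ge0; lra.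
rewrite -A2 -subr_ge0; apply: le_trans (addr_ge0 X3 (sqr_ge0 (3 * A - 2 * r%:R))) _.
by rewrite le_eqVlt; apply/orP; left; apply/eqP; ring.
Qed.

(* The error on the grid of step J ^ 2 balances the fluctuations at scale J ^ 3. *)
Lemma torus_slope (s : R) (j : nat) (J := (2 * j)%N) : (0 < j)%N -> (J ^ 3 < 2 * M)%N ->
  `|sigma - s| <= M%:R^-1 ->
  \sum_(h <- Ts q M p) ((tree_dist (h 0) (h (pt (J ^ 3))))%:R / (J ^ 3)%:R - s) ^+ 2 <=
    200 / J%:R ^+ 2 * (size (Ts q M p))%:R.
Proof.
move=> j0 JM sM; set T : R := (size _)%:R.
have J0 : (0 < J)%N by rewrite /J muln_gt0.
have x0 : 0 < J%:R :> R by rewrite ltr0n.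
have x1 : 1 <= J%:R :> R by rewrite ler1n.
have T0 : 0 <= T by [].
have nE : (J ^ 2 * J = J ^ 3)%N by rewrite -expnSr.
have sumT (c : R) : \sum_(h <- Ts q M p) c = c * T.
  by rewrite big_const_seq count_predT iter_addr addr0 mulr_natr.
have dev_grid (l : 'I_J.+1) : \sum_(h <- Ts q M p) dev (J ^ 2 * l) h ^+ 2 <= 2 * J%:R ^+ 3 * T.
  have lJ : (J ^ 2 * l <= J ^ 3)%N by rewrite -nE leq_mul2l -ltnS ltn_ord orbT.
  (* [J] is even, so every grid point is at even distance, where the mean is known exactly. *)
  have E : (J ^ 2 * l = 2 * (j * J * l))%N by rewrite /J; ring.
  rewrite {1}E; apply: le_trans (deviation _) _; rewrite -E; first exact: leq_ltn_trans lJ JM.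
  by rewrite -/T ler_wpM2r// natrM ler_wpM2l// -natrX ler_nat.
have dist_sum : \sum_(h <- Ts q M p) (dist (J ^ 3) h - (J ^ 3)%:R * sigma) ^+ 2 <=
    80 * J%:R ^+ 4 * T.
  apply: (@le_trans _ _ (\sum_(h <- Ts q M p)
      (18 * (\sum_(l < J.+1) dev (J ^ 2 * l) h ^+ 2) + 8 * (J ^ 2)%:R ^+ 2))).
    rewrite big_seq [leRHS]big_seq; apply: ler_sum => h /(mem_Ts hd M0 pk0)[[hh _] _].
    by rewrite -nE; apply: dist_deviation => //; rewrite expn_gt0 J0.
  rewrite big_split /= sumT -mulr_sumr exchange_big /=.
  (* There are [J + 1 <= 2 J] grid points; the constant 80 is [18 * 4 + 8]. *)
  have : \sum_(l < J.+1) \sum_(h <- Ts q M p) dev (J ^ 2 * l) h ^+ 2 <=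
      2 * J%:R * (2 * J%:R ^+ 3 * T).
    apply: le_trans (ler_sum _ (fun l _ => dev_grid l)) _.
    rewrite sumr_const card_ord -[leLHS]mulr_natl; apply: ler_wpM2r.
      by rewrite mulr_ge0// mulr_ge0// exprn_ge0// ltW.
    by rewrite -natr1 mulr_natl mulr2n lerD2l.
  move: (bigop _ _ _) => S1 hS; rewrite natrX.
  have -> : 80 * J%:R ^+ 4 * T = 18 * (2 * J%:R * (2 * J%:R ^+ 3 * T)) + 8 * (J%:R ^+ 2) ^+ 2 * T.
    by ring.
  by rewrite lerD2r ler_wpM2l.
have M1 : 0 < M%:R :> R by rewrite ltr0n.
(* [J <= J ^ 3 < 2 M] bounds [1 / M] by [2 / J]. *)
have sJ : (sigma - s) ^+ 2 <= 4 / J%:R ^+ 2.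
  have -> : 4 / J%:R ^+ 2 = (2 / J%:R) ^+ 2 :> R by field; rewrite gt_eqF.
  rewrite -[leLHS]real_normK ?num_real// ler_sqr ?nnegrE ?divr_ge0//.
  apply: le_trans sM _; rewrite -[leRHS]invf_div lef_pV2 ?posrE ?divr_gt0// ler_pdivrMr//.
  by rewrite -natrM ler_nat mulnC ltnW// (leq_ltn_trans _ JM)// -{1}(expn1 J) leq_pexp2l.
apply: (@le_trans _ _ (\sum_(h <- Ts q M p)
   (2 / J%:R ^+ 6 * (dist (J ^ 3) h - (J ^ 3)%:R * sigma) ^+ 2 + 2 * (4 / J%:R ^+ 2)))).
  apply: ler_sum => h _; set D := dist _ _; rewrite -/(dist _ h) -/D natrX.
  have -> : D / J%:R ^+ 3 - s = (D - J%:R ^+ 3 * sigma) / J%:R ^+ 3 + (sigma - s).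
    by field; rewrite gt_eqF.
  set x := _ / _ ^+ 3; have -> : 2 / J%:R ^+ 6 * (D - J%:R ^+ 3 * sigma) ^+ 2 = 2 * x ^+ 2.
    by rewrite /x; field; rewrite gt_eqF.
  have := sqr_ge0 (x - (sigma - s)); move: sJ; move: (4 / _) x (sigma - s) => c x y; nra.
rewrite big_split /= sumT -mulr_sumr.
apply: (@le_trans _ _ (2 / J%:R ^+ 6 * (80 * J%:R ^+ 4 * T) + 2 * (4 / J%:R ^+ 2) * T)).
  by rewrite lerD2r ler_wpM2l// divr_ge0// exprn_ge0// ltW.
(* The terms add up to [168 = 2 * 80 + 8]; the rest of 200 is slack. *)
rewrite -subr_ge0 (_ : _ - _ = 32 / J%:R ^+ 2 * T); last by field; rewrite gt_eqF.
by rewrite mulr_ge0// divr_ge0// sqr_ge0.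
Qed.

End TorusSlope.

(** * From summable square errors on a sparse grid to the slope *)

Section Interpolation.
Variable R : realType.

(** Telescoping: [(x + 1) ^ -2] is at most [2 / (2 x + 1) - 2 / (2 x + 3)]. *)
Lemma sum_inv_sqr_le2 J : \sum_(i < J) (i.+1%:R ^- 2) <= 2 :> R.
Proof.
suff : \sum_(i < J) (i.+1%:R ^- 2) <= 2 - 2 / (2 * J%:R + 1) :> R.
  by move=> h; apply: le_trans h _; rewrite gerBl divr_ge0// addr_ge0// mulr_ge0.
elim: J => [|J IH]; first by rewrite big_ord0 mulr0 add0r divr1 subrr.
rewrite big_ord_recr /=; apply: le_trans (lerD IH (lexx _)) _.
rewrite -[J.+1%:R]natr1; have : 0 <= J%:R :> R by []; move: (J%:R) => x x0.
have x1 : 0 < x + 1 by lra.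
have x2 : 0 < 2 * x + 1 by lra.
have x3 : 0 < 2 * (x + 1) + 1 by lra.
rewrite -subr_ge0.
have -> : 2 - 2 / (2 * (x + 1) + 1) - (2 - 2 / (2 * x + 1) + (x + 1) ^- 2) =
    ((x + 1) ^+ 2 * (2 * x + 1) * (2 * (x + 1) + 1))^-1.
  by field; rewrite !gt_eqF.
by rewrite invr_ge0 !mulr_ge0 ?sqr_ge0 ?ltW.
Qed.

(* Grid on which square errors of order [j ^- 2] are summable, yet dense enough
   for Lipschitz interpolation. *)
Definition cubes (j : nat) : nat := ((2 * j.+1) ^ 3)%N.

Lemma cubes_gt0 j : (0 < cubes j)%N. Proof. by rewrite expn_gt0 muln_gt0. Qed.

Lemma cubes_ltS j : (cubes j < cubes j.+1)%N.
Proof. by rewrite ltn_exp2r// ltn_pmul2l. Qed.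

Lemma cubes_between i n : (cubes i <= n)%N ->
  exists2 j, (i <= j)%N & (cubes j <= n < cubes j.+1)%N.
Proof.
elim: n => [|n IH].
  by rewrite leqNgt cubes_gt0.
rewrite leq_eqVlt => /predU1P[<-|]; first by exists i; rewrite // leqnn cubes_ltS.
rewrite ltnS => /IH[j ij /andP[jn nj]].
have [nj1|nj1] := ltnP n.+1 (cubes j.+1); first by exists j; rewrite // nj1 ltnW.
exists j.+1; first exact: leqW.
by rewrite nj1 (leq_ltn_trans nj (cubes_ltS _)).
Qed.

(** Consecutive grid points near [N] are [O(N ^ (2/3))] apart, so a Lipschitz sequence changes by
    [o(N)] between them. *)
Lemma cvg_cubes (a : nat -> R) (s : R) : (forall n, `|a n.+1 - a n| <= 1) ->
  (forall l : nat, \forall j \near \oo, `|a (cubes j) / (cubes j)%:R - s| <= l.+1%:R^-1) ->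
  a n / n%:R @[n --> \oo] --> s.
Proof.
move=> lip grid; apply/cvgrPdist_le => e e0.
have lipD n i : `|a (n + i)%N - a n| <= i%:R.
  elim: i => [|i IH]; first by rewrite addn0 subrr normr0.
  rewrite addnS -(subrKA (a (n + i)%N)) (le_trans (ler_normD _ _))// -natr1 addrC.
  exact: lerD.
pose l := Num.bound (2 / e); pose i1 := Num.bound (52 * (1 + `|s|) / e).
have le2 : l.+1%:R^-1 <= e / 2.
  rewrite -[leRHS]invf_div lef_pV2 ?posrE ?divr_gt0//.
  apply/ltW/(lt_trans (archi_boundP _)); first by rewrite divr_ge0// ltW.
  by rewrite ltr_nat.
have [i0 _ gridi] := grid l.
near=> n; have [|j] := @cubes_between (maxn i0 i1) n; first by near: n; exact: nbhs_infty_ge.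
rewrite geq_max => /andP[i0j i1j] /andP[jn nj].
have := gridi j i0j; set N := cubes j in jn *.
have N0 : 0 < N%:R :> R by rewrite ltr0n cubes_gt0.
have n0 : 0 < n%:R :> R by rewrite ltr0n (leq_trans (cubes_gt0 j)).
move=> /le_trans/(_ le2) gN.
(* With [x = 2 (j + 1)], the gap is [(x + 2) ^ 3 - x ^ 3 = 6 x ^ 2 + 12 x + 8 <= 26 x ^ 2]; the 52
   in [i1] is twice 26. *)
have dN : (n - N)%:R <= 26 * (2 * j.+1)%:R ^+ 2 :> R.
  rewrite -natrX -natrM ler_nat leq_subLR (leq_trans (ltnW nj))//.
  by rewrite /N /cubes; clear; nia.
have := lipD N (n - N)%N; rewrite subnKC// => aN.
have E : s - a n / n%:R = - (a n - a N - (n - N)%:R * s + N%:R * (a N / N%:R - s)) / n%:R.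
  by rewrite natrB//; field; rewrite !gt_eqF.
rewrite E normrM normrN normfV (gtr0_norm n0) ler_pdivrMr//.
apply: le_trans (ler_normD _ _) _; rewrite normrM (gtr0_norm N0).
apply: (@le_trans _ _ ((n - N)%:R * (1 + `|s|) + N%:R * (e / 2))).
  rewrite lerD ?ler_wpM2l// mulrDr mulr1 (le_trans (ler_normB _ _))// normrM.
  by rewrite normr_nat lerD.
have i1e : 52 * (1 + `|s|) <= e * (2 * j.+1)%:R.
  rewrite [leRHS]mulrC -ler_pdivrMr//.
  apply/ltW/(lt_le_trans (archi_boundP _)); first by rewrite divr_ge0// ?mulr_ge0// ?addr_ge0// ltW.
  by rewrite ler_nat -/i1; move: i1j; clear; lia.
have NE : N%:R = (2 * j.+1)%:R ^+ 3 :> R by rewrite natrX.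
have nN : N%:R <= n%:R :> R by rewrite ler_nat.
have s0 : 0 <= `|s| by [].
apply: le_trans (_ : N%:R * e <= _); last by rewrite mulrC ler_wpM2l// ltW.
suff : (n - N)%:R * (1 + `|s|) <= N%:R * (e / 2) by lra.
apply: le_trans (ler_wpM2r _ dN) _; first by rewrite addr_ge0.
rewrite NE exprSr -mulrA; set x := (2 * j.+1)%:R in i1e *.
have x2 : 0 <= x ^+ 2 by exact: sqr_ge0.
have := ler_wpM2l x2 i1e; lra.
Unshelve. all: by end_near.
Qed.

End Interpolation.

Section SquareError.
Variables (R : realType) (m d : nat) (hd : (2 <= d)%N).
Notation site := 'rV[int]_m.
Notation grad := (gradient m hd).
Notation gspace := (gradient_space m hd).
Implicit Types (g : grad) (C : set grad) (P : set grad -> R) (mu : probability gspace R).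
Variable s : 'I_m -> R.

Definition span_dist k n g : nat := tree_dist (height g 0) (height g (delta_mx 0 k *+ n)).
Definition span_level k n v : set grad := [set g | span_dist k n g = v].

Lemma local_span_dist k n (A : set nat) : local [set g | A (span_dist k n g)].
Proof.
have -> : [set g | A (span_dist k n g)] =
    [set g | A (tree_dist 1%g (height g (delta_mx 0 k *+ n)))].
  by apply/funext => g /=; rewrite /span_dist height0.
exact: (local_height hd (fun w => A (tree_dist 1%g w))).
Qed.

Lemma span_dist_le k n g : (span_dist k n g <= n)%N.
Proof.
have [hh _ _] := heightP g; apply: leq_trans (hom_lip hh _ _) _.
by rewrite l1norm_sym subr0 l1norm_delta_mulrn.
Qed.

Lemma span_dist_lip k n g : `|(span_dist k n.+1 g)%:R - (span_dist k n g)%:R| <= 1 :> R.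
Proof.
have [hh _ _] := heightP g; rewrite /span_dist.
set u := height g 0; set v := height g (_ *+ n); set w := height g _.
have vw : tree_dist v w = 1%N.
  by apply: hh; rewrite l1norm_sym mulrSr addrAC subrr add0r l1norm_delta.
have h1 := tree_dist_triangle v u w; have h2 := tree_dist_triangle w u v.
rewrite (tree_distC w) vw in h2; rewrite vw in h1.
rewrite ler_norml; apply/andP; split.
  by rewrite lerBrDl lerBlDr natr1 ler_nat -addn1.
by rewrite lerBlDl natr1 ler_nat -addn1.
Qed.

(** The mean square error, expanded over the finitely many values of the distance: as a finite
    linear combination of probabilities of local events it is affine and continuous along
    ultrafilters. *)
Definition sq_error (j : nat) P : R :=
  \sum_k \sum_(v < (cubes j).+1)
    (v%:R / (cubes j)%:R - s k) ^+ 2 * P (span_level k (cubes j) v).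

Lemma sq_error_chebyshev mu j k (e : R) : 0 <= e ->
  e ^+ 2 * Pr mu [set g | ~ `|(span_dist k (cubes j) g)%:R / (cubes j)%:R - s k| <= e] <=
    sq_error j (Pr mu).
Proof.
move=> e0; set n := cubes j.
have lv v : measurable (span_level k n v : set gspace).
  by apply: measurable_local; exact: (local_span_dist k n [set v]).
have term_ge0 i v : 0 <= (v%:R / n%:R - s i) ^+ 2 * Pr mu (span_level i n v).
  by rewrite mulr_ge0 ?sqr_ge0 ?Pr_ge0.
rewrite /sq_error (bigD1 k)//= -/n; apply: ler_wpDr.
  by apply: sumr_ge0 => i _; apply: sumr_ge0 => v _.
pose far (v : nat) : Prop := ~ `|v%:R / n%:R - s k| <= e.
pose B v : set gspace := if `[< far v >] then span_level k n v else set0.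
have mB v : measurable (B v) by rewrite /B; case: ifP.
have -> : [set g | ~ `|(span_dist k n g)%:R / n%:R - s k| <= e] =
    \big[setU/set0]_(v < n.+1) B v.
  rewrite -bigcup_mkord; apply/seteqP; split=> [g fg|g [v /= _]].
    exists (span_dist k n g); first by rewrite /= ltnS span_dist_le.
    by rewrite /B; case: asboolP.
  by rewrite /B; case: asboolP => // fv gv; rewrite /= gv.
have leB N : Pr mu (\big[setU/set0]_(v < N) B v) <= \sum_(v < N) Pr mu (B v).
  elim: N => [|N IH]; first by rewrite !big_ord0 Pr0.
  rewrite !big_ord_recr /=; apply: le_trans (PrU_le _ _ _) _ => //.
    exact: bigsetU_measurable.
  by rewrite lerD2r.
apply: le_trans (ler_wpM2l (sqr_ge0 e) (leB _)) _; rewrite mulr_sumr.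
apply: ler_sum => v _; rewrite /B; case: asboolP => [/negP|_]; last by rewrite Pr0 mulr0.
rewrite -ltNge => fv; apply: ler_wpM2r; first exact: Pr_ge0.
by rewrite -[leRHS]real_normK ?num_real// ler_sqr ?nnegrE// ltW.
Qed.

(** Chebyshev's inequality makes the probabilities of large errors on the grid summable, so
    Borel-Cantelli gives almost sure convergence there. *)
Lemma sq_error_slope mu (c : R) : (forall J, \sum_(i < J) sq_error i (Pr mu) <= c) ->
  has_slope mu s.
Proof.
move=> hc k.
have : {ae mu, forall g, forall l : nat, \forall j \near \oo,
    `|(span_dist k (cubes j) g)%:R / (cubes j)%:R - s k| <= l.+1%:R^-1}.
  apply: ae_foralln => l; set e : R := _^-1.
  pose F j : set gspace :=
    [set g | ~ `|(span_dist k (cubes j) g)%:R / (cubes j)%:R - s k| <= e].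
  have mF j : measurable (F j).
    apply: measurable_local.
    exact: (local_span_dist k _ [set v | ~ `|v%:R / (cubes j)%:R - s k| <= e]).
  have e0 : 0 < e by rewrite invr_gt0.
  exists (lim_sup_set F); split.
  - by apply: bigcap_measurable => [|n _]; [exists 0%N|exact: bigcup_measurable].
  - apply: lim_sup_set_cvg0 => //.
    apply: le_lt_trans (ltry (e ^- 2 * c)).
    apply: lime_le; first by apply: is_cvg_nneseries => *; exact: measure_ge0.
    near=> n; rewrite (eq_bigr (fun i => (Pr mu (F i))%:E)) => [|i _]; last exact: PrE.
    rewrite sumEFin lee_fin big_mkord mulrC ler_pdivlMr ?exprn_gt0// mulrC mulr_sumr.
    apply: le_trans (hc n); apply: ler_sum => i _.
    exact/sq_error_chebyshev/ltW.
  - move=> g ng n _; apply: contrapT => nF; apply: ng; exists n => // j nj.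
    by apply: contrapT => fj; apply: nF; exists j.
move=> [A [mA A0 sub]]; exists A; split=> // g ng; apply: sub => hg; apply: ng.
apply: (cvg_cubes (a := fun n => (span_dist k n g)%:R)) => // n.
exact: span_dist_lip.
Unshelve. all: by end_near.
Qed.

Lemma sq_error_ge0 j P : (forall C, 0 <= P C) -> 0 <= sq_error j P.
Proof.
move=> P0; apply: sumr_ge0 => k _; apply: sumr_ge0 => v _.
by rewrite mulr_ge0 ?sqr_ge0.
Qed.

Lemma sq_error_affine j (t : R) P P' :
  sq_error j (fun C => t * P C + (1 - t) * P' C) = t * sq_error j P + (1 - t) * sq_error j P'.
Proof.
rewrite /sq_error !mulr_sumr -big_split; apply: eq_bigr => k _ /=.
by rewrite !mulr_sumr -big_split; apply: eq_bigr => v _ /=; ring.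
Qed.

Lemma local_span_level k n v : local (span_level k n v).
Proof. exact: (local_span_dist k n [set v]). Qed.

Lemma sq_error_local j P P' : (forall C, local C -> P C = P' C) -> sq_error j P = sq_error j P'.
Proof.
move=> PP'; apply: eq_bigr => k _; apply: eq_bigr => v _.
by rewrite PP'//; exact: local_span_level.
Qed.

Lemma sq_error_cvg (U : set_system nat) (UF : UltraFilter U) j (Ps : nat -> set grad -> R) P :
  (forall C, local C -> Ps n C @[n --> U] --> P C) ->
  sq_error j (Ps n) @[n --> U] --> sq_error j P.
Proof.
move=> PsP; have PF := ultra_proper.
apply: cvg_sumr => k; apply: cvg_sumr => v.
by apply: cvgM; [exact: cvg_cst|apply: PsP; exact: local_span_level].
Qed.

End SquareError.

Lemma torus_sq_error (R : realType) (m q : nat) (hd : (2 <= q.+2)%N) (M : nat)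
    (p : 'I_m -> nat) (k0 : 'I_m) (s : 'I_m -> R) (j : nat) :
  (0 < M)%N -> (forall k, (p k <= M)%N) -> (0 < p k0)%N -> (cubes j < 2 * M)%N ->
  (forall k, `|(p k)%:R / M%:R - s k| <= M%:R^-1) ->
  sq_error s j (@torus_prob R m q hd M p) <= m%:R * 50 * j.+1%:R ^- 2.
Proof.
move=> M0 pM pk0 jM ps; set T := Ts q M p; set n := cubes j.
have T0 : 0 < (size T)%:R :> R by rewrite ltr0n (size_Ts hd M0 pM pk0).
have -> : m%:R * 50 * j.+1%:R ^- 2 = \sum_(k < m) (50 * j.+1%:R ^- 2) :> R.
  by rewrite sumr_const card_ord -[RHS]mulr_natl mulrA.
apply: ler_sum => k _.
have := @torus_slope R m q hd M p k0 M0 pk0 k (s k) j.+1 isT jM (ps k); rewrite -/T -/n => h.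
have -> : 50 * j.+1%:R ^- 2 = 200 / (2 * j.+1)%N%:R ^+ 2 :> R.
  by rewrite natrM; field; rewrite addrC natr1 pnatr_eq0.
rewrite -ler_pdivrMr// in h; apply: le_trans h.
rewrite mulr_suml le_eqVlt; apply/orP; left; apply/eqP.
have count_sum v : torus_prob R M p (span_level (hd := hd) k n v) =
    \sum_(h <- T) (tree_dist (h 0) (h (delta_mx 0 k *+ n)) == v)%:R / (size T)%:R.
  rewrite /torus_prob -/T -mulr_suml -sum1_count natr_sum big_mkcond /=; congr (_ / _).
  rewrite big_seq [RHS]big_seq; apply: eq_bigr => h /(mem_Ts hd M0 pk0)[[hh _] _].
  have -> : `[< span_level (hd := hd) k n v (gr hd h) >] = (tree_dist (h 0) (h (delta_mx 0 k *+ n)) == v).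
    rewrite /span_level /span_dist /= !height_gr// tree_dist_mull.
    by apply/asboolP/eqP.
  by case: (_ == _).
under eq_bigr do rewrite count_sum mulr_sumr.
rewrite exchange_big /= big_seq [RHS]big_seq; apply: eq_bigr => h /(mem_Ts hd M0 pk0)[[hh _] _].
set D := tree_dist _ _.
have Dn : (D < n.+1)%N.
  by rewrite ltnS (leq_trans (hom_lip hh _ _))// l1norm_sym subr0 l1norm_delta_mulrn.
rewrite (bigD1 (Ordinal Dn))//= eqxx big1 ?addr0 ?mulrA ?mulr1// => v vD.
rewrite (_ : (D == v) = false) ?mul0r ?mulr0//; apply: contraNF vD => /eqP Dv.
by apply/eqP/val_inj.
Qed.

(** [p M k] is the integer part of [M * s k], at most [M] as [s k <= 1]; from [M0] on it is positive
    in a direction of positive slope. *)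
Lemma slope_approx (R : realType) (m : nat) (s : 'I_m -> R) : (forall k, 0 <= s k) ->
  0 < \sum_k `|s k| -> \sum_k `|s k| < 1 ->
  exists k0 M0 (p : nat -> 'I_m -> nat), [/\ (0 < M0)%N,
    forall M k, (p M k <= M)%N, forall M, (M0 <= M)%N -> (0 < p M k0)%N &
    forall M k, (0 < M)%N -> `|(p M k)%:R / M%:R - s k| <= M%:R^-1].
Proof.
move=> s0 s_gt0 s_lt1.
have [k0 k0s] : exists k0, 0 < s k0.
  apply: contrapT => /forallNP ns; move: s_gt0; rewrite big1 ?ltxx// => k _.
  by apply/eqP; rewrite normr_eq0 eq_le s0 andbT leNgt; exact/negP.
have s1 k : s k <= 1.
  apply: le_trans (ltW s_lt1); rewrite (bigD1 k)//= ger0_norm// lerDl.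
  by apply: sumr_ge0 => *; exact: normr_ge0.
pose M1 := Num.bound (s k0)^-1.
have tr M k := truncn_itv (mulr_ge0 (ler0n R M) (s0 k)).
exists k0, M1.+1, (fun M k => Num.truncn (M%:R * s k)); split=> //.
- move=> M k; rewrite -(ler_nat R); have /andP[h _] := tr M k.
  by apply: le_trans h _; rewrite ler_piMr.
- move=> M MM; have /andP[_] := tr M k0.
  rewrite lt0n; apply: contraTN => /eqP ->; rewrite -leNgt -ler_pdivrMr// div1r.
  apply/ltW/(lt_le_trans (archi_boundP _)); first by rewrite invr_ge0.
  by rewrite ler_nat ltnW.
move=> M k M0; have /andP[h1 h2] := tr M k.
have M0' : 0 < M%:R :> R by rewrite ltr0n.
have -> (x : R) : x / M%:R - s k = (x - M%:R * s k) / M%:R by field; rewrite gt_eqF.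
rewrite normrM normfV (gtr0_norm M0') ler_pdivrMr// mulVf ?gt_eqF//.
rewrite distrC ger0_norm; first by move: h2; rewrite -natr1; lra.
by rewrite subr_ge0.
Qed.

(** An event or a swap involves finitely many sites and so fits into all large tori. The bound is
    the limit of those on the tori, with [100 = 50 * 2] from the sum of inverse squares. *)
Lemma torus_limit (R : realType) (m q : nat) (hd : (2 <= q.+2)%N) (s : 'I_m -> R) :
  (forall k, 0 <= s k) -> 0 < \sum_k `|s k| -> \sum_k `|s k| < 1 ->
  exists mu : probability (gradient_space m hd) R, invariant mu /\
    forall J, \sum_(j < J) sq_error s j (Pr mu) <= m%:R * 100.
Proof.
move=> s0 s_gt0 s_lt1.
have [k0 [M0 [p [M00 pM pk0 ps]]]] := slope_approx s0 s_gt0 s_lt1.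
have [U [UF Uinf]] := ultraFilterLemma (eventually_filter : ProperFilter \oo).
have PF := ultra_proper.
pose Ps n C : R := @torus_prob R m q hd (M0 + n) (p (M0 + n)%N) C.
have Mn n : (0 < M0 + n)%N by rewrite addn_gt0 M00.
have pkn n : (0 < p (M0 + n)%N k0)%N by apply: pk0; exact: leq_addr.
have [||||mu mu_lim] := @ultralimit_measure R m _ hd U UF Ps _.
- by move=> n C; exact: torus_prob_ge0.
- by move=> n C; apply: (torus_prob_le1 R (Mn n) (pM _) (pkn n)).
- by move=> n; exact: (torus_probT R hd (Mn n) (pM _) (pkn n)).
- by move=> n C C' _ _; exact: torus_probU.
exists mu; split.
  split=> [v C lC|L x0 z z' C x0L lC].
    rewrite (PrE _ (measurable_local lC)) (PrE _ (measurable_local (local_translate v lC))).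
    congr _%:E; apply: (ulim_unique UF (mu_lim _ (local_translate v lC))).
    under eq_fun do rewrite /Ps (torus_prob_translate R (Mn _) (pkn _)).
    exact: mu_lim.
  have /local_cube[r1 Cr1] := lC; have [r2 Lr2] := seq_cube (x0 :: L).
  pose r := maxn r1 r2.
  rewrite (PrE _ (measurable_local lC)) (PrE _ (measurable_local (local_swap L x0 z z' lC))).
  congr _%:E; apply: (ulim_unique UF (mu_lim _ (local_swap L x0 z z' lC))).
  apply: cvg_trans (mu_lim _ lC); apply: near_eq_cvg; apply: Uinf.
  near=> n; rewrite /Ps (@torus_prob_swap R m q hd _ _ k0 (Mn n) _ (pkn n) L x0 z z' r)//.
  - by move=> x xL; apply: (cube_le (leq_maxr _ _)); apply: Lr2; rewrite inE xL orbT.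
  - by apply: (cube_le (leq_maxr _ _)); apply: Lr2; rewrite inE eqxx.
  - by rewrite (@leq_trans n)// ?leq_addl//; near: n; exact: nbhs_infty_ge.
  - by move=> g g' gg'; apply: Cr1 => x xr; apply: gg'; exact: (cube_le (leq_maxl _ _)).
move=> J; apply: (@le_trans _ _ (\sum_(j < J) (m%:R * 50 * j.+1%:R ^- 2))).
  apply: ler_sum => j _; apply: (ulim_le UF (@sq_error_cvg R m _ hd s U UF j Ps (Pr mu) mu_lim)); apply: Uinf.
  near=> n; apply: (torus_sq_error (p := p (M0 + n)%N) hd (Mn n) (pM _) (pkn n)) => [|k]; last exact: ps.
  have : (cubes j <= n)%N by near: n; exact: nbhs_infty_ge.
  by move: (cubes j) M00 => c; clear; lia.
rewrite -mulr_sumr; have -> : m%:R * 100 = m%:R * 50 * 2 :> R by ring.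
by rewrite ler_wpM2l ?mulr_ge0// sum_inv_sqr_le2.
Unshelve. all: by end_near.
Qed.

Theorem theorem5p5 (R : realType) (m d : nat) (hm : (2 <= m)%N) (hd : (2 <= d)%N)
    (s : 'I_m -> R) (s_ge0 : forall k, (0 <= s k)%R)
    (s_gt0 : (0 < \sum_k `|s k|)%R) (s_lt1 : (\sum_k `|s k| < 1)%R) :
  exists mu : probability (gradient_space m hd) R,
    [/\ ergodic mu, gradient_gibbs mu & has_slope mu s].
Proof.
case: d hd => [|[|q]] hd //.
have [mu0 [inv0 err0]] := torus_limit hd s_ge0 s_gt0 s_lt1.
have [mu [c [inv erg err]]] := @ergodic_exists R m _ hd (ltnW hm) (sq_error s)
  (@sq_error_ge0 R m _ hd s) (@sq_error_affine R m _ hd s) (@sq_error_local R m _ hd s)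
  (@sq_error_cvg R m _ hd s) mu0 _ inv0 err0.
by exists mu; split=> //; [exact: invariant_gibbs (ltnW hm) inv|exact: sq_error_slope err].
Qed.
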